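(* Let $f\in C^r(\mathbb{R},\mathbb{R})$ ($r$ a sufficiently large integer) satisfy: $f(0)=f'(0)=\dots=f^{(p-1)}(0)=0$ and $f^{(p)}(0)=a\,p!\neq 0$ for some odd integer $p\geq 3$. Then there exists a constant $C_{10}=C_{10}(f)>0$ such that for every $\omega\in\mathcal{W}$ and every integer $n\geq 1$ satisfying $$\frac{|\omega-1|\,n^2}{\gamma_\omega}\leq C_{10},$$ and with $\omega>1$ if $a>0$ (resp. $\omega<1$ if $a<0$), the equation $$u_{tt}-u_{xx}+f(u)=0,\qquad u(t,0)=u(t,\pi)=0$$ possesses at least one pair of even (in time) periodic classical $C^2$ solutions of minimal period $2\pi/(n\omega)$.
   Context: For $\gamma>0$, $W_\gamma:=\{\omega\in\mathbb{R} : |\omega l-j|\geq \gamma/l \text{ for all integers } l\geq 1,\ j\geq 0 \text{ with } j\neq l\}$; $\mathcal{W}:=\bigcup_{\gamma>0}W_\gamma$; for $\omega\in\mathcal{W}$, $\gamma_\omega:=\max\{\gamma : \omega\in W_\gamma\}$. A solution $u(t,x)$ is even in time if $u(-t,x)=u(t,x)$. A ''pair'' of solutions refers to $u(t,x)$ and $u(t+\pi,\pi-x)$, which are both solutions. *)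

(* Defs.v *)
From Stdlib Require Import Reals Lra Lia.
From Coquelicot Require Import Coquelicot.
Open Scope R_scope.

Definition Ck (r : nat) (f : R -> R) : Prop :=
  (forall k x, (k <= r)%nat -> ex_derive_n f k x) /\
  (forall x, continuous (Derive_n f r) x).

Definition d_t (u : R -> R -> R) : R -> R -> R :=
  fun t x => Derive (fun s => u s x) t.
Definition d_x (u : R -> R -> R) : R -> R -> R :=
  fun t x => Derive (fun y => u t y) x.

Definition partials_exist (g : R -> R -> R) : Prop :=
  forall t x, ex_derive (fun s => g s x) t /\ ex_derive (fun y => g t y) x.
Definition jcont (g : R -> R -> R) : Prop :=
  forall t x, continuous (fun q : R * R => g (fst q) (snd q)) (t, x).

Definition C2 (u : R -> R -> R) : Prop :=
  partials_exist u /\ partials_exist (d_t u) /\ partials_exist (d_x u) /\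
  jcont u /\ jcont (d_t u) /\ jcont (d_x u) /\
  jcont (d_t (d_t u)) /\ jcont (d_x (d_t u)) /\
  jcont (d_t (d_x u)) /\ jcont (d_x (d_x u)).

(* classical solution of u_tt - u_xx + f(u) = 0, u(t,0)=u(t,pi)=0, on the
   strip R x [0,pi] (u is the restriction of a C^2 function on R^2) *)
Definition is_solution (f : R -> R) (u : R -> R -> R) : Prop :=
  C2 u /\
  (forall t x, 0 <= x <= PI ->
     d_t (d_t u) t x - d_x (d_x u) t x + f (u t x) = 0) /\
  (forall t, u t 0 = 0 /\ u t PI = 0).

Definition even_in_time (u : R -> R -> R) : Prop :=
  forall t x, 0 <= x <= PI -> u (- t) x = u t x.

Definition has_period (u : R -> R -> R) (T : R) : Prop :=
  forall t x, 0 <= x <= PI -> u (t + T) x = u t x.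

Definition minimal_period (u : R -> R -> R) (T : R) : Prop :=
  0 < T /\ has_period u T /\
  (forall T', 0 < T' < T -> ~ has_period u T').

Definition in_W (gamma omega : R) : Prop :=
  forall l j : nat, (1 <= l)%nat -> j <> l ->
    Rabs (omega * INR l - INR j) >= gamma / INR l.

Definition is_gamma_omega (omega gamma : R) : Prop :=
  in_W gamma omega /\ (forall g, in_W g omega -> g <= gamma).

Definition in_Wcal (omega : R) : Prop :=
  exists gamma, 0 < gamma /\ in_W gamma omega.

(* Main.v *)
Require Import Defs.
From Stdlib Require Import Reals Lra Lia List Permutation Wf_nat Factorial FunctionalExtensionality ClassicalEpsilon.
From Stdlib Require Cantor.
From Coquelicot Require Import Coquelicot.
Open Scope R_scope.

(** Rescale time by [n * omega] and write [u = delta * U], [a * delta^(p-1) = mu] with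
    [mu = (omega^2 - 1) * n^2].  Then [U] is 2 pi-periodic and solves
    [(omega n)^2 U_tt - U_xx + mu g(U) = 0] where [g(y) = f(delta y) / (a delta^p)] is close to
    [y^p].  On the modes [cos(l t) sin(j x)] the wave operator has symbol
    [j^2 - (omega n l)^2]: it equals [- mu l^2] when [j = n l], and otherwise, since [omega]
    lies in [W_gamma], it dominates [mu] as soon as [C10] is small.  On trigonometric polynomials
    the non-resonant modes are therefore eliminated by an L2 contraction.  What remains is the
    critical point problem, on the resonant coefficients [xi], of a functional which is C1-close to
    [1/2 sum l^2 xi^2 - 1/(p+1) int v^(p+1)]; it is solved by minimising over the sphere of directions
    the maximum over the ray, the latter being attained at exactly one point.
    Estimates independent of the number of modes give a C2 limit, and a smaller period is excluded
    because undoing the dilation [v(t,x) -> v(d t,d x)] would lower the minimal level. *)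

(** * Finite sums and the normalised integral over the square *)

(** What makes one [C10] serve all [n] and [omega] is an exact compensation: a nonresonant symbol
    factors as [(j - om n l) (j + om n l)]. The first factor is at least [gamma / (n l)], by the
    definition of [W_gamma] at the index [n l], and the second is at least [om n l], so the symbol
    is at least [om gamma] and no derivative is lost. The sign condition linking [a] and [omega]
    says that [mu / a > 0]: only then is [delta] a positive real number and does the power term
    compete with the quadratic one. Sup norms come from weighted l2 norms whose weight has a
    summable inverse, uniformly in the slope of the characteristic line; this plays the part of a
    Sobolev embedding with constants blind to [n] and [omega]. Truncation makes the sphere of
    directions compact. No derivative of the eliminated modes with respect to [xi] is required,
    because the action is already stationary in those directions. The price is that bounds on
    derivatives, and the energy comparisons that decide the minimal period, must hold with constants
    independent of the truncation. *)

Fixpoint lsum {A : Type} (l : list A) (F : A -> R) : R :=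
  match l with nil => 0 | a :: l' => F a + lsum l' F end.

Section ListSums.
Context {A : Type}.
Implicit Types (l : list A) (F G : A -> R).

Lemma lsum_ext_in l F G : (forall a, In a l -> F a = G a) -> lsum l F = lsum l G.
Proof.
  induction l as [|a l IH]; simpl; intros H; [reflexivity|].
  rewrite (H a) by now left. rewrite IH; [reflexivity|]. intros; apply H; now right.
Qed.

Lemma lsum_plus l F G : lsum l (fun a => F a + G a) = lsum l F + lsum l G.
Proof. induction l as [|a l IH]; simpl; [lra|rewrite IH; lra]. Qed.

Lemma lsum_minus l F G : lsum l (fun a => F a - G a) = lsum l F - lsum l G.
Proof. induction l as [|a l IH]; simpl; [lra|rewrite IH; lra]. Qed.

Lemma lsum_scal l c F : lsum l (fun a => c * F a) = c * lsum l F.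
Proof. induction l as [|a l IH]; simpl; [lra|rewrite IH; lra]. Qed.

Lemma lsum_le l F G : (forall a, In a l -> F a <= G a) -> lsum l F <= lsum l G.
Proof.
  induction l as [|a l IH]; simpl; intros H; [lra|].
  apply Rplus_le_compat; [apply H; now left|apply IH; intros; apply H; now right].
Qed.

Lemma lsum_zero l : lsum l (fun _ => 0) = 0.
Proof. induction l as [|a l IH]; simpl; [lra|rewrite IH; lra]. Qed.

Lemma lsum_nonneg l F : (forall a, In a l -> 0 <= F a) -> 0 <= lsum l F.
Proof. intros H. rewrite <- (lsum_zero l). now apply lsum_le. Qed.

Lemma lsum_abs l F : Rabs (lsum l F) <= lsum l (fun a => Rabs (F a)).
Proof.
  induction l as [|a l IH]; simpl; [rewrite Rabs_R0; lra|].
  eapply Rle_trans; [apply Rabs_triang|lra].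
Qed.

Lemma lsum_app l l' F : lsum (l ++ l') F = lsum l F + lsum l' F.
Proof. induction l as [|a l IH]; simpl; [lra|rewrite IH; lra]. Qed.

Lemma lsum_term_le l F a :
  (forall b, In b l -> 0 <= F b) -> In a l -> F a <= lsum l F.
Proof.
  induction l as [|b l IH]; simpl; intros H [].
  - subst. assert (0 <= lsum l F) by (apply lsum_nonneg; intros; apply H; now right). lra.
  - assert (0 <= F b) by (apply H; now left).
    assert (F a <= lsum l F) by (apply IH; [intros; apply H; now right|assumption]). lra.
Qed.

Lemma lsum_CS l F G :
  (lsum l (fun a => F a * G a)) ^ 2 <= lsum l (fun a => F a ^ 2) * lsum l (fun a => G a ^ 2).
Proof.
  set (x := lsum l (fun a => F a ^ 2)). set (y := lsum l (fun a => F a * G a)).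
  set (z := lsum l (fun a => G a ^ 2)).
  assert (Hq : forall s, 0 <= x * s ^ 2 + 2 * y * s + z).
  { intros s.
    replace (x * s ^ 2 + 2 * y * s + z) with (lsum l (fun a => (F a * s + G a) ^ 2)).
    - apply lsum_nonneg; intros; apply pow2_ge_0.
    - rewrite (lsum_ext_in l _ (fun a => s ^ 2 * (F a ^ 2) + (2 * s) * (F a * G a) + G a ^ 2))
        by (intros; ring).
      rewrite !lsum_plus, !lsum_scal. fold x y z. ring. }
  assert (0 <= x) by (apply lsum_nonneg; intros; apply pow2_ge_0).
  assert (0 <= z) by (apply lsum_nonneg; intros; apply pow2_ge_0).
  destruct (Req_dec x 0) as [Hx|Hx].
  - rewrite Hx in *. destruct (Req_dec y 0) as [->|Hy]; [nra|].
    (* With leading coefficient zero the polynomial is affine in [s]; at this [s] it equals [-1]. *)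
    specialize (Hq (- (z + 1) / (2 * y))). exfalso.
    replace (0 * (- (z + 1) / (2 * y)) ^ 2 + 2 * y * (- (z + 1) / (2 * y)) + z) with (-1) in Hq
      by (field; assumption). lra.
  - specialize (Hq (- y / x)).
    replace (x * (- y / x) ^ 2 + 2 * y * (- y / x) + z) with ((x * z - y ^ 2) / x) in Hq
      by (field; assumption).
    assert (0 < x) by lra.
    apply (Rmult_le_compat_r x) in Hq; [|lra].
    unfold Rdiv in Hq. rewrite Rmult_assoc, Rinv_l in Hq by assumption. lra.
Qed.

Lemma lsum_perm l l' F : Permutation l l' -> lsum l F = lsum l' F.
Proof. induction 1; simpl; lra. Qed.

Lemma lsum_incl l l' F :
  NoDup l -> NoDup l' -> incl l l' ->
  (forall a, In a l' -> ~ In a l -> F a = 0) -> lsum l' F = lsum l F.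
Proof.
  revert l'. induction l as [|a l IH]; intros l' Hl Hl' Hi Hz.
  - simpl. rewrite (lsum_ext_in l' F (fun _ => 0)); [apply lsum_zero|].
    intros b Hb. apply Hz; [assumption|intros []].
  - inversion Hl; subst.
    destruct (in_split a l') as [l1 [l2 ->]]; [apply Hi; now left|].
    rewrite (lsum_perm (l1 ++ a :: l2) (a :: l1 ++ l2)) by (symmetry; apply Permutation_middle).
    simpl. f_equal. apply IH; auto.
    + eapply NoDup_remove_1; eauto.
    + intros b Hb.
      assert (Hb' : In b (l1 ++ a :: l2)) by (apply Hi; now right).
      apply in_app_or in Hb'. apply in_or_app.
      destruct Hb' as [|[->|]]; auto. contradiction.
    + intros b Hb Hn. apply Hz.
      * apply in_or_app. apply in_app_or in Hb. destruct Hb; [now left|right; now right].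
      * intros [->|]; [|contradiction].
        apply (NoDup_remove_2 l1 l2 b Hl'). assumption.
Qed.

Lemma lsum_incl_le l l' F :
  NoDup l -> NoDup l' -> incl l l' -> (forall a, In a l' -> 0 <= F a) -> lsum l F <= lsum l' F.
Proof.
  intros Hl Hl' Hi Hp.
  assert (dec : forall a, {In a l} + {~ In a l}) by (intros; apply excluded_middle_informative).
  rewrite (lsum_ext_in l F (fun a => if dec a then F a else 0)).
  2: { intros a Ha. destruct (dec a); [reflexivity|contradiction]. }
  rewrite <- (lsum_incl l l'); auto.
  - apply lsum_le. intros a Ha. destruct (dec a); [lra|auto].
  - intros a _ Hn'. destruct (dec a); [contradiction|reflexivity].
Qed.

Lemma lsum_single l F a : NoDup l -> In a l -> (forall b, In b l -> b <> a -> F b = 0) ->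
  lsum l F = F a.
Proof.
  intros Hl Ha Hz. rewrite (lsum_incl (a :: nil) l); [simpl; lra| |assumption| |].
  - constructor; [intros []|constructor].
  - intros b [->|[]]; assumption.
  - intros b Hb Hn. apply Hz; [assumption|]. intros ->. apply Hn. now left.
Qed.
End ListSums.

Lemma lsum_map {A B} (h : A -> B) l F : lsum (map h l) F = lsum l (fun a => F (h a)).
Proof. induction l as [|a l IH]; simpl; [reflexivity|rewrite IH; reflexivity]. Qed.

Lemma lsum_list_prod {A B} (l : list A) (l' : list B) F :
  lsum (list_prod l l') F = lsum l (fun a => lsum l' (fun b => F (a, b))).
Proof.
  induction l as [|a l IH]; simpl; [reflexivity|].
  rewrite lsum_app, IH, lsum_map. reflexivity.
Qed.

(** * One-variable integrals and joint continuity *)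

Definition cont (h : R -> R) : Prop := forall x, continuous h x.
Definition int (h : R -> R) : R := RInt h 0 PI.

Lemma cont_const c : cont (fun _ => c).
Proof. intros x; apply continuous_const. Qed.
Lemma cont_id : cont (fun x => x).
Proof. intros x; apply continuous_id. Qed.
Lemma cont_plus f g : cont f -> cont g -> cont (fun x => f x + g x).
Proof. intros Hf Hg x. apply (continuous_plus f g); auto. Qed.
Lemma cont_mult f g : cont f -> cont g -> cont (fun x => f x * g x).
Proof. intros Hf Hg x. apply (continuous_mult f g); auto. Qed.
Lemma cont_opp f : cont f -> cont (fun x => - f x).
Proof. intros Hf x. apply (continuous_opp f); auto. Qed.
Lemma cont_minus f g : cont f -> cont g -> cont (fun x => f x - g x).
Proof. intros Hf Hg x. apply (continuous_minus f g); auto. Qed.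
Lemma cont_comp f g : cont f -> cont g -> cont (fun x => g (f x)).
Proof. intros Hf Hg x. apply (continuous_comp f g); auto. Qed.
Lemma cont_pow f n : cont f -> cont (fun x => f x ^ n).
Proof.
  intros Hf. induction n; simpl; [apply cont_const|]. apply cont_mult; assumption.
Qed.
Lemma cont_derive f f' : (forall x, is_derive f x (f' x)) -> cont f.
Proof. intros H x. apply (ex_derive_continuous f). eexists; apply H. Qed.
Lemma cont_cos : cont cos. Proof. intros x. apply continuous_cos. Qed.
Lemma cont_sin : cont sin. Proof. intros x. apply continuous_sin. Qed.

Lemma jcont_const c : jcont (fun _ _ => c).
Proof. intros t x. apply continuous_const. Qed.
Lemma jcont_plus f g : jcont f -> jcont g -> jcont (fun t x => f t x + g t x).
Proof.
  intros Hf Hg t x.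
  apply (continuous_plus (fun q : R * R => f (fst q) (snd q)) (fun q => g (fst q) (snd q))); auto.
Qed.
Lemma jcont_mult f g : jcont f -> jcont g -> jcont (fun t x => f t x * g t x).
Proof.
  intros Hf Hg t x.
  apply (continuous_mult (fun q : R * R => f (fst q) (snd q)) (fun q => g (fst q) (snd q))); auto.
Qed.
Lemma jcont_opp f : jcont f -> jcont (fun t x => - f t x).
Proof. intros Hf t x. apply (continuous_opp (fun q : R * R => f (fst q) (snd q))); auto. Qed.
Lemma jcont_minus f g : jcont f -> jcont g -> jcont (fun t x => f t x - g t x).
Proof. intros Hf Hg. apply jcont_plus; [|apply jcont_opp]; assumption. Qed.
Lemma jcont_comp f g : jcont f -> cont g -> jcont (fun t x => g (f t x)).
Proof.
  intros Hf Hg t x. apply (continuous_comp (fun q : R * R => f (fst q) (snd q)) g); auto.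
Qed.
Lemma jcont_fst g : cont g -> jcont (fun t _ => g t).
Proof. intros Hg t x. apply (continuous_comp fst g); [apply continuous_fst|apply Hg]. Qed.
Lemma jcont_snd g : cont g -> jcont (fun _ x => g x).
Proof. intros Hg t x. apply (continuous_comp snd g); [apply continuous_snd|apply Hg]. Qed.
Lemma jcont_pow f n : jcont f -> jcont (fun t x => f t x ^ n).
Proof.
  intros Hf. induction n; simpl; [apply jcont_const|]. apply jcont_mult; assumption.
Qed.
Lemma jcont_lsum {A} (l : list A) (c : A -> R -> R -> R) :
  (forall a, jcont (c a)) -> jcont (fun t x => lsum l (fun a => c a t x)).
Proof.
  intros H. induction l; simpl; [apply jcont_const|]. apply jcont_plus; auto.
Qed.
Lemma jcont_reparam F h k : jcont F -> cont h -> cont k -> jcont (fun t x => F (h t) (k x)).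
Proof.
  intros HF Hh Hk t x.
  apply (continuous_comp_2 (fun q : R * R => h (fst q)) (fun q : R * R => k (snd q)) F).
  - apply (jcont_fst h Hh).
  - apply (jcont_snd k Hk).
  - apply HF.
Qed.
Lemma jcont_sec_t F x : jcont F -> cont (fun t => F t x).
Proof.
  intros HF t.
  apply (continuous_comp_2 (fun t : R => t) (fun _ : R => x) F).
  - apply continuous_id.
  - apply continuous_const.
  - apply HF.
Qed.
Lemma jcont_sec_x F t : jcont F -> cont (fun x => F t x).
Proof.
  intros HF x.
  apply (continuous_comp_2 (fun _ : R => t) (fun x : R => x) F).
  - apply continuous_const.
  - apply continuous_id.
  - apply HF.
Qed.

Create HintDb jc.
#[export] Hint Resolve cont_const cont_id cont_plus cont_mult cont_opp cont_minus cont_pow cont_cos cont_sin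
  jcont_const jcont_plus jcont_mult jcont_opp jcont_minus jcont_fst jcont_snd jcont_pow
  jcont_sec_t jcont_sec_x : jc.

Lemma ex_int h a b : cont h -> ex_RInt h a b.
Proof. intros H. apply (ex_RInt_continuous h). intros; apply H. Qed.
Lemma int_plus f g : cont f -> cont g -> int (fun x => f x + g x) = int f + int g.
Proof. intros Hf Hg. apply (RInt_plus f g); apply ex_int; assumption. Qed.
Lemma int_scal c f : cont f -> int (fun x => c * f x) = c * int f.
Proof. intros Hf. apply (RInt_scal f); apply ex_int; assumption. Qed.
Lemma int_ext f g : (forall x, 0 <= x <= PI -> f x = g x) -> int f = int g.
Proof.
  intros H. apply RInt_ext. intros x Hx. pose proof PI_RGT_0.
  rewrite Rmin_left, Rmax_right in Hx by lra. apply H; lra.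
Qed.
Lemma int_le f g : cont f -> cont g -> (forall x, 0 <= x <= PI -> f x <= g x) -> int f <= int g.
Proof.
  intros Hf Hg H. pose proof PI_RGT_0.
  apply RInt_le; [lra|apply ex_int; assumption|apply ex_int; assumption|].
  intros; apply H; lra.
Qed.
Lemma int_const c : int (fun _ => c) = PI * c.
Proof. unfold int. rewrite RInt_const. unfold scal; simpl; unfold mult; simpl. ring. Qed.

(** Uniform continuity of [F] over a compact strip makes the two integrands differ by at most
    [eps / (2 PI)] at every [t], hence the integrals by at most [eps / 2]. *)
Lemma cont_inner F : jcont F -> cont (fun x => int (fun t => F t x)).
Proof.
  intros HF x. apply continuity_pt_filterlim. intros eps Heps.
  pose proof PI_RGT_0 as Hpi.
  assert (H2 : 0 < eps / (2 * PI)) by (apply Rdiv_lt_0_compat; lra).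
  destruct (uniform_continuity_2d F 0 PI (x - 1) (x + 1)) with (eps := mkposreal _ H2) as [d Hd].
  { intros u v Hu Hv. apply continuity_2d_pt_filterlim. apply (HF u v). }
  exists (Rmin d 1). split; [apply Rmin_pos; [apply cond_pos|lra]|].
  intros y [_ Hy]. unfold dist in *; simpl in *. unfold R_dist in *.
  assert (Hy1 : Rabs (y - x) < d) by (eapply Rlt_le_trans; [apply Hy|apply Rmin_l]).
  assert (Hy2 : Rabs (y - x) < 1) by (eapply Rlt_le_trans; [apply Hy|apply Rmin_r]).
  assert (Hc : forall z, cont (fun t => F t z)) by (intros; auto with jc).
  replace (int (fun t => F t y) - int (fun t => F t x)) with (int (fun t => F t y + (-1) * F t x))
    by (rewrite int_plus, int_scal by auto with jc; ring).
  assert (Hb : forall t, 0 <= t <= PI -> Rabs (F t y - F t x) <= eps / (2 * PI)).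
  { intros t Ht. left. apply (Hd t x t y); try lra.
    - apply Rabs_def2 in Hy2; lra.
    - rewrite Rminus_diag, Rabs_R0. apply cond_pos. }
  apply Rle_lt_trans with (PI * (eps / (2 * PI))).
  - apply Rabs_le. split.
    + apply Rle_trans with (int (fun _ => - (eps / (2 * PI)))).
      * rewrite int_const. lra.
      * apply int_le; auto with jc. intros t Ht. specialize (Hb t Ht). apply Rabs_le_between in Hb. lra.
    + apply Rle_trans with (int (fun _ => eps / (2 * PI))).
      * apply int_le; auto with jc. intros t Ht. specialize (Hb t Ht). apply Rabs_le_between in Hb. lra.
      * rewrite int_const. lra.
  - replace (PI * (eps / (2 * PI))) with (eps / 2) by (field; lra). lra.
Qed.
#[export] Hint Resolve cont_inner : jc.

(** The factor makes the modes [psi 0] orthonormal; the total mass is then 4, the origin of most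
    factors 4 below. Half a time period is enough because in the application every integrand is even
    in time. *)
Definition Int2 (F : R -> R -> R) : R := 4 / PI ^ 2 * int (fun x => int (fun t => F t x)).

Lemma Int2_ext F G : (forall t x, 0 <= t <= PI -> 0 <= x <= PI -> F t x = G t x) -> Int2 F = Int2 G.
Proof. intros H. unfold Int2. f_equal. apply int_ext. intros. apply int_ext. intros; auto. Qed.
Lemma Int2_plus F G : jcont F -> jcont G -> Int2 (fun t x => F t x + G t x) = Int2 F + Int2 G.
Proof.
  intros HF HG. unfold Int2.
  rewrite (int_ext _ (fun x => int (fun t => F t x) + int (fun t => G t x))).
  - rewrite int_plus; auto with jc. ring.
  - intros. apply int_plus; auto with jc.
Qed.
Lemma Int2_scal c F : jcont F -> Int2 (fun t x => c * F t x) = c * Int2 F.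
Proof.
  intros HF. unfold Int2.
  rewrite (int_ext _ (fun x => c * int (fun t => F t x))).
  - rewrite int_scal; auto with jc. ring.
  - intros. apply int_scal; auto with jc.
Qed.
Lemma Int2_minus F G : jcont F -> jcont G -> Int2 (fun t x => F t x - G t x) = Int2 F - Int2 G.
Proof.
  intros HF HG. rewrite (Int2_ext _ (fun t x => F t x + (-1) * G t x)) by (intros; ring).
  rewrite Int2_plus, Int2_scal by auto with jc. ring.
Qed.
Lemma Int2_factor_pos : 0 < 4 / PI ^ 2.
Proof. pose proof PI_RGT_0. apply Rdiv_lt_0_compat; [lra|apply pow_lt; lra]. Qed.
Lemma Int2_le F G : jcont F -> jcont G ->
  (forall t x, 0 <= t <= PI -> 0 <= x <= PI -> F t x <= G t x) -> Int2 F <= Int2 G.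
Proof.
  intros HF HG H. unfold Int2. apply Rmult_le_compat_l; [left; apply Int2_factor_pos|].
  apply int_le; auto with jc. intros. apply int_le; auto with jc.
Qed.
Lemma Int2_const c : Int2 (fun _ _ => c) = 4 * c.
Proof.
  unfold Int2. rewrite (int_ext _ (fun _ => PI * c)) by (intros; apply int_const).
  rewrite int_const. field. apply PI_neq0.
Qed.
Lemma Int2_sep a b : cont a -> cont b ->
  Int2 (fun t x => a t * b x) = (2 / PI * int a) * (2 / PI * int b).
Proof.
  intros Ha Hb. unfold Int2.
  rewrite (int_ext _ (fun x => int a * b x)).
  - rewrite int_scal by assumption. field. apply PI_neq0.
  - intros. rewrite (int_ext _ (fun t => b x * a t)) by (intros; ring).
    rewrite int_scal by assumption. ring.
Qed.
Lemma Int2_lsum {A} (l : list A) (c : A -> R) (F : A -> R -> R -> R) :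
  (forall a, jcont (F a)) ->
  Int2 (fun t x => lsum l (fun a => c a * F a t x)) = lsum l (fun a => c a * Int2 (F a)).
Proof.
  intros H. induction l as [|a l IH]; simpl.
  - rewrite Int2_const; ring.
  - rewrite Int2_plus, Int2_scal, IH; auto with jc.
    apply (jcont_lsum l (fun a t x => c a * F a t x)). auto with jc.
Qed.
Lemma Int2_nonneg F : jcont F -> (forall t x, 0 <= t <= PI -> 0 <= x <= PI -> 0 <= F t x) -> 0 <= Int2 F.
Proof.
  intros HF H. replace 0 with (Int2 (fun _ _ => 0)) by (rewrite Int2_const; ring).
  apply Int2_le; auto with jc.
Qed.
Lemma Int2_abs_le F G : jcont F -> jcont G ->
  (forall t x, 0 <= t <= PI -> 0 <= x <= PI -> Rabs (F t x) <= G t x) -> Rabs (Int2 F) <= Int2 G.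
Proof.
  intros HF HG H. apply Rabs_le. split.
  - replace (- Int2 G) with (Int2 (fun t x => (-1) * G t x)) by (rewrite Int2_scal by assumption; ring).
    apply Int2_le; auto with jc. intros t x Ht Hx. specialize (H t x Ht Hx).
    apply Rabs_le_between in H. lra.
  - apply Int2_le; auto with jc. intros t x Ht Hx. specialize (H t x Ht Hx).
    apply Rabs_le_between in H. lra.
Qed.
Lemma Int2_CS F G : jcont F -> jcont G ->
  (Int2 (fun t x => F t x * G t x)) ^ 2 <= Int2 (fun t x => F t x ^ 2) * Int2 (fun t x => G t x ^ 2).
Proof.
  intros HF HG.
  set (x := Int2 (fun t x => F t x ^ 2)). set (y := Int2 (fun t x => F t x * G t x)).
  set (z := Int2 (fun t x => G t x ^ 2)).
  assert (Hq : forall s, 0 <= x * s ^ 2 + 2 * y * s + z).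
  { intros s.
    replace (x * s ^ 2 + 2 * y * s + z) with (Int2 (fun t x => (F t x * s + G t x) ^ 2)).
    - apply Int2_nonneg; auto 10 with jc. intros; apply pow2_ge_0.
    - rewrite (Int2_ext _ (fun t x => s ^ 2 * (F t x ^ 2) + (2 * s) * (F t x * G t x) + G t x ^ 2))
        by (intros; ring).
      rewrite !Int2_plus, !Int2_scal by auto 10 with jc. fold x y z. ring. }
  assert (0 <= x) by (apply Int2_nonneg; auto with jc; intros; apply pow2_ge_0).
  assert (0 <= z) by (apply Int2_nonneg; auto with jc; intros; apply pow2_ge_0).
  destruct (Req_dec x 0) as [Hx|Hx].
  - rewrite Hx in *. destruct (Req_dec y 0) as [->|Hy]; [nra|].
    specialize (Hq (- (z + 1) / (2 * y))). exfalso.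
    replace (0 * (- (z + 1) / (2 * y)) ^ 2 + 2 * y * (- (z + 1) / (2 * y)) + z) with (-1) in Hq
      by (field; assumption). lra.
  - specialize (Hq (- y / x)).
    replace (x * (- y / x) ^ 2 + 2 * y * (- y / x) + z) with ((x * z - y ^ 2) / x) in Hq
      by (field; assumption).
    assert (0 < x) by lra.
    apply (Rmult_le_compat_r x) in Hq; [|lra].
    unfold Rdiv in Hq. rewrite Rmult_assoc, Rinv_l in Hq by assumption. lra.
Qed.

(** Norms at most 1 instead of equal to 1: the time derivatives of odd order of the modes with
    [l = 0] vanish identically, yet these modes stay in the index list. *)
Definition suborth {A} (l : list A) (F : A -> R -> R -> R) : Prop :=
  NoDup l /\ (forall a, jcont (F a)) /\
  (forall a b, In a l -> In b l -> a <> b -> Int2 (fun t x => F a t x * F b t x) = 0) /\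
  (forall a, In a l -> Int2 (fun t x => F a t x ^ 2) <= 1).

Lemma suborth_coef {A} (l : list A) F (c : A -> R) a : suborth l F -> In a l ->
  Int2 (fun t x => lsum l (fun b => c b * F b t x) * F a t x) = c a * Int2 (fun t x => F a t x ^ 2).
Proof.
  intros (Hn & Hc & Ho & _) Ha.
  rewrite (Int2_ext _ (fun t x => lsum l (fun b => c b * (F b t x * F a t x)))).
  - rewrite (Int2_lsum l c (fun b t x => F b t x * F a t x)) by auto with jc.
    rewrite (lsum_single l _ a Hn Ha).
    + f_equal. apply Int2_ext. intros; ring.
    + intros b Hb Hne. rewrite Ho by auto. ring.
  - intros. rewrite Rmult_comm, <- lsum_scal. apply lsum_ext_in. intros; ring.
Qed.

Lemma suborth_sq_le {A} (l : list A) F (c : A -> R) : suborth l F ->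
  Int2 (fun t x => (lsum l (fun b => c b * F b t x)) ^ 2) <= lsum l (fun a => c a ^ 2).
Proof.
  intros Hs. pose proof Hs as (Hn & Hc & Ho & H1).
  rewrite (Int2_ext _ (fun t x => lsum l (fun a => c a * (lsum l (fun b => c b * F b t x) * F a t x)))).
  - rewrite (Int2_lsum l c (fun a t x => lsum l (fun b => c b * F b t x) * F a t x)).
    + apply lsum_le. intros a Ha. rewrite (suborth_coef l F c a Hs Ha).
      specialize (H1 a Ha). pose proof (pow2_ge_0 (c a)). nra.
    + intros a. apply jcont_mult; auto.
      apply (jcont_lsum l (fun b t x => c b * F b t x)); auto with jc.
  - intros. simpl. rewrite Rmult_1_r, <- lsum_scal. apply lsum_ext_in. intros; ring.
Qed.

(** The sum [P] of the [b a] times [F a] is not the orthogonal projection when some norms are below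
    1, but [<G, P> = sum b^2] and [|P|^2 <= sum b^2] are all that expanding [|G - P|^2 >= 0]
    requires. *)
Lemma bessel {A} (l : list A) F G : suborth l F -> jcont G ->
  lsum l (fun a => Int2 (fun t x => G t x * F a t x) ^ 2) <= Int2 (fun t x => G t x ^ 2).
Proof.
  intros Hs HG. pose proof Hs as (Hn & Hc & Ho & H1).
  set (b := fun a => Int2 (fun t x => G t x * F a t x)).
  set (P := fun t x => lsum l (fun a => b a * F a t x)).
  assert (HP : jcont P) by (apply (jcont_lsum l (fun a t x => b a * F a t x)); auto with jc).
  assert (H0 : 0 <= Int2 (fun t x => (G t x - P t x) ^ 2)).
  { apply Int2_nonneg; auto with jc. intros; apply pow2_ge_0. }
  rewrite (Int2_ext _ (fun t x => G t x ^ 2 + (-2) * (G t x * P t x) + P t x ^ 2)) in H0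
    by (intros; ring).
  rewrite !Int2_plus, Int2_scal in H0 by auto 10 with jc.
  pose proof (suborth_sq_le l F b Hs) as H2. fold P in H2.
  assert (H3 : Int2 (fun t x => G t x * P t x) = lsum l (fun a => b a ^ 2)).
  { rewrite (Int2_ext _ (fun t x => lsum l (fun a => b a * (G t x * F a t x)))).
    - rewrite (Int2_lsum l b (fun a t x => G t x * F a t x)) by auto with jc.
      apply lsum_ext_in. intros. unfold b at 1. simpl. fold (b a). unfold b. ring.
    - intros. unfold P. rewrite <- lsum_scal. apply lsum_ext_in. intros; ring. }
  change (lsum l (fun a => b a ^ 2) <= Int2 (fun t x => G t x ^ 2)).
  change (fun t x => (lsum l (fun b0 => b b0 * F b0 t x)) ^ 2) with (fun t x => P t x ^ 2) in H2.
  lra.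
Qed.

(** * Trigonometric modes *)

(** The constant function has mean square 1 over [[0, PI]], the other cosines have [1 / 2]; this
    factor makes all modes equally normalised. *)
Definition nrm (l : nat) : R := if Nat.eqb l 0 then / sqrt 2 else 1.
(* [tr i] is the i-th derivative of the cosine, for i <= 3. *)
Definition tr (i : nat) (s : R) : R :=
  match i with 0 => cos s | 1 => - sin s | 2 => - cos s | _ => sin s end.
Notation mode := (nat * nat)%type (only parsing).
(** [psi i] is the [i]-th time derivative of a mode with its factor [l^i] left out, and [chi i] the
    space derivative of [psi i] with its factor [j] left out. Stripped of these factors, both
    families are bounded by 1 and suborthonormal. *)
Definition psi (i : nat) (k : mode) (t x : R) : R :=
  nrm (fst k) * tr i (INR (fst k) * t) * sin (INR (snd k) * x).
Definition chi (i : nat) (k : mode) (t x : R) : R :=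
  nrm (fst k) * tr i (INR (fst k) * t) * cos (INR (snd k) * x).
Definition box (N : nat) : list mode := list_prod (seq 0 (S N)) (seq 1 N).

Lemma in_box N l j : In (l, j) (box N) <-> (l <= N /\ 1 <= j <= N)%nat.
Proof. unfold box. rewrite in_prod_iff, !in_seq. lia. Qed.

Lemma NoDup_list_prod {A B} (l : list A) (l' : list B) : NoDup l -> NoDup l' -> NoDup (list_prod l l').
Proof.
  intros Hl Hl'. induction Hl as [|a l Ha Hl IH]; simpl; [constructor|].
  apply NoDup_app.
  - apply FinFun.Injective_map_NoDup; [|assumption]. intros u v H. now inversion H.
  - assumption.
  - intros [u v] H1 H2. apply in_map_iff in H1. destruct H1 as [w [H1 _]].
    inversion H1; subst. apply in_prod_iff in H2. tauto.
Qed.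

Lemma NoDup_box N : NoDup (box N).
Proof. apply NoDup_list_prod; apply seq_NoDup. Qed.

Lemma box_incl N N' : (N <= N')%nat -> incl (box N) (box N').
Proof. intros H [l j]. rewrite !in_box. lia. Qed.

Lemma nrm_bound l : 0 < nrm l <= 1.
Proof.
  unfold nrm. destruct (Nat.eqb l 0); [|lra].
  assert (1 < sqrt 2) by (rewrite <- sqrt_1; apply sqrt_lt_1; lra).
  split; [apply Rinv_0_lt_compat; lra|].
  rewrite <- Rinv_1. apply Rinv_le_contravar; lra.
Qed.
Lemma nrm_0_sq : nrm 0 ^ 2 = / 2.
Proof.
  unfold nrm. simpl Nat.eqb. cbv iota. rewrite pow_inv, pow2_sqrt; lra.
Qed.

Lemma tr_bound i s : Rabs (tr i s) <= 1.
Proof.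
  destruct i as [|[|[|i]]]; simpl; rewrite ?Rabs_Ropp; apply Rabs_le;
    first [apply COS_bound|apply SIN_bound].
Qed.
Lemma Rabs_mult3_le a b c : Rabs a <= 1 -> Rabs b <= 1 -> Rabs c <= 1 -> Rabs (a * b * c) <= 1.
Proof.
  intros. rewrite !Rabs_mult. rewrite <- (Rmult_1_l 1).
  apply Rmult_le_compat; auto using Rabs_pos.
  - apply Rmult_le_pos; apply Rabs_pos.
  - rewrite <- (Rmult_1_l 1). apply Rmult_le_compat; auto using Rabs_pos.
Qed.
Lemma nrm_abs l : Rabs (nrm l) <= 1.
Proof. pose proof (nrm_bound l). rewrite Rabs_right; lra. Qed.
Lemma psi_bound i k t x : Rabs (psi i k t x) <= 1.
Proof.
  apply Rabs_mult3_le; [apply nrm_abs|apply tr_bound|apply Rabs_le, SIN_bound].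
Qed.
Lemma chi_bound i k t x : Rabs (chi i k t x) <= 1.
Proof.
  apply Rabs_mult3_le; [apply nrm_abs|apply tr_bound|apply Rabs_le, COS_bound].
Qed.

Lemma cont_lin c g : cont g -> cont (fun t => g (c * t)).
Proof. intros. apply (cont_comp (fun t => c * t)); auto with jc. Qed.
Lemma cont_tr i : cont (tr i).
Proof. destruct i as [|[|[|i]]]; simpl; auto with jc. apply (cont_opp sin), cont_sin. apply (cont_opp cos), cont_cos. Qed.
#[export] Hint Resolve cont_lin cont_tr : jc.
Lemma jcont_psi i k : jcont (psi i k).
Proof.
  unfold psi. apply jcont_mult.
  - apply jcont_mult; [apply jcont_const|].
    apply (jcont_fst (fun t => tr i (INR (fst k) * t))). auto with jc.
  - apply (jcont_snd (fun x => sin (INR (snd k) * x))). auto with jc.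
Qed.
Lemma jcont_chi i k : jcont (chi i k).
Proof.
  unfold chi. apply jcont_mult.
  - apply jcont_mult; [apply jcont_const|].
    apply (jcont_fst (fun t => tr i (INR (fst k) * t))). auto with jc.
  - apply (jcont_snd (fun x => cos (INR (snd k) * x))). auto with jc.
Qed.
#[export] Hint Resolve jcont_psi jcont_chi : jc.

Lemma sin_IZR_PI z : sin (IZR z * PI) = 0.
Proof. apply sin_eq_0_1. now exists z. Qed.
Lemma sin_INR_PI l : sin (INR l * PI) = 0.
Proof. rewrite INR_IZR_INZ. apply sin_IZR_PI. Qed.

Lemma int_cos_IZR z : z <> 0%Z -> int (fun t => cos (IZR z * t)) = 0.
Proof.
  intros Hz. apply is_RInt_unique.
  assert (Hz' : IZR z <> 0) by (apply not_0_IZR; assumption).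
  replace 0 with (sin (IZR z * PI) / IZR z - sin (IZR z * 0) / IZR z) at 2.
  - apply (is_RInt_derive (fun t => sin (IZR z * t) / IZR z)).
    + intros t _. auto_derive; [trivial|]. field. assumption.
    + intros t _. apply (cont_lin (IZR z) cos cont_cos t).
  - rewrite sin_IZR_PI, Rmult_0_r, sin_0. field. assumption.
Qed.

Lemma int_cos_cos l m : l <> m -> int (fun t => cos (INR l * t) * cos (INR m * t)) = 0.
Proof.
  intros H. rewrite !INR_IZR_INZ.
  rewrite (int_ext _ (fun t => / 2 * (cos (IZR (Z.of_nat l - Z.of_nat m) * t)
                                     + cos (IZR (Z.of_nat l + Z.of_nat m) * t)))).
  - rewrite int_scal, int_plus, !int_cos_IZR by (auto with jc || lia). ring.
  - intros t _. rewrite minus_IZR, plus_IZR, Rmult_minus_distr_r, Rmult_plus_distr_r, cos_minus, cos_plus.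
    field.
Qed.
Lemma int_sin_sin l m : l <> m -> int (fun t => sin (INR l * t) * sin (INR m * t)) = 0.
Proof.
  intros H. rewrite !INR_IZR_INZ.
  rewrite (int_ext _ (fun t => / 2 * (cos (IZR (Z.of_nat l - Z.of_nat m) * t)
                                     + (-1) * cos (IZR (Z.of_nat l + Z.of_nat m) * t)))).
  - destruct (Nat.eq_dec (l + m) 0) as [E|E]; [lia|].
    rewrite int_scal, int_plus, int_scal, !int_cos_IZR by (auto with jc || lia). ring.
  - intros t _. rewrite minus_IZR, plus_IZR, Rmult_minus_distr_r, Rmult_plus_distr_r, cos_minus, cos_plus.
    field.
Qed.
Lemma int_cos_sq l : l <> 0%nat -> int (fun t => cos (INR l * t) ^ 2) = PI / 2.
Proof.
  intros H. rewrite INR_IZR_INZ.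
  rewrite (int_ext _ (fun t => / 2 * (1 + cos (IZR (2 * Z.of_nat l) * t)))).
  - rewrite int_scal, int_plus, int_const, int_cos_IZR by (auto with jc || lia). field.
  - intros t _. rewrite mult_IZR, Rmult_assoc, cos_2a_cos. field.
Qed.
Lemma int_sin_sq l : l <> 0%nat -> int (fun t => sin (INR l * t) ^ 2) = PI / 2.
Proof.
  intros H.
  rewrite (int_ext _ (fun t => 1 + (-1) * cos (INR l * t) ^ 2)).
  - rewrite int_plus, int_scal, int_const, int_cos_sq by auto with jc. field.
  - intros t _. pose proof (sin2_cos2 (INR l * t)) as E. unfold Rsqr in E. lra.
Qed.

Lemma int_tr_orth i l m : l <> m ->
  int (fun t => tr i (INR l * t) * tr i (INR m * t)) = 0.
Proof.
  intros H. destruct i as [|[|[|i]]]; simpl.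
  - now apply int_cos_cos.
  - rewrite <- (int_sin_sin l m H). apply int_ext; intros; ring.
  - rewrite <- (int_cos_cos l m H). apply int_ext; intros; ring.
  - now apply int_sin_sin.
Qed.
Lemma int_tr_sq i l : 2 / PI * int (fun t => (nrm l * tr i (INR l * t)) ^ 2) <= 1.
Proof.
  pose proof PI_RGT_0 as Hpi.
  assert (E : int (fun t => (nrm l * tr i (INR l * t)) ^ 2)
              = nrm l ^ 2 * int (fun t => tr i (INR l * t) ^ 2)).
  { rewrite <- int_scal by auto with jc. apply int_ext; intros; ring. }
  rewrite E. clear E. destruct (Nat.eq_dec l 0) as [->|Hl].
  - rewrite nrm_0_sq.
    assert (int (fun t => tr i (INR 0 * t) ^ 2) <= PI * 1).
    { rewrite <- int_const. apply int_le; auto with jc. intros t _.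
      pose proof (tr_bound i (INR 0 * t)) as E. apply Rabs_le_between in E. nra. }
    apply Rle_trans with (2 / PI * (/ 2 * (PI * 1))); [|right; field; lra].
    apply Rmult_le_compat_l; [apply Rlt_le, Rdiv_lt_0_compat; lra|lra].
  - unfold nrm. replace (Nat.eqb l 0) with false by (symmetry; now apply Nat.eqb_neq).
    assert (E : int (fun t => tr i (INR l * t) ^ 2) = PI / 2).
    { destruct i as [|[|[|i]]]; simpl tr.
      - now apply int_cos_sq.
      - rewrite <- (int_sin_sq l Hl). apply int_ext; intros; ring.
      - rewrite <- (int_cos_sq l Hl). apply int_ext; intros; ring.
      - now apply int_sin_sq. }
    rewrite E. right. field. lra.
Qed.

Lemma psi_orth i k k' : k <> k' -> Int2 (fun t x => psi i k t x * psi i k' t x) = 0.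
Proof.
  destruct k as [l j], k' as [m q]. intros H. unfold psi; simpl fst; simpl snd.
  rewrite (Int2_ext _ (fun t x => (nrm l * nrm m * (tr i (INR l * t) * tr i (INR m * t)))
     * (sin (INR j * x) * sin (INR q * x)))) by (intros; ring).
  rewrite Int2_sep by auto with jc. rewrite int_scal by auto with jc.
  destruct (Nat.eq_dec l m) as [->|E].
  - rewrite (int_sin_sin j q) by congruence. ring.
  - rewrite int_tr_orth by assumption. ring.
Qed.
Lemma chi_orth i k k' : k <> k' -> Int2 (fun t x => chi i k t x * chi i k' t x) = 0.
Proof.
  destruct k as [l j], k' as [m q]. intros H. unfold chi; simpl fst; simpl snd.
  rewrite (Int2_ext _ (fun t x => (nrm l * nrm m * (tr i (INR l * t) * tr i (INR m * t)))
     * (cos (INR j * x) * cos (INR q * x)))) by (intros; ring).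
  rewrite Int2_sep by auto with jc. rewrite int_scal by auto with jc.
  destruct (Nat.eq_dec l m) as [->|E].
  - rewrite (int_cos_cos j q) by congruence. ring.
  - rewrite int_tr_orth by assumption. ring.
Qed.
Lemma psi_sq i l j : j <> 0%nat -> Int2 (fun t x => psi i (l, j) t x ^ 2) <= 1.
Proof.
  intros H. unfold psi; simpl fst; simpl snd.
  rewrite (Int2_ext _ (fun t x => ((nrm l * tr i (INR l * t)) ^ 2) * (sin (INR j * x) ^ 2)))
    by (intros; ring).
  rewrite Int2_sep by auto with jc. rewrite (int_sin_sq j H).
  pose proof (int_tr_sq i l). replace (2 / PI * (PI / 2)) with 1 by (field; apply PI_neq0). lra.
Qed.
Lemma chi_sq i l j : j <> 0%nat -> Int2 (fun t x => chi i (l, j) t x ^ 2) <= 1.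
Proof.
  intros H. unfold chi; simpl fst; simpl snd.
  rewrite (Int2_ext _ (fun t x => ((nrm l * tr i (INR l * t)) ^ 2) * (cos (INR j * x) ^ 2)))
    by (intros; ring).
  rewrite Int2_sep by auto with jc. rewrite (int_cos_sq j H).
  pose proof (int_tr_sq i l). replace (2 / PI * (PI / 2)) with 1 by (field; apply PI_neq0). lra.
Qed.
Lemma psi0_sq l j : j <> 0%nat -> Int2 (fun t x => psi 0 (l, j) t x ^ 2) = 1.
Proof.
  intros H. unfold psi; simpl fst; simpl snd. simpl tr.
  rewrite (Int2_ext _ (fun t x => (nrm l ^ 2 * cos (INR l * t) ^ 2) * (sin (INR j * x) ^ 2)))
    by (intros; ring).
  rewrite Int2_sep by auto with jc. rewrite (int_sin_sq j H), int_scal by auto with jc.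
  replace (2 / PI * (PI / 2)) with 1 by (field; apply PI_neq0).
  destruct (Nat.eq_dec l 0) as [->|Hl].
  - rewrite nrm_0_sq. rewrite (int_ext _ (fun _ => 1)).
    + rewrite int_const. field. apply PI_neq0.
    + intros. simpl INR. rewrite Rmult_0_l, cos_0. ring.
  - rewrite int_cos_sq by assumption.
    unfold nrm. replace (Nat.eqb l 0) with false by (symmetry; now apply Nat.eqb_neq).
    field. apply PI_neq0.
Qed.

Lemma psi_suborth i N : suborth (box N) (psi i).
Proof.
  split; [apply NoDup_box|]. split; [intros; apply jcont_psi|]. split.
  - intros; now apply psi_orth.
  - intros [l j] H. apply in_box in H. apply psi_sq. lia.
Qed.
Lemma chi_suborth i N : suborth (box N) (chi i).
Proof.
  split; [apply NoDup_box|]. split; [intros; apply jcont_chi|]. split.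
  - intros; now apply chi_orth.
  - intros [l j] H. apply in_box in H. apply chi_sq. lia.
Qed.

(** * Integration by parts against the modes *)

Lemma int_derive (f df : R -> R) : (forall t, is_derive f t (df t)) -> cont df ->
  int df = f PI - f 0.
Proof.
  intros Hf Hc. apply is_RInt_unique. apply (is_RInt_derive f); intros; auto.
Qed.

Lemma is_derive_tr i c t : (i <= 2)%nat -> is_derive (fun s => tr i (c * s)) t (c * tr (S i) (c * t)).
Proof.
  intros Hi. destruct i as [|[|[|i]]]; simpl; [| | |lia]; (auto_derive; [trivial|ring]).
Qed.
Lemma is_derive_tr_S i c t : (i <= 2)%nat ->
  is_derive (fun s => tr (S i) (c * s)) t (- (c * tr i (c * t))).
Proof.
  intros Hi. destruct i as [|[|[|i]]]; simpl; [| | |lia]; (auto_derive; [trivial|ring]).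
Qed.
Lemma tr_odd_0 i : (i <= 2)%nat -> i <> 1%nat -> forall l, tr (S i) (INR l * 0) = 0 /\ tr (S i) (INR l * PI) = 0.
Proof.
  intros Hi H1 l. destruct i as [|[|[|i]]]; simpl; try lia; rewrite Rmult_0_r, sin_0, sin_INR_PI; lra.
Qed.

(** The boundary term carries [tr (S i)], a sine up to sign when [i] is 0 or 2, which vanishes at
    [0] and [PI]. For [i = 1] it is a cosine and [F] itself has to vanish there. *)
Lemma parts_t F F' i k : (i <= 2)%nat -> jcont F -> jcont F' ->
  (forall t x, is_derive (fun s => F s x) t (F' t x)) ->
  (i = 1%nat -> forall x, F 0 x = 0 /\ F PI x = 0) ->
  INR (fst k) * Int2 (fun t x => F t x * psi i k t x) = Int2 (fun t x => F' t x * psi (S i) k t x).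
Proof.
  intros Hi HF HF' HD Hb. rewrite <- Int2_scal by auto with jc.
  unfold Int2. f_equal. apply int_ext. intros x _. destruct k as [l j]. unfold psi; simpl fst; simpl snd.
  set (z := nrm l * sin (INR j * x)).
  assert (E : int (fun t => F' t x * (z * tr (S i) (INR l * t))
       + F t x * (z * (- (INR l * tr i (INR l * t))))) = 0).
  { rewrite (int_derive (fun t => F t x * (z * tr (S i) (INR l * t)))).
    - destruct (Nat.eq_dec i 1) as [->|H1].
      + destruct (Hb eq_refl x) as [-> ->]. ring.
      + destruct (tr_odd_0 i Hi H1 l) as [-> ->]. ring.
    - intros t. apply (is_derive_mult (fun s => F s x) (fun s => z * tr (S i) (INR l * s))); auto.
      + apply is_derive_scal. now apply is_derive_tr_S.
      + intros; apply Rmult_comm.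
    - auto 10 with jc. }
  rewrite int_plus in E by auto 10 with jc.
  rewrite (int_ext (fun t => F' t x * (nrm l * tr (S i) (INR l * t) * sin (INR j * x)))
    (fun t => F' t x * (z * tr (S i) (INR l * t)))) by (intros; unfold z; ring).
  rewrite (int_ext (fun t => INR l * (F t x * (nrm l * tr i (INR l * t) * sin (INR j * x))))
    (fun t => (-1) * (F t x * (z * - (INR l * tr i (INR l * t)))))) by (intros; unfold z; ring).
  rewrite int_scal by auto 10 with jc. lra.
Qed.

Lemma derive_inner F F' : jcont F -> jcont F' ->
  (forall t x, is_derive (fun y => F t y) x (F' t x)) ->
  forall x, is_derive (fun y => int (fun t => F t y)) x (int (fun t => F' t x)).
Proof.
  intros HF HF' HD x.
  assert (ED : forall t y, Derive (fun z => F t z) y = F' t y)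
    by (intros; apply is_derive_unique; auto).
  rewrite <- (int_ext (fun t => Derive (fun z => F t z) x)) by (intros; apply ED).
  apply (is_derive_RInt_param (fun y t => F t y) 0 PI x).
  - apply filter_forall. intros y t _. eexists. apply HD.
  - intros t _. apply (continuity_2d_pt_ext (fun y s => F' s y)); [intros; symmetry; apply ED|].
    apply continuity_2d_pt_filterlim.
    apply (continuous_comp_2 (fun q : R * R => snd q) (fun q : R * R => fst q) F').
    + apply continuous_snd.
    + apply continuous_fst.
    + apply HF'.
  - apply filter_forall. intros y. apply ex_int. auto with jc.
Qed.

(** [Int2] integrates over [t] inside, so the time factor is integrated out first, the resulting
    function [h] of [x] is differentiated under the integral sign, and the parts are taken in [x].
    The cosine does not vanish at the ends; the Dirichlet condition on [F] does the work. *)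
Lemma parts_x F F' i k : jcont F -> jcont F' ->
  (forall t x, is_derive (fun y => F t y) x (F' t x)) ->
  (forall t, F t 0 = 0 /\ F t PI = 0) ->
  INR (snd k) * Int2 (fun t x => F t x * psi i k t x) = Int2 (fun t x => F' t x * chi i k t x).
Proof.
  intros HF HF' HD Hb. rewrite <- Int2_scal by auto with jc. destruct k as [l j].
  unfold psi, chi; simpl fst; simpl snd.
  set (a := fun t => nrm l * tr i (INR l * t)).
  assert (Ha : jcont (fun t _ => a t)) by (unfold a; auto with jc).
  set (h := fun x => int (fun t => F t x * a t)).
  set (h' := fun x => int (fun t => F' t x * a t)).
  assert (Hh : cont h) by (unfold h; auto with jc).
  assert (Hh' : cont h') by (unfold h'; auto with jc).
  assert (Hd : forall x, is_derive h x (h' x)).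
  { intros x. apply (derive_inner (fun t x => F t x * a t) (fun t x => F' t x * a t)); auto with jc.
    intros t y. exact (is_derive_scal_l (fun z => F t z) y (F' t y) (a t) (HD t y)). }
  assert (Hz : h 0 = 0 /\ h PI = 0).
  { split; unfold h; rewrite (int_ext _ (fun _ => 0)); try (rewrite int_const; ring);
      intros t _; destruct (Hb t) as [E1 E2]; rewrite ?E1, ?E2; ring. }
  assert (E : int (fun x => h' x * cos (INR j * x) + h x * (- (INR j * sin (INR j * x)))) = 0 - 0).
  { destruct Hz as [E1 E2].
    replace (0 - 0) with (h PI * cos (INR j * PI) - h 0 * cos (INR j * 0)) by (rewrite E1, E2; ring).
    apply (int_derive (fun x => h x * cos (INR j * x))).
    - intros x. apply (is_derive_mult h (fun y => cos (INR j * y))); auto.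
      + auto_derive; [trivial|ring].
      + intros; apply Rmult_comm.
    - auto 10 with jc. }
  rewrite int_plus in E by auto 10 with jc.
  unfold Int2. f_equal.
  rewrite (int_ext _ (fun x => (-1) * (h x * - (INR j * sin (INR j * x))))).
  - rewrite int_scal by auto 10 with jc.
    rewrite (int_ext (fun x => int (fun t => F' t x * (nrm l * tr i (INR l * t) * cos (INR j * x))))
       (fun x => h' x * cos (INR j * x))); [lra|].
    intros x _. rewrite (Rmult_comm (h' x)). unfold h'. rewrite <- int_scal by (unfold a; auto with jc).
    apply int_ext; intros; unfold a; ring.
  - intros x _. unfold h.
    replace (-1 * (int (fun t => F t x * a t) * - (INR j * sin (INR j * x))))
      with ((INR j * sin (INR j * x)) * int (fun t => F t x * a t)) by ring.
    rewrite <- int_scal by (unfold a; auto with jc).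
    apply int_ext; intros; unfold a; ring.
Qed.

(** * Trigonometric polynomials *)

(** Quadratic growth in [l] and in the distance of [j] from a curve [j = Om l]. Three curves occur:
    [om n l] (the characteristic line), [n l] (the resonant modes) and [0]. *)
Definition wt (Om : nat -> R) (k : mode) : R :=
  (1 + INR (fst k) ^ 2) * (1 + (INR (snd k) - Om (fst k)) ^ 2).

Lemma wt_ge1 Om k : 1 <= wt Om k.
Proof.
  unfold wt. pose proof (pow2_ge_0 (INR (fst k))).
  pose proof (pow2_ge_0 (INR (snd k) - Om (fst k))). nra.
Qed.

(** The mean value theorem gives [1 / (1 + c^2)] with [c] within distance 1 of [t], and then
    [1 + c^2 <= 3 (1 + t^2)]. *)
Lemma inv_sq_le_atan t : / (1 + t ^ 2) <= 3 * (atan (t + 1) - atan t).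
Proof.
  destruct (MVT_gen atan t (t + 1) (fun x => / (1 + x ^ 2))) as [c [Hc E]].
  - intros x _. auto_derive; [trivial|]. field. nra.
  - intros x _. apply continuity_pt_filterlim. apply (ex_derive_continuous atan).
    eexists. apply is_derive_atan.
  - rewrite E. rewrite Rmin_left, Rmax_right in Hc by lra.
    replace (t + 1 - t) with 1 by ring. rewrite Rmult_1_r.
    assert (H1 : 0 < 1 + t ^ 2) by nra. assert (H2 : 0 < 1 + c ^ 2) by nra.
    replace (3 * / (1 + c ^ 2)) with (/ ((1 + c ^ 2) / 3)) by (field; nra).
    apply Rinv_le_contravar; [lra|].
    assert ((c - t) ^ 2 <= 1) by nra. pose proof (pow2_ge_0 (2 * t - c)). pose proof (pow2_ge_0 t).
    assert (c ^ 2 <= 2 * t ^ 2 + 2) by nra. lra.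
Qed.

(** The bound by increments of [atan] telescopes; the total increment is below [PI <= 4], whence
    [12 = 3 * 4]. The shift [w] disappears, as the increments of [atan] are bounded whatever the
    starting point. *)
Lemma lsum_inv_sq_le w a m :
  lsum (seq a m) (fun j => / (1 + (INR j - w) ^ 2)) <= 12.
Proof.
  assert (H : lsum (seq a m) (fun j => / (1 + (INR j - w) ^ 2))
              <= 3 * (atan (INR (a + m) - w) - atan (INR a - w))).
  { revert a. induction m as [|m IH]; intros a; simpl.
    - rewrite Nat.add_0_r. lra.
    - specialize (IH (S a)). pose proof (inv_sq_le_atan (INR a - w)) as E.
      replace (INR a - w + 1) with (INR (S a) - w) in E by (rewrite S_INR; ring).
      replace (a + S m)%nat with (S a + m)%nat by lia. simpl in E, IH |- *. lra. }
  pose proof (atan_bound (INR (a + m) - w)). pose proof (atan_bound (INR a - w)).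
  pose proof PI_4. lra.
Qed.

(** Summing over [j] at fixed [l] costs 12 for any value of [Om l], and summing over [l] costs 12
    again. The absence of [Om] from the bound is what keeps later constants free of [n] and
    [omega]. *)
Lemma wt_sum Om N : lsum (box N) (fun k => / wt Om k) <= 144.
Proof.
  unfold box. rewrite lsum_list_prod.
  rewrite (lsum_ext_in _ _ (fun l => / (1 + (INR l - 0) ^ 2) *
     lsum (seq 1 N) (fun j => / (1 + (INR j - Om l) ^ 2)))).
  - apply Rle_trans with (lsum (seq 0 (S N)) (fun l => 12 * / (1 + (INR l - 0) ^ 2))).
    + apply lsum_le. intros l _. rewrite (Rmult_comm 12). apply Rmult_le_compat_l.
      * left. apply Rinv_0_lt_compat. nra.
      * apply lsum_inv_sq_le.
    + rewrite lsum_scal. pose proof (lsum_inv_sq_le 0 0 (S N)). lra.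
  - intros l _. rewrite <- lsum_scal. apply lsum_ext_in. intros j _. unfold wt; simpl fst; simpl snd.
    rewrite Rinv_mult, Rminus_0_r. reflexivity.
Qed.

Lemma lsum_wt_CS {l : list mode} Om z :
  (lsum l (fun k => Rabs (z k))) ^ 2 <= lsum l (fun k => / wt Om k) * lsum l (fun k => wt Om k * z k ^ 2).
Proof.
  assert (Hw : forall k, 0 < wt Om k) by (intros k; pose proof (wt_ge1 Om k); lra).
  rewrite (lsum_ext_in l (fun k => Rabs (z k))
     (fun k => / sqrt (wt Om k) * (sqrt (wt Om k) * Rabs (z k)))).
  - eapply Rle_trans; [apply lsum_CS|]. right. f_equal.
    + apply lsum_ext_in. intros k _. rewrite pow_inv, pow2_sqrt; [reflexivity|left; apply Hw].
    + apply lsum_ext_in. intros k _. rewrite Rpow_mult_distr, pow2_sqrt by (left; apply Hw).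
      rewrite pow2_abs. reflexivity.
  - intros k _. field. apply Rgt_not_eq, sqrt_lt_R0, Hw.
Qed.

(** Acts as the Sobolev embedding: modes are bounded by 1, so the l1 norm of the coefficients
    dominates the sup norm of the polynomial. *)
Lemma l1_le_wt Om z N :
  (lsum (box N) (fun k => Rabs (z k))) ^ 2 <= 144 * lsum (box N) (fun k => wt Om k * z k ^ 2).
Proof.
  eapply Rle_trans; [apply (lsum_wt_CS Om)|].
  apply Rmult_le_compat_r; [|apply wt_sum].
  apply lsum_nonneg. intros k _. pose proof (wt_ge1 Om k). pose proof (pow2_ge_0 (z k)). nra.
Qed.

(** The [i]-th time derivative (for [i <= 3]) of the trigonometric polynomial with coefficients [c];
    [upx] is the space derivative of that. *)
Definition up (N i : nat) (c : mode -> R) (t x : R) : R :=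
  lsum (box N) (fun k => (c k * INR (fst k) ^ i) * psi i k t x).
Definition upx (N i : nat) (c : mode -> R) (t x : R) : R :=
  lsum (box N) (fun k => (c k * INR (fst k) ^ i * INR (snd k)) * chi i k t x).

Lemma is_derive_lsum {A} (l : list A) (f f' : A -> R -> R) t :
  (forall a, is_derive (f a) t (f' a t)) ->
  is_derive (fun s => lsum l (fun a => f a s)) t (lsum l (fun a => f' a t)).
Proof.
  intros H. induction l as [|a l IH]; simpl; [apply (is_derive_const 0)|].
  apply (is_derive_plus (f a)); auto.
Qed.

Lemma is_derive_psi_t i k t x : (i <= 2)%nat ->
  is_derive (fun s => psi i k s x) t (INR (fst k) * psi (S i) k t x).
Proof.
  intros Hi. unfold psi.
  pose proof (is_derive_tr i (INR (fst k)) t Hi) as H.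
  apply (is_derive_scal _ _ (nrm (fst k))) in H.
  pose proof (is_derive_scal_l _ _ _ (sin (INR (snd k) * x)) H) as H'.
  unfold scal in H'; simpl in H'; unfold mult in H'; simpl in H'.
  replace (INR (fst k) * (nrm (fst k) * tr (S i) (INR (fst k) * t) * sin (INR (snd k) * x)))
    with (nrm (fst k) * (INR (fst k) * tr (S i) (INR (fst k) * t)) * sin (INR (snd k) * x)) by ring.
  exact H'.
Qed.
Lemma is_derive_psi_x i k t x :
  is_derive (fun y => psi i k t y) x (INR (snd k) * chi i k t x).
Proof. unfold psi, chi. auto_derive; [trivial|ring]. Qed.
Lemma is_derive_chi_x i k t x :
  is_derive (fun y => chi i k t y) x (- INR (snd k) * psi i k t x).
Proof. unfold psi, chi. auto_derive; [trivial|ring]. Qed.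
Lemma is_derive_chi_t i k t x : (i <= 2)%nat ->
  is_derive (fun s => chi i k s x) t (INR (fst k) * chi (S i) k t x).
Proof.
  intros Hi. unfold chi.
  pose proof (is_derive_tr i (INR (fst k)) t Hi) as H.
  apply (is_derive_scal _ _ (nrm (fst k))) in H.
  pose proof (is_derive_scal_l _ _ _ (cos (INR (snd k) * x)) H) as H'.
  unfold scal in H'; simpl in H'; unfold mult in H'; simpl in H'.
  replace (INR (fst k) * (nrm (fst k) * tr (S i) (INR (fst k) * t) * cos (INR (snd k) * x)))
    with (nrm (fst k) * (INR (fst k) * tr (S i) (INR (fst k) * t)) * cos (INR (snd k) * x)) by ring.
  exact H'.
Qed.

Section Poly.
Variable N : nat.
Implicit Type c : mode -> R.

Lemma jcont_up i c : jcont (up N i c).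
Proof. apply (jcont_lsum (box N) (fun k t x => (c k * INR (fst k) ^ i) * psi i k t x)). auto with jc. Qed.
Lemma jcont_upx i c : jcont (upx N i c).
Proof.
  apply (jcont_lsum (box N) (fun k t x => (c k * INR (fst k) ^ i * INR (snd k)) * chi i k t x)).
  auto with jc.
Qed.

Lemma is_derive_up_t i c t x : (i <= 2)%nat -> is_derive (fun s => up N i c s x) t (up N (S i) c t x).
Proof.
  intros Hi. unfold up.
  rewrite (lsum_ext_in _ _ (fun k => (c k * INR (fst k) ^ i) * (INR (fst k) * psi (S i) k t x)))
    by (intros; simpl; ring).
  apply (is_derive_lsum (box N) (fun k s => (c k * INR (fst k) ^ i) * psi i k s x)
     (fun k s => (c k * INR (fst k) ^ i) * (INR (fst k) * psi (S i) k s x))).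
  intros k. apply is_derive_scal. now apply is_derive_psi_t.
Qed.
Lemma is_derive_upx_t i c t x : (i <= 2)%nat ->
  is_derive (fun s => upx N i c s x) t (upx N (S i) c t x).
Proof.
  intros Hi. unfold upx.
  rewrite (lsum_ext_in _ _ (fun k => (c k * INR (fst k) ^ i * INR (snd k)) * (INR (fst k) * chi (S i) k t x)))
    by (intros; simpl; ring).
  apply (is_derive_lsum (box N) (fun k s => (c k * INR (fst k) ^ i * INR (snd k)) * chi i k s x)
     (fun k s => (c k * INR (fst k) ^ i * INR (snd k)) * (INR (fst k) * chi (S i) k s x))).
  intros k. apply is_derive_scal. now apply is_derive_chi_t.
Qed.
Lemma is_derive_up_x i c t x : is_derive (fun y => up N i c t y) x (upx N i c t x).
Proof.
  unfold up, upx.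
  rewrite (lsum_ext_in _ _ (fun k => (c k * INR (fst k) ^ i) * (INR (snd k) * chi i k t x)))
    by (intros; simpl; ring).
  apply (is_derive_lsum (box N) (fun k y => (c k * INR (fst k) ^ i) * psi i k t y)
     (fun k y => (c k * INR (fst k) ^ i) * (INR (snd k) * chi i k t y))).
  intros k. apply is_derive_scal. apply is_derive_psi_x.
Qed.

Lemma up_sup i c t x : Rabs (up N i c t x) <= lsum (box N) (fun k => INR (fst k) ^ i * Rabs (c k)).
Proof.
  unfold up. eapply Rle_trans; [apply lsum_abs|]. apply lsum_le. intros k _.
  rewrite !Rabs_mult. rewrite (Rabs_right (INR (fst k) ^ i)) by (apply Rle_ge, pow_le, pos_INR).
  pose proof (psi_bound i k t x).
  assert (0 <= Rabs (c k) * INR (fst k) ^ i)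
    by (apply Rmult_le_pos; [apply Rabs_pos|apply pow_le, pos_INR]).
  nra.
Qed.
Lemma up_L2 i c : Int2 (fun t x => up N i c t x ^ 2) <= lsum (box N) (fun k => (c k * INR (fst k) ^ i) ^ 2).
Proof. apply (suborth_sq_le (box N) (psi i) (fun k => c k * INR (fst k) ^ i)), psi_suborth. Qed.
Lemma upx_L2 i c : Int2 (fun t x => upx N i c t x ^ 2)
  <= lsum (box N) (fun k => (c k * INR (fst k) ^ i * INR (snd k)) ^ 2).
Proof. apply (suborth_sq_le (box N) (chi i) (fun k => c k * INR (fst k) ^ i * INR (snd k))), chi_suborth. Qed.

Lemma up_minus i c c' t x : up N i c t x - up N i c' t x = up N i (fun k => c k - c' k) t x.
Proof. unfold up. rewrite <- lsum_minus. apply lsum_ext_in; intros; ring. Qed.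
Lemma up_plus i c c' t x : up N i c t x + up N i c' t x = up N i (fun k => c k + c' k) t x.
Proof. unfold up. rewrite <- lsum_plus. apply lsum_ext_in; intros; ring. Qed.
Lemma up_scal i a c t x : up N i (fun k => a * c k) t x = a * up N i c t x.
Proof. unfold up. rewrite <- lsum_scal. apply lsum_ext_in; intros; ring. Qed.
Lemma up_ext i c c' t x : (forall k, In k (box N) -> c k = c' k) -> up N i c t x = up N i c' t x.
Proof. intros H. apply lsum_ext_in. intros k Hk. now rewrite (H k Hk). Qed.
Lemma psi_x_0 i k t : psi i k t 0 = 0 /\ psi i k t PI = 0.
Proof. unfold psi. rewrite Rmult_0_r, sin_0, sin_INR_PI. lra. Qed.
Lemma up_x_0 i c t : up N i c t 0 = 0 /\ up N i c t PI = 0.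
Proof.
  unfold up. split; rewrite (lsum_ext_in _ _ (fun _ => 0)); try apply lsum_zero;
    intros k _; destruct (psi_x_0 i k t) as [E1 E2]; rewrite ?E1, ?E2; ring.
Qed.
(** Supplies the vanishing at the ends of the time interval that [parts_t] asks for when [i = 1]. *)
Lemma up1_t_0 c x : up N 1 c 0 x = 0 /\ up N 1 c PI x = 0.
Proof.
  unfold up. split; rewrite (lsum_ext_in _ _ (fun _ => 0)); try apply lsum_zero;
    intros k _; unfold psi; simpl tr; rewrite ?Rmult_0_r, ?sin_0, ?sin_INR_PI; ring.
Qed.
End Poly.
#[export] Hint Resolve jcont_up jcont_upx : jc.

Lemma lipschitz_of_derive f f' B G : (forall x, is_derive f x (f' x)) ->
  (forall x, Rabs x <= B -> Rabs (f' x) <= G) ->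
  forall x y, Rabs x <= B -> Rabs y <= B -> Rabs (f x - f y) <= G * Rabs (x - y).
Proof.
  intros Hf HG x y Hx Hy.
  destruct (MVT_gen f y x f') as [z [Hz E]].
  - intros; apply Hf.
  - intros z _. apply continuity_pt_filterlim. apply (ex_derive_continuous f). eexists; apply Hf.
  - rewrite E, Rabs_mult. apply Rmult_le_compat_r; [apply Rabs_pos|]. apply HG.
    apply Rabs_le_between in Hx. apply Rabs_le_between in Hy. apply Rabs_le.
    revert Hz. unfold Rmin, Rmax. destruct (Rle_dec y x); lra.
Qed.

Lemma is_lim_seq_lsum {A} (l : list A) (u : nat -> A -> R) (v : A -> R) :
  (forall a, In a l -> is_lim_seq (fun i => u i a) (v a)) ->
  is_lim_seq (fun i => lsum l (u i)) (lsum l v).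
Proof.
  induction l as [|a l IH]; simpl; intros H; [apply is_lim_seq_const|].
  apply is_lim_seq_plus'; [apply H; now left|apply IH; intros; apply H; now right].
Qed.

Lemma geometric_cv (a : nat -> R) M :
  (forall i, Rabs (a (S i) - a i) <= M * (1 / 2) ^ i) -> is_lim_seq a (real (Lim_seq a)).
Proof.
  intros H. apply Lim_seq_correct'.
  assert (Hs : ex_series (fun i => a (S i) - a i)).
  { apply (ex_series_le (fun i => a (S i) - a i) (fun i => M * (1 / 2) ^ i)).
    - intros i. apply H.
    - apply (ex_series_scal_l M (fun i => (1 / 2) ^ i)). apply ex_series_geom. rewrite Rabs_right; lra. }
  destruct Hs as [S HS]. exists (S + a 0%nat).
  apply is_lim_seq_incr_1.
  apply (is_lim_seq_ext (fun m => sum_n (fun i => a (Datatypes.S i) - a i) m + a 0%nat)).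
  - intros m. induction m as [|m IH].
    + rewrite sum_O. ring.
    + rewrite sum_Sn. unfold plus; simpl. simpl in IH. lra.
  - apply is_lim_seq_plus'; [exact HS|apply is_lim_seq_const].
Qed.

Lemma sq_le_Rabs_le x a : 0 <= a -> x ^ 2 <= a ^ 2 -> Rabs x <= a.
Proof. intros Ha H. apply Rabs_le. nra. Qed.

Lemma is_lim_seq_scal' (u : nat -> R) (a l : R) :
  is_lim_seq u l -> is_lim_seq (fun i => a * u i) (a * l).
Proof. intros H. apply is_lim_seq_mult'; [apply is_lim_seq_const|exact H]. Qed.
Lemma is_lim_seq_sq (u : nat -> R) (l : R) :
  is_lim_seq u l -> is_lim_seq (fun i => u i ^ 2) (l ^ 2).
Proof.
  intros H. simpl. apply is_lim_seq_mult'; [exact H|].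
  apply is_lim_seq_mult'; [exact H|apply is_lim_seq_const].
Qed.

(** * Diagonal extraction *)

Definition extraction (phi : nat -> nat) : Prop := forall i, (phi i < phi (S i))%nat.

Lemma extraction_mono phi : extraction phi -> forall i j, (i < j)%nat -> (phi i < phi j)%nat.
Proof. intros H i j Hij. induction Hij; [apply H|]. specialize (H m). lia. Qed.
Lemma extraction_ge phi : extraction phi -> forall i, (i <= phi i)%nat.
Proof. intros H i. induction i; [lia|]. specialize (H i). lia. Qed.

Lemma bounded_extraction (a : nat -> R) M : (forall i, Rabs (a i) <= M) ->
  exists phi, extraction phi /\ ex_finite_lim_seq (fun i => a (phi i)).
Proof.
  intros H.
  destruct (Bolzano_Weierstrass a (fun x => - M <= x <= M)) as [l Hl].
  - apply compact_P3.
  - intros i. specialize (H i). now apply Rabs_le_between in H.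
  - assert (Hp : forall m i : nat, exists q, (m <= q)%nat /\ Rabs (a q - l) < / (INR i + 1)).
    { intros m i. assert (Hi : 0 < / (INR i + 1)) by (apply Rinv_0_lt_compat; pose proof (pos_INR i); lra).
      destruct (Hl (disc l (mkposreal _ Hi)) m) as [q [Hq1 Hq2]].
      - exists (mkposreal _ Hi). intros x Hx. exact Hx.
      - exists q. split; [exact Hq1|exact Hq2]. }
    set (pick := fun m i => epsilon (inhabits 0%nat) (fun q => (m <= q)%nat /\ Rabs (a q - l) < / (INR i + 1))).
    assert (Hpick : forall m i, (m <= pick m i)%nat /\ Rabs (a (pick m i) - l) < / (INR i + 1)).
    { intros m i. apply (epsilon_spec (inhabits 0%nat) (fun q => (m <= q)%nat /\ Rabs (a q - l) < / (INR i + 1))).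
      apply Hp. }
    set (phi := fix phi (i : nat) : nat :=
      match i with O => pick 0%nat 0%nat | S i' => pick (S (phi i')) (S i') end).
    exists phi. split.
    + intros i. simpl. destruct (Hpick (S (phi i)) (S i)). lia.
    + exists l. apply is_lim_seq_spec. intros eps.
      destruct (archimed_cor1 eps (cond_pos eps)) as [m [Hm1 Hm2]].
      exists m. intros i Hi.
      assert (E : Rabs (a (phi i) - l) < / (INR i + 1)).
      { destruct i; [apply Hpick|]. simpl phi. apply Hpick. }
      eapply Rlt_trans; [apply E|]. eapply Rle_lt_trans; [|apply Hm1].
      apply Rinv_le_contravar; [apply lt_0_INR; lia|]. apply le_INR in Hi. lra.
Qed.

Section Diagonal.
Variables (u : nat -> nat -> R) (M : R).
Hypothesis Hu : forall i m, Rabs (u i m) <= M.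

Let sub (a : nat -> R) : nat -> nat :=
  epsilon (inhabits (fun i : nat => i)) (fun phi => extraction phi /\ ex_finite_lim_seq (fun i => a (phi i))).
(** Along [nested m] the coordinates below [m] converge; each stage composes the previous one with
    an extraction that settles one more coordinate. *)
Fixpoint nested (m : nat) : nat -> nat :=
  match m with
  | O => fun i => i
  | S m' => fun i => nested m' (sub (fun j => u (nested m' j) m') i)
  end.

Lemma nested_step m : extraction (sub (fun j => u (nested m j) m)) /\
  ex_finite_lim_seq (fun i => u (nested (S m) i) m).
Proof.
  apply (epsilon_spec (inhabits (fun i : nat => i))
    (fun phi => extraction phi /\ ex_finite_lim_seq (fun i => u (nested m (phi i)) m))).
  apply (bounded_extraction (fun j => u (nested m j) m) M). intros; apply Hu.
Qed.
Lemma nested_extraction m : extraction (nested m).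
Proof.
  induction m as [|m IH]; intros i; simpl; [lia|].
  apply extraction_mono; [exact IH|]. apply (nested_step m).
Qed.
(** Every later stage is a subsequence of [nested m] and reads it at a position not before [x].
    Hence the diagonal inherits from index [m + 1] on the convergence of coordinate [m]. *)
Lemma nested_factor m d x : exists y, (x <= y)%nat /\ nested (d + m) x = nested m y.
Proof.
  revert x. induction d as [|d IH]; intros x; simpl; [exists x; auto|].
  destruct (IH (sub (fun j => u (nested (d + m) j) (d + m)) x)) as [y [Hy E]].
  exists y. split; [|exact E].
  pose proof (extraction_ge _ (proj1 (nested_step (d + m))) x). lia.
Qed.

Lemma diagonal_extraction : exists phi, extraction phi /\ forall m, ex_finite_lim_seq (fun i => u (phi i) m).
Proof.
  exists (fun i => nested i i). split.
  - intros i. simpl. apply extraction_mono; [apply nested_extraction|].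
    pose proof (extraction_ge _ (proj1 (nested_step i)) (S i)). lia.
  - intros m. destruct (proj2 (nested_step m)) as [l Hl]. exists l.
    apply is_lim_seq_spec. apply is_lim_seq_spec in Hl. intros eps.
    destruct (Hl eps) as [i0 Hi0]. exists (Nat.max i0 (S m)). intros i Hi.
    destruct (nested_factor (S m) (i - S m) i) as [y [Hy E]].
    replace (i - S m + S m)%nat with i in E by lia. rewrite E. apply Hi0. lia.
Qed.
End Diagonal.

Lemma mode_extraction (u : nat -> mode -> R) M : (forall i k, Rabs (u i k) <= M) ->
  exists phi, extraction phi /\ forall k, is_lim_seq (fun i => u (phi i) k) (real (Lim_seq (fun i => u (phi i) k))).
Proof.
  intros H.
  destruct (diagonal_extraction (fun i m => u i (Cantor.of_nat m)) M) as [phi [Hp Hl]].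
  - intros; apply H.
  - exists phi. split; [exact Hp|]. intros k. apply Lim_seq_correct'.
    specialize (Hl (Cantor.to_nat k)). now rewrite Cantor.cancel_of_to in Hl.
Qed.

(** * Galerkin reduction and min-max *)

Lemma lsum_if {A} (l : list A) (p : A -> bool) F :
  lsum l F = lsum l (fun a => if p a then F a else 0) + lsum l (fun a => if p a then 0 else F a).
Proof. rewrite <- lsum_plus. apply lsum_ext_in. intros a _. destruct (p a); ring. Qed.

Lemma Int2_le_const F C : jcont F -> (forall t x, F t x <= C) -> Int2 F <= 4 * C.
Proof. intros HF H. rewrite <- Int2_const. apply Int2_le; auto with jc. Qed.

Section Reduction.
Variables (n N : nat) (om mu kap Rm G : R) (g0 g1 : R -> R).

Definition res (k : mode) : bool := Nat.eqb (snd k) (n * fst k).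
Definition lam (k : mode) : R := INR (snd k) ^ 2 - (om * INR n * INR (fst k)) ^ 2.
(** [17^2 >= 288] and [34^2 >= 1152]: the first summand bounds the l1 norm of the resonant part when
    [N1 <= Rm^2] ([l1_res]), the second that of the other modes in the unit ball of [adm]
    ([l1_lam]). *)
Definition supb : R := 17 * Rm + 34.
Definition bc (c : mode -> R) (k : mode) : R :=
  Int2 (fun t x => g0 (up N 0 c t x) * psi 0 k t x).
Definition N1 (xi : mode -> R) : R :=
  lsum (box N) (fun k => if res k then (INR (fst k) * xi k) ^ 2 else 0).
(** The weight [l^2 + lam^2] dominates [wt] along the characteristic line, so this ball controls the
    sup norm; its [l^2] part also controls one time derivative. *)
Definition adm (xi c : mode -> R) : Prop :=
  (forall k, In k (box N) -> res k = true -> c k = xi k) /\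
  lsum (box N) (fun k => if res k then 0 else (INR (fst k) ^ 2 + lam k ^ 2) * c k ^ 2) <= 1.
Definition FP (xi c : mode -> R) : Prop :=
  adm xi c /\ forall k, In k (box N) -> res k = false -> lam k * c k = - mu * bc c k.

Hypothesis Hn : (1 <= n)%nat.
Hypothesis Hom : / 2 <= om.
Hypothesis Hmu : mu = (om ^ 2 - 1) * INR n ^ 2.
Hypothesis Hnr : forall k, In k (box N) -> res k = false ->
  lam k <> 0 /\ Rabs mu <= kap * Rabs (lam k).
Hypothesis HRm : 0 <= Rm.
Hypothesis HG0 : 0 <= G.
Hypothesis Hg : forall y, is_derive g0 y (g1 y).
Hypothesis Hg1 : cont g1.
Hypothesis HgB : forall y, Rabs y <= supb -> Rabs (g0 y) <= G /\ Rabs (g1 y) <= G.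
Hypothesis Hkap : 0 <= kap.
Hypothesis Hball : (kap ^ 2 + mu ^ 2) * (G ^ 2 * (Rm ^ 2 + 5)) <= 1.

Lemma lam_res k : res k = true -> lam k = - mu * INR (fst k) ^ 2.
Proof.
  unfold res, lam. intros H. apply Nat.eqb_eq in H. rewrite H, mult_INR, Hmu. ring.
Qed.

(** With [w = om n l >= l / 2], the factorisation [lam = (j - w) (j + w)] gives
    [lam^2 >= (j - w)^2 l^2 / 4], and [1 + l^2 <= 2 l^2] for [l >= 1]. For [l = 0] the symbol is
    [j^2] and [j >= 1]. *)
Lemma wt_le_lam k : In k (box N) -> wt (fun l => om * INR n * INR l) k <= 8 * (INR (fst k) ^ 2 + lam k ^ 2).
Proof.
  destruct k as [l j]. rewrite in_box. intros Hk. unfold wt, lam; simpl fst; simpl snd.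
  assert (Hj : 1 <= INR j) by (apply (le_INR 1); lia).
  assert (Hn' : 1 <= INR n) by (apply (le_INR 1); lia).
  destruct (Nat.eq_dec l 0) as [->|Hl].
  - change (INR 0) with 0. assert (1 <= INR j ^ 2) by nra. set (y := INR j ^ 2) in *.
    replace (INR j - om * INR n * 0) with (INR j) by ring. fold y. nra.
  - assert (Hl' : 1 <= INR l) by (apply (le_INR 1); lia).
    set (w := om * INR n * INR l).
    assert (Hw : INR l / 2 <= w).
    { unfold w. assert (/ 2 <= om * INR n) by nra. nra. }
    set (L := INR l) in *. set (d := INR j - w).
    replace (INR j ^ 2 - w ^ 2) with (d * (d + 2 * w)) by (unfold d; ring).
    assert (Hd : d ^ 2 * (L / 2) ^ 2 <= (d * (d + 2 * w)) ^ 2).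
    { replace ((d * (d + 2 * w)) ^ 2) with (d ^ 2 * (d + 2 * w) ^ 2) by ring.
      apply Rmult_le_compat_l; [apply pow2_ge_0|]. apply pow_incr.
      unfold d. lra. }
    assert (1 + L ^ 2 <= 2 * L ^ 2) by nra.
    pose proof (pow2_ge_0 d).
    apply Rle_trans with (2 * L ^ 2 * (1 + d ^ 2)); [apply Rmult_le_compat_r; lra|nra].
Qed.

Lemma l1_lam z : (lsum (box N) (fun k => Rabs (z k))) ^ 2
  <= 1152 * lsum (box N) (fun k => (INR (fst k) ^ 2 + lam k ^ 2) * z k ^ 2).
Proof.
  eapply Rle_trans; [apply (l1_le_wt (fun l => om * INR n * INR l))|].
  replace 1152 with (144 * 8) by ring. rewrite Rmult_assoc. apply Rmult_le_compat_l; [lra|].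
  rewrite <- lsum_scal. apply lsum_le. intros k Hk.
  pose proof (wt_le_lam k Hk). pose proof (pow2_ge_0 (z k)). nra.
Qed.

(** On resonant modes [j = n l], so with the curve [Om l = n l] the second factor of the weight is
    1; since [j >= 1] forces [l >= 1], the first factor is at most [2 l^2]. *)
Lemma l1_res z :
  (lsum (box N) (fun k => if res k then Rabs (z k) else 0)) ^ 2 <= 288 * N1 z.
Proof.
  rewrite (lsum_ext_in _ _ (fun k => Rabs (if res k then z k else 0))).
  2: { intros k _. destruct (res k); [reflexivity|now rewrite Rabs_R0]. }
  eapply Rle_trans; [apply (l1_le_wt (fun l => INR n * INR l))|].
  unfold N1. replace 288 with (144 * 2) by ring. rewrite Rmult_assoc. apply Rmult_le_compat_l; [lra|].
  rewrite <- lsum_scal. apply lsum_le. intros [l j] Hk. rewrite in_box in Hk.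
  destruct (res (l, j)) eqn:E; [|simpl; lra]. unfold res in E. simpl in E. apply Nat.eqb_eq in E. subst j.
  unfold wt; simpl fst; simpl snd. rewrite mult_INR, Rminus_diag.
  assert (1 <= INR l) by (apply (le_INR 1); destruct l; lia).
  rewrite Rpow_mult_distr. assert (1 <= INR l ^ 2) by nra.
  assert (0 <= (INR l ^ 2 - 1) * z (l, (n * l)%nat) ^ 2) by (apply Rmult_le_pos; [lra|apply pow2_ge_0]).
  lra.
Qed.

Lemma adm_bounds xi c : N1 xi <= Rm ^ 2 -> adm xi c ->
  lsum (box N) (fun k => Rabs (c k)) <= supb /\
  lsum (box N) (fun k => (c k * INR (fst k) ^ 1) ^ 2) <= Rm ^ 2 + 1.
Proof.
  intros HN [Hr Hw]. split.
  - rewrite (lsum_if _ res). unfold supb. apply Rplus_le_compat.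
    + assert (E := l1_res xi). apply Rsqr_incr_0_var; [|lra]. unfold Rsqr.
      rewrite (lsum_ext_in _ _ (fun k => if res k then Rabs (xi k) else 0)); [nra|].
      intros k Hk. destruct (res k) eqn:E1; [now rewrite (Hr k Hk E1)|reflexivity].
    + apply Rsqr_incr_0_var; [|lra]. unfold Rsqr.
      rewrite (lsum_ext_in _ _ (fun k => Rabs (if res k then 0 else c k))).
      2: { intros k _. destruct (res k); [now rewrite Rabs_R0|reflexivity]. }
      assert (E := l1_lam (fun k => if res k then 0 else c k)). cbv beta in E.
      rewrite (lsum_ext_in _ (fun k => (INR (fst k) ^ 2 + lam k ^ 2) * _)
        (fun k => if res k then 0 else (INR (fst k) ^ 2 + lam k ^ 2) * c k ^ 2)) in E.
      * nra.
      * intros k _. destruct (res k); ring.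
  - rewrite (lsum_if _ res). apply Rplus_le_compat.
    + eapply Rle_trans; [|apply HN]. right. apply lsum_ext_in. intros k Hk.
      destruct (res k) eqn:E; [rewrite (Hr k Hk E); ring|reflexivity].
    + eapply Rle_trans; [|apply Hw]. apply lsum_le. intros k _. destruct (res k); [lra|].
      pose proof (pow2_ge_0 (lam k)). pose proof (pow2_ge_0 (c k)).
      rewrite Rpow_mult_distr, pow_1. nra.
Qed.

Lemma cont_g0 : cont g0. Proof. apply (cont_derive g0 g1 Hg). Qed.
Lemma jcont_g0up c : jcont (fun t x => g0 (up N 0 c t x)).
Proof. apply (jcont_comp (up N 0 c) g0); [auto with jc|apply cont_g0]. Qed.
Lemma jcont_g1up c : jcont (fun t x => g1 (up N 0 c t x)).
Proof. apply (jcont_comp (up N 0 c) g1); [auto with jc|apply Hg1]. Qed.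
Hint Resolve jcont_g0up jcont_g1up : jc.

Lemma up0_supb c t x : lsum (box N) (fun k => Rabs (c k)) <= supb -> Rabs (up N 0 c t x) <= supb.
Proof.
  intros H. eapply Rle_trans; [apply up_sup|]. eapply Rle_trans; [|apply H].
  right. apply lsum_ext_in. intros; simpl; ring.
Qed.

Lemma bc_sq_sum c : lsum (box N) (fun k => Rabs (c k)) <= supb ->
  lsum (box N) (fun k => bc c k ^ 2) <= 4 * G ^ 2.
Proof.
  intros H. unfold bc.
  eapply Rle_trans; [apply (bessel (box N) (psi 0) (fun t x => g0 (up N 0 c t x)));
                     [apply psi_suborth|auto with jc]|].
  apply Int2_le_const; [auto with jc|]. intros t x.
  destruct (HgB _ (up0_supb c t x H)) as [E _]. rewrite <- (pow2_abs (g0 _)).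
  apply pow_incr. split; [apply Rabs_pos|assumption].
Qed.

Lemma is_derive_g0up c t x :
  is_derive (fun s => g0 (up N 0 c s x)) t (g1 (up N 0 c t x) * up N 1 c t x).
Proof.
  rewrite Rmult_comm. apply (is_derive_comp g0 (fun s => up N 0 c s x)); [apply Hg|].
  apply is_derive_up_t. lia.
Qed.

(** After one integration by parts [l * bc] is a coefficient of the time derivative of [g0 u], that
    is of [g1 u * u_t]; Bessel and the bound on [g1] finish. *)
Lemma bc_l_sum c : lsum (box N) (fun k => Rabs (c k)) <= supb ->
  lsum (box N) (fun k => (INR (fst k) * bc c k) ^ 2)
  <= G ^ 2 * lsum (box N) (fun k => (c k * INR (fst k) ^ 1) ^ 2).
Proof.
  intros H.
  rewrite (lsum_ext_in _ _ (fun k => Int2 (fun t x => (g1 (up N 0 c t x) * up N 1 c t x) * psi 1 k t x) ^ 2)).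
  2: { intros k _. f_equal. unfold bc.
       apply (parts_t (fun t x => g0 (up N 0 c t x))); auto with jc; try discriminate.
       intros; apply is_derive_g0up. }
  eapply Rle_trans; [apply (bessel (box N) (psi 1)); [apply psi_suborth|auto with jc]|].
  apply Rle_trans with (Int2 (fun t x => G ^ 2 * up N 1 c t x ^ 2)).
  - apply Int2_le; auto with jc. intros t x _ _. rewrite Rpow_mult_distr.
    apply Rmult_le_compat_r; [apply pow2_ge_0|].
    destruct (HgB _ (up0_supb c t x H)) as [_ E]. rewrite <- (pow2_abs (g1 _)).
    apply pow_incr. split; [apply Rabs_pos|assumption].
  - rewrite Int2_scal by auto with jc. apply Rmult_le_compat_l; [apply pow2_ge_0|apply up_L2].
Qed.

Lemma g0_lip x y : Rabs x <= supb -> Rabs y <= supb -> Rabs (g0 x - g0 y) <= G * Rabs (x - y).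
Proof. apply (lipschitz_of_derive g0 g1); [apply Hg|]. intros; now apply HgB. Qed.

Lemma up_L2_0 c : Int2 (fun t x => up N 0 c t x ^ 2) <= lsum (box N) (fun k => c k ^ 2).
Proof.
  eapply Rle_trans; [apply up_L2|]. right. apply lsum_ext_in. intros; simpl; ring.
Qed.

Lemma g0_diff_L2 c c' :
  lsum (box N) (fun k => Rabs (c k)) <= supb -> lsum (box N) (fun k => Rabs (c' k)) <= supb ->
  Int2 (fun t x => (g0 (up N 0 c t x) - g0 (up N 0 c' t x)) ^ 2)
  <= G ^ 2 * lsum (box N) (fun k => (c k - c' k) ^ 2).
Proof.
  intros H H'.
  apply Rle_trans with (Int2 (fun t x => G ^ 2 * up N 0 (fun k => c k - c' k) t x ^ 2)).
  - apply Int2_le; auto with jc. intros t x _ _. rewrite <- up_minus.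
    rewrite <- (pow2_abs (g0 _ - _)), <- (pow2_abs (up N 0 c t x - _)), <- Rpow_mult_distr.
    apply pow_incr. split; [apply Rabs_pos|]. apply g0_lip; now apply up0_supb.
  - rewrite Int2_scal by auto with jc. apply Rmult_le_compat_l; [apply pow2_ge_0|].
    apply (up_L2_0 (fun k => c k - c' k)).
Qed.

Lemma bc_diff_sum c c' :
  lsum (box N) (fun k => Rabs (c k)) <= supb -> lsum (box N) (fun k => Rabs (c' k)) <= supb ->
  lsum (box N) (fun k => (bc c k - bc c' k) ^ 2) <= G ^ 2 * lsum (box N) (fun k => (c k - c' k) ^ 2).
Proof.
  intros H H'. eapply Rle_trans; [|apply (g0_diff_L2 c c' H H')].
  eapply Rle_trans; [|apply (bessel (box N) (psi 0)); [apply psi_suborth|auto with jc]].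
  right. apply lsum_ext_in. intros k _. f_equal. unfold bc.
  rewrite <- Int2_minus by auto with jc. apply Int2_ext; intros; ring.
Qed.

(** * Contraction for the nonresonant modes *)

Definition Tmap (xi c : mode -> R) (k : mode) : R :=
  if res k then xi k else - (mu / lam k) * bc c k.

Lemma ratio_le k : In k (box N) -> res k = false -> (mu / lam k) ^ 2 <= kap ^ 2.
Proof.
  intros Hk E. destruct (Hnr k Hk E) as [H0 H1].
  rewrite <- (pow2_abs (mu / lam k)). apply pow_incr. split; [apply Rabs_pos|].
  unfold Rdiv. rewrite Rabs_mult, Rabs_inv.
  assert (0 < Rabs (lam k)) by now apply Rabs_pos_lt.
  apply Rmult_le_reg_r with (Rabs (lam k)); [assumption|].
  rewrite Rmult_assoc, Rinv_l by lra. lra.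
Qed.

(** On the image the weight splits: [lam^2 (mu / lam)^2 b^2 = mu^2 b^2], and
    [l^2 (mu / lam)^2 b^2 <= kap^2 (l b)^2]. Both sums of [b] are at most [G^2 (Rm^2 + 5)], which is
    the form of [Hball]. *)
Lemma Tmap_adm xi c : N1 xi <= Rm ^ 2 -> adm xi c -> adm xi (Tmap xi c).
Proof.
  intros HN Ha. destruct (adm_bounds xi c HN Ha) as [Hs Hl]. split.
  - intros k _ E. unfold Tmap. now rewrite E.
  - apply Rle_trans with (lsum (box N) (fun k => kap ^ 2 * (INR (fst k) * bc c k) ^ 2 + mu ^ 2 * bc c k ^ 2)).
    + apply lsum_le. intros k Hk. unfold Tmap. pose proof (pow2_ge_0 (bc c k)).
      pose proof (pow2_ge_0 (INR (fst k) * bc c k)). pose proof (pow2_ge_0 mu). pose proof (pow2_ge_0 kap).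
      destruct (res k) eqn:E; [nra|].
      pose proof (ratio_le k Hk E) as Hr. destruct (Hnr k Hk E) as [Hl0 _].
      replace ((INR (fst k) ^ 2 + lam k ^ 2) * (- (mu / lam k) * bc c k) ^ 2)
        with ((mu / lam k) ^ 2 * (INR (fst k) * bc c k) ^ 2 + mu ^ 2 * bc c k ^ 2) by (field; assumption).
      nra.
    + rewrite lsum_plus, !lsum_scal.
      pose proof (bc_sq_sum c Hs) as E1. pose proof (bc_l_sum c Hs) as E2.
      pose proof (pow2_ge_0 kap). pose proof (pow2_ge_0 mu). pose proof (pow2_ge_0 G). pose proof (pow2_ge_0 Rm).
      assert (E3 : lsum (box N) (fun k => (INR (fst k) * bc c k) ^ 2) <= G ^ 2 * (Rm ^ 2 + 5)) by nra.
      assert (E4 : lsum (box N) (fun k => bc c k ^ 2) <= G ^ 2 * (Rm ^ 2 + 5)) by nra.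
      nra.
Qed.

(** The contraction holds in plain l2 and not in the stronger norm of [adm]; that ball only keeps
    the arguments of [g0] inside [[-supb, supb]]. Two base points are allowed because resonant
    entries are left out of the sum. *)
Lemma Tmap_contr xi xi' c c' :
  lsum (box N) (fun k => Rabs (c k)) <= supb -> lsum (box N) (fun k => Rabs (c' k)) <= supb ->
  lsum (box N) (fun k => if res k then 0 else (Tmap xi c k - Tmap xi' c' k) ^ 2)
  <= kap ^ 2 * G ^ 2 * lsum (box N) (fun k => (c k - c' k) ^ 2).
Proof.
  intros H H'. rewrite Rmult_assoc.
  eapply Rle_trans; [|apply Rmult_le_compat_l; [apply pow2_ge_0|apply (bc_diff_sum c c' H H')]].
  rewrite <- lsum_scal. apply lsum_le. intros k Hk. unfold Tmap.
  pose proof (pow2_ge_0 kap). pose proof (pow2_ge_0 (bc c k - bc c' k)).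
  destruct (res k) eqn:E; [nra|]. pose proof (ratio_le k Hk E).
  replace ((- (mu / lam k) * bc c k - - (mu / lam k) * bc c' k) ^ 2)
    with ((mu / lam k) ^ 2 * (bc c k - bc c' k) ^ 2) by ring. nra.
Qed.

Definition dres (xi xi' : mode -> R) : R :=
  lsum (box N) (fun k => if res k then (xi k - xi' k) ^ 2 else 0).

Lemma FP_Tmap xi c : FP xi c -> forall k, In k (box N) -> c k = Tmap xi c k.
Proof.
  intros [[Hr _] Hf] k Hk. unfold Tmap. destruct (res k) eqn:E; [now apply Hr|].
  destruct (Hnr k Hk E) as [H0 _]. specialize (Hf k Hk E).
  apply Rmult_eq_reg_l with (lam k); [|assumption]. rewrite Hf. field. assumption.
Qed.

Lemma kG_sq : kap ^ 2 * G ^ 2 <= 1 / 4.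
Proof. rewrite <- Rpow_mult_distr. assert (0 <= kap * G) by now apply Rmult_le_pos. nra. Qed.

(** If [S] is the full squared distance, then [S <= dres + (1/4) S]. Feeding this back into the
    contraction shows that the nonresonant part moves only by a factor of order [kap] of the
    resonant one. Taking [xi' = xi] yields uniqueness. *)
Lemma FP_lip xi xi' c c' : N1 xi <= Rm ^ 2 -> N1 xi' <= Rm ^ 2 -> FP xi c -> FP xi' c' ->
  lsum (box N) (fun k => (c k - c' k) ^ 2) <= 2 * dres xi xi' /\
  lsum (box N) (fun k => if res k then 0 else (c k - c' k) ^ 2) <= 2 * (kap ^ 2 * G ^ 2) * dres xi xi'.
Proof.
  intros HN HN' HF HF'.
  destruct (adm_bounds xi c HN (proj1 HF)) as [Hs _].
  destruct (adm_bounds xi' c' HN' (proj1 HF')) as [Hs' _].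
  pose proof (Tmap_contr xi xi' c c' Hs Hs') as E.
  rewrite (lsum_ext_in _ _ (fun k => if res k then 0 else (c k - c' k) ^ 2)) in E.
  2: { intros k Hk. rewrite <- (FP_Tmap xi c HF k Hk), <- (FP_Tmap xi' c' HF' k Hk). reflexivity. }
  pose proof (lsum_if (box N) res (fun k => (c k - c' k) ^ 2)) as E1.
  assert (E2 : lsum (box N) (fun k => if res k then (c k - c' k) ^ 2 else 0) = dres xi xi').
  { apply lsum_ext_in. intros k Hk. destruct (res k) eqn:Er; [|reflexivity].
    destruct HF as [[Hr _] _]. destruct HF' as [[Hr' _] _].
    rewrite (Hr k Hk Er), (Hr' k Hk Er). reflexivity. }
  pose proof kG_sq.
  assert (0 <= kap ^ 2 * G ^ 2) by (apply Rmult_le_pos; apply pow2_ge_0).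
  assert (0 <= dres xi xi').
  { apply lsum_nonneg. intros k _. destruct (res k); [apply pow2_ge_0|lra]. }
  set (S := lsum (box N) (fun k => (c k - c' k) ^ 2)) in *. cbv beta in E1. rewrite E2 in E1.
  assert (HS : S <= 2 * dres xi xi') by nra. split; [assumption|]. nra.
Qed.

Lemma FP_nonres_small xi c : N1 xi <= Rm ^ 2 -> FP xi c ->
  lsum (box N) (fun k => if res k then 0 else c k ^ 2) <= kap ^ 2 * (4 * G ^ 2).
Proof.
  intros HN HF. destruct (adm_bounds xi c HN (proj1 HF)) as [Hs _].
  eapply Rle_trans; [|apply Rmult_le_compat_l; [apply pow2_ge_0|apply (bc_sq_sum c Hs)]].
  rewrite <- lsum_scal. apply lsum_le. intros k Hk.
  pose proof (pow2_ge_0 kap). pose proof (pow2_ge_0 (bc c k)).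
  destruct (res k) eqn:E; [nra|]. rewrite (FP_Tmap xi c HF k Hk). unfold Tmap. rewrite E.
  pose proof (ratio_le k Hk E).
  replace ((- (mu / lam k) * bc c k) ^ 2) with ((mu / lam k) ^ 2 * bc c k ^ 2) by ring. nra.
Qed.

Fixpoint iter (xi : mode -> R) (i : nat) : mode -> R :=
  match i with
  | O => fun k => if res k then xi k else 0
  | S i => Tmap xi (iter xi i)
  end.

Lemma iter_adm xi i : N1 xi <= Rm ^ 2 -> adm xi (iter xi i).
Proof.
  intros HN. induction i as [|i IH]; simpl; [|now apply Tmap_adm].
  split.
  - intros k _ E. now rewrite E.
  - rewrite (lsum_ext_in _ _ (fun _ => 0)); [rewrite lsum_zero; lra|].
    intros k _. destruct (res k); ring.
Qed.

Lemma FP_exists xi : N1 xi <= Rm ^ 2 -> exists c, FP xi c.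
Proof.
  intros HN.
  assert (Hs : forall i, lsum (box N) (fun k => Rabs (iter xi i k)) <= supb)
    by (intros i; apply (adm_bounds xi _ HN (iter_adm xi i HN))).
  set (D := lsum (box N) (fun k => (iter xi 1 k - iter xi 0 k) ^ 2)).
  assert (HD : 0 <= D) by (apply lsum_nonneg; intros; apply pow2_ge_0).
  (* Resonant coordinates are constant along the iteration, and the other squared increments shrink
     by [kap^2 G^2 <= 1/4] at each step. *)
  assert (Hc : forall i, lsum (box N) (fun k => (iter xi (S i) k - iter xi i k) ^ 2) <= D * ((1 / 2) ^ i) ^ 2).
  { induction i as [|i IH].
    - fold D. simpl. lra.
    - rewrite (lsum_if _ res).
      rewrite (lsum_ext_in _ (fun k => if res k then (iter xi (S (S i)) k - iter xi (S i) k) ^ 2 else 0)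
         (fun _ => 0)), lsum_zero.
      2: { intros k _. simpl. unfold Tmap. destruct (res k); ring. }
      pose proof (Tmap_contr xi xi (iter xi (S i)) (iter xi i) (Hs (S i)) (Hs i)) as E.
      pose proof kG_sq.
      assert (0 <= lsum (box N) (fun k => (iter xi (S i) k - iter xi i k) ^ 2))
        by (apply lsum_nonneg; intros; apply pow2_ge_0).
      change (iter xi (S (S i))) with (Tmap xi (iter xi (S i))).
      change (iter xi (S i)) with (Tmap xi (iter xi i)) at 2.
      replace (D * ((1 / 2) ^ S i) ^ 2) with (1 / 4 * (D * ((1 / 2) ^ i) ^ 2)) by (simpl; field).
      nra. }
  set (c := fun k => real (Lim_seq (fun i => iter xi i k))).
  assert (Hl : forall k, In k (box N) -> is_lim_seq (fun i => iter xi i k) (c k)).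
  { intros k Hk. apply (geometric_cv _ (sqrt D)). intros i. apply sq_le_Rabs_le.
    - apply Rmult_le_pos; [apply sqrt_pos|apply pow_le; lra].
    - rewrite Rpow_mult_distr, pow2_sqrt by assumption. eapply Rle_trans; [|apply (Hc i)].
      apply (lsum_term_le (box N) (fun k => (iter xi (S i) k - iter xi i k) ^ 2)); [|assumption].
      intros; apply pow2_ge_0. }
  assert (Ha : adm xi c).
  { split.
    - intros k Hk E. unfold c. rewrite (Lim_seq_ext _ (fun _ => xi k)); [now rewrite Lim_seq_const|].
      intros i. apply (iter_adm xi i HN); assumption.
    - assert (E : is_lim_seq (fun i => lsum (box N) (fun k => if res k then 0 else (INR (fst k) ^ 2 + lam k ^ 2) * iter xi i k ^ 2))
        (lsum (box N) (fun k => if res k then 0 else (INR (fst k) ^ 2 + lam k ^ 2) * c k ^ 2))).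
      { apply is_lim_seq_lsum. intros k Hk. destruct (res k); [apply is_lim_seq_const|].
        apply is_lim_seq_scal'. now apply is_lim_seq_sq, Hl. }
      apply (is_lim_seq_le _ (fun _ => 1) _ 1 (fun i => proj2 (iter_adm xi i HN)) E).
      apply is_lim_seq_const. }
  exists c. split; [exact Ha|].
  destruct (adm_bounds xi c HN Ha) as [Hsc _].
  assert (Hz : is_lim_seq (fun i => G ^ 2 * lsum (box N) (fun k => (iter xi i k - c k) ^ 2)) 0).
  { replace 0 with (G ^ 2 * lsum (box N) (fun k => (c k - c k) ^ 2)).
    - apply is_lim_seq_scal'.
      apply (is_lim_seq_lsum (box N) (fun i k => (iter xi i k - c k) ^ 2) (fun k => (c k - c k) ^ 2)).
      intros k Hk.
      assert (E : is_lim_seq (fun i => iter xi i k - c k) (c k - c k))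
        by (apply is_lim_seq_minus'; [now apply Hl|apply is_lim_seq_const]).
      now apply is_lim_seq_sq.
    - rewrite (lsum_ext_in _ _ (fun _ => 0)); [rewrite lsum_zero; ring|]. intros; ring. }
  intros k Hk E. destruct (Hnr k Hk E) as [H0 _].
  assert (Hb : is_lim_seq (fun i => (bc (iter xi i) k - bc c k) ^ 2) 0).
  { apply (is_lim_seq_le_le (fun _ => 0) _ (fun i => G ^ 2 * lsum (box N) (fun k => (iter xi i k - c k) ^ 2)));
      [|apply is_lim_seq_const|exact Hz].
    intros i. split; [apply pow2_ge_0|].
    eapply Rle_trans; [|apply (bc_diff_sum (iter xi i) c (Hs i) Hsc)].
    apply (lsum_term_le (box N) (fun k => (bc (iter xi i) k - bc c k) ^ 2)); [|assumption].
    intros; apply pow2_ge_0. }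
  (* By definition of the iteration this expression is [mu (bc c - bc (iter i))], which tends to 0;
     it also tends to the defect of the equation at [c], so that defect vanishes. *)
  assert (Hb2 : is_lim_seq (fun i => (lam k * iter xi (S i) k + mu * bc c k) ^ 2) 0).
  { apply (is_lim_seq_ext (fun i => mu ^ 2 * (bc (iter xi i) k - bc c k) ^ 2)).
    - intros i. simpl iter. unfold Tmap. rewrite E. field. assumption.
    - replace 0 with (mu ^ 2 * 0) by ring. apply is_lim_seq_scal'. exact Hb. }
  assert (Hb3 : is_lim_seq (fun i => (lam k * iter xi (S i) k + mu * bc c k) ^ 2)
     ((lam k * c k + mu * bc c k) ^ 2)).
  { assert (E1 : is_lim_seq (fun i => lam k * iter xi (S i) k + mu * bc c k) (lam k * c k + mu * bc c k)).
    { apply is_lim_seq_plus'; [|apply is_lim_seq_const].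
      apply is_lim_seq_scal'.
      apply (is_lim_seq_incr_1 (fun i => iter xi i k)). now apply Hl. }
    now apply is_lim_seq_sq. }
  apply is_lim_seq_unique in Hb2. apply is_lim_seq_unique in Hb3. rewrite Hb2 in Hb3.
  injection Hb3 as Hb3. nra.
Qed.

(** The fixed point over [xi]. The equations determine it on the box only; its other entries never
    enter a sum. *)
Definition cs (xi : mode -> R) : mode -> R := epsilon (inhabits (fun _ => 0)) (FP xi).
Lemma cs_FP xi : N1 xi <= Rm ^ 2 -> FP xi (cs xi).
Proof. intros H. unfold cs. apply epsilon_spec. now apply FP_exists. Qed.
Lemma cs_supb xi : N1 xi <= Rm ^ 2 -> lsum (box N) (fun k => Rabs (cs xi k)) <= supb.
Proof. intros H. apply (adm_bounds xi _ H (proj1 (cs_FP xi H))). Qed.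

(** * The reduced functional and its first-order expansion *)

Hypothesis Hmu0 : mu <> 0.

Definition GG (y : R) : R := RInt g0 0 y.
Lemma is_derive_GG y : is_derive GG y (g0 y).
Proof.
  apply (is_derive_RInt g0 GG 0 y).
  - apply filter_forall. intros b. apply (RInt_correct g0 0 b). apply ex_int, cont_g0.
  - apply cont_g0.
Qed.
Lemma cont_GG : cont GG. Proof. apply (cont_derive GG g0 is_derive_GG). Qed.
Lemma jcont_GGup c : jcont (fun t x => GG (up N 0 c t x)).
Proof. apply (jcont_comp (up N 0 c) GG); [auto with jc|apply cont_GG]. Qed.
Hint Resolve jcont_GGup : jc.

Lemma GG_taylor y z : Rabs y <= supb -> Rabs z <= supb ->
  Rabs (GG z - GG y - g0 y * (z - y)) <= G * (z - y) ^ 2.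
Proof.
  intros Hy Hz.
  destruct (MVT_gen GG y z g0) as [v [Hv E]].
  - intros; apply is_derive_GG.
  - intros v _. apply continuity_pt_filterlim, cont_GG.
  - rewrite E.
    assert (Hv' : Rabs (v - y) <= Rabs (z - y) /\ Rabs v <= supb).
    { revert Hv. apply Rabs_le_between in Hy. apply Rabs_le_between in Hz.
      unfold Rmin, Rmax. destruct (Rle_dec y z); intros; split;
        try (apply Rabs_le; lra); unfold Rabs; destruct (Rcase_abs (v - y)); destruct (Rcase_abs (z - y)); lra. }
    destruct Hv' as [H1 H2].
    replace (g0 v * (z - y) - g0 y * (z - y)) with ((g0 v - g0 y) * (z - y)) by ring.
    rewrite Rabs_mult, <- (pow2_abs (z - y)).
    pose proof (g0_lip v y H2 Hy). pose proof (Rabs_pos (z - y)).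
    assert (G * Rabs (v - y) <= G * Rabs (z - y)) by now apply Rmult_le_compat_l.
    replace (G * Rabs (z - y) ^ 2) with (G * Rabs (z - y) * Rabs (z - y)) by ring.
    apply Rmult_le_compat_r; lra.
Qed.

(** The action of the truncated equation divided by [mu]: its partial derivative in [c k] is
    [lam k / mu * c k + bc c k]. *)
Definition Act (c : mode -> R) : R :=
  1 / 2 * lsum (box N) (fun k => lam k / mu * c k ^ 2) + Int2 (fun t x => GG (up N 0 c t x)).
(** The sign is reversed because [lam / mu = - l^2] on resonant modes: the quadratic part becomes
    positive and the potential negative. *)
Definition Psi (xi : mode -> R) : R := - Act (cs xi).
Definition yv (xi : mode -> R) (k : mode) : R := INR (fst k) ^ 2 * xi k - bc (cs xi) k.

Lemma bc_pair c h : lsum (box N) (fun k => bc c k * h k)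
  = Int2 (fun t x => g0 (up N 0 c t x) * up N 0 h t x).
Proof.
  unfold bc. rewrite (Int2_ext (fun t x => g0 (up N 0 c t x) * up N 0 h t x)
    (fun t x => lsum (box N) (fun k => h k * (g0 (up N 0 c t x) * psi 0 k t x)))).
  - rewrite (Int2_lsum (box N) h (fun k t x => g0 (up N 0 c t x) * psi 0 k t x)) by auto with jc.
    apply lsum_ext_in; intros; ring.
  - intros. unfold up at 2. rewrite <- lsum_scal. apply lsum_ext_in; intros; simpl; ring.
Qed.

(** The constant depends on [N] through the sum of [|lam / mu|]. This is harmless: the expansion
    serves to locate a critical point at fixed [N] and [K] enters no bound used for the limit. *)
Lemma Act_expand : exists K, 0 <= K /\ forall c c',
  lsum (box N) (fun k => Rabs (c k)) <= supb -> lsum (box N) (fun k => Rabs (c' k)) <= supb ->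
  Rabs (Act c' - Act c - lsum (box N) (fun k => (lam k / mu * c k + bc c k) * (c' k - c k)))
  <= K * lsum (box N) (fun k => (c' k - c k) ^ 2).
Proof.
  set (Kn := lsum (box N) (fun k => Rabs (lam k / mu))).
  assert (HKn : 0 <= Kn) by (apply lsum_nonneg; intros; apply Rabs_pos).
  exists (1 / 2 * Kn + G). split; [lra|]. intros c c' H H'.
  rewrite (lsum_ext_in _ _ (fun k => lam k / mu * c k * (c' k - c k) + bc c k * (c' k - c k)))
    by (intros; ring).
  rewrite lsum_plus, (bc_pair c (fun k => c' k - c k)).
  set (T := Int2 (fun t x => GG (up N 0 c' t x) - GG (up N 0 c t x)
     - g0 (up N 0 c t x) * up N 0 (fun k => c' k - c k) t x)).
  assert (HT : Rabs T <= G * lsum (box N) (fun k => (c' k - c k) ^ 2)).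
  { apply Rle_trans with (Int2 (fun t x => G * up N 0 (fun k => c' k - c k) t x ^ 2)).
    - apply Int2_abs_le; auto with jc. intros t x _ _. rewrite <- up_minus.
      apply GG_taylor; now apply up0_supb.
    - rewrite Int2_scal by auto with jc. apply Rmult_le_compat_l; [assumption|].
      apply (up_L2_0 (fun k => c' k - c k)). }
  assert (HS : Rabs (lsum (box N) (fun k => lam k / mu * (c' k - c k) ^ 2))
     <= Kn * lsum (box N) (fun k => (c' k - c k) ^ 2)).
  { eapply Rle_trans; [apply lsum_abs|]. rewrite <- lsum_scal. apply lsum_le. intros k Hk.
    rewrite Rabs_mult, (Rabs_right ((c' k - c k) ^ 2)) by (apply Rle_ge, pow2_ge_0).
    apply Rmult_le_compat_r; [apply pow2_ge_0|].
    apply (lsum_term_le (box N) (fun k => Rabs (lam k / mu))); [intros; apply Rabs_pos|assumption]. }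
  unfold T in HT. rewrite Int2_minus, Int2_minus in HT by auto 10 with jc.
  unfold Act.
  match goal with |- Rabs ?e <= _ => replace e with
    (1 / 2 * lsum (box N) (fun k => lam k / mu * (c' k - c k) ^ 2)
     + (Int2 (fun t x => GG (up N 0 c' t x)) - Int2 (fun t x => GG (up N 0 c t x))
        - Int2 (fun t x => g0 (up N 0 c t x) * up N 0 (fun k => c' k - c k) t x))) end.
  - eapply Rle_trans; [apply Rabs_triang|]. rewrite Rabs_mult, (Rabs_right (1 / 2)) by lra.
    rewrite Rmult_plus_distr_r. nra.
  - rewrite (lsum_ext_in _ (fun k => lam k / mu * (c' k - c k) ^ 2)
      (fun k => lam k / mu * c' k ^ 2 - lam k / mu * c k ^ 2 - 2 * (lam k / mu * c k * (c' k - c k))))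
      by (intros; ring).
    rewrite !lsum_minus, lsum_scal. field.
Qed.

(** At [cs xi] the action is stationary in the nonresonant directions, so the linear term only sees
    the resonant increments and the derivative of [cs] never appears. The remainder is quadratic in
    [cs xi' - cs xi], hence in [xi' - xi] by [FP_lip]. Thus [yv] is the gradient of [Psi]. *)
Lemma Psi_expand : exists K, 0 <= K /\ forall xi xi', N1 xi <= Rm ^ 2 -> N1 xi' <= Rm ^ 2 ->
  Rabs (Psi xi' - Psi xi - lsum (box N) (fun k => if res k then yv xi k * (xi' k - xi k) else 0))
  <= K * dres xi' xi.
Proof.
  destruct Act_expand as [K [HK H]]. exists (K * 2). split; [lra|]. intros xi xi' HN HN'.
  specialize (H (cs xi) (cs xi') (cs_supb xi HN) (cs_supb xi' HN')).
  pose proof (FP_lip xi' xi _ _ HN' HN (cs_FP xi' HN') (cs_FP xi HN)) as [E _].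
  replace (lsum (box N) (fun k => (lam k / mu * cs xi k + bc (cs xi) k) * (cs xi' k - cs xi k)))
    with (- lsum (box N) (fun k => if res k then yv xi k * (xi' k - xi k) else 0)) in H.
  - unfold Psi. rewrite <- Rabs_Ropp.
    match goal with H : Rabs ?a <= _ |- Rabs ?b <= _ => replace b with a by ring end.
    eapply Rle_trans; [apply H|]. rewrite Rmult_assoc. now apply Rmult_le_compat_l.
  - replace (- lsum (box N) (fun k => if res k then yv xi k * (xi' k - xi k) else 0))
      with ((-1) * lsum (box N) (fun k => if res k then yv xi k * (xi' k - xi k) else 0)) by ring.
    rewrite <- lsum_scal. apply lsum_ext_in. intros k Hk.
    destruct (cs_FP xi HN) as [[Hr _] Hf]. destruct (cs_FP xi' HN') as [[Hr' _] _].
    destruct (res k) eqn:Er.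
    + unfold yv. rewrite (Hr k Hk Er), (Hr' k Hk Er), (lam_res k Er). field. assumption.
    + replace (lam k / mu * cs xi k + bc (cs xi) k) with ((lam k * cs xi k + mu * bc (cs xi) k) / mu)
        by (field; assumption).
      rewrite (Hf k Hk Er). field. assumption.
Qed.

Lemma yv_lip : exists K, 0 <= K /\ forall xi xi', N1 xi <= Rm ^ 2 -> N1 xi' <= Rm ^ 2 ->
  lsum (box N) (fun k => if res k then (yv xi' k - yv xi k) ^ 2 else 0) <= K * dres xi' xi.
Proof.
  set (L := lsum (box N) (fun k => (INR (fst k) ^ 2) ^ 2)).
  assert (HL : 0 <= L) by (apply lsum_nonneg; intros; apply pow2_ge_0).
  exists (2 * L + 4 * G ^ 2). split; [pose proof (pow2_ge_0 G); lra|]. intros xi xi' HN HN'.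
  pose proof (FP_lip xi' xi _ _ HN' HN (cs_FP xi' HN') (cs_FP xi HN)) as [E _].
  pose proof (bc_diff_sum _ _ (cs_supb xi' HN') (cs_supb xi HN)) as E2.
  apply Rle_trans with (lsum (box N) (fun k => 2 * (L * (if res k then (xi' k - xi k) ^ 2 else 0))
    + 2 * (bc (cs xi') k - bc (cs xi) k) ^ 2)).
  - apply lsum_le. intros k Hk.
    pose proof (pow2_ge_0 (bc (cs xi') k - bc (cs xi) k)).
    destruct (res k); [|lra]. unfold yv.
    assert (Hl : (INR (fst k) ^ 2) ^ 2 <= L).
    { apply (lsum_term_le (box N) (fun k => (INR (fst k) ^ 2) ^ 2)); [intros; apply pow2_ge_0|assumption]. }
    pose proof (pow2_ge_0 (xi' k - xi k)).
    set (a := INR (fst k) ^ 2) in *. set (d := xi' k - xi k) in *.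
    set (b := bc (cs xi') k - bc (cs xi) k) in *.
    replace (a * xi' k - bc (cs xi') k - (a * xi k - bc (cs xi) k)) with (a * d - b) by (unfold d, b; ring).
    assert ((a * d - b) ^ 2 <= 2 * (a ^ 2 * d ^ 2) + 2 * b ^ 2) by (pose proof (pow2_ge_0 (a * d + b)); nra).
    nra.
  - rewrite lsum_plus, !lsum_scal. fold (dres xi' xi). pose proof (pow2_ge_0 G). nra.
Qed.

(** * Comparison with the pure power along rays *)

Variables (p q : nat) (eps kp : R).
Hypothesis Hq : (2 <= q)%nat.
Hypothesis Hpq : (p + 1 = 2 * q)%nat.
Hypothesis Hg00 : g0 0 = 0.
Hypothesis Heps : forall y, Rabs y <= supb -> Rabs (g1 y - INR p * y ^ (p - 1)) <= eps.
Hypothesis Heps0 : 0 <= eps.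
(** One factor [p] and [supb^p] bound the Lipschitz constant of powers up to [p] on [[-supb, supb]];
    the other factor [p] comes from differentiating [z^p] once more. *)
Definition Cp : R := INR p * INR p * supb ^ p.
Hypothesis Hkp : 0 <= kp <= 1 / 10.
Hypothesis Hkp2 :
  3 * (eps ^ 2 + (2 * (eps + Cp) ^ 2 + 1156 * Cp ^ 2) * (kap ^ 2 * G ^ 2)) <= kp ^ 2.

Lemma supb_ge : 34 <= supb. Proof. unfold supb. lra. Qed.

Lemma pow_lip m x y : (m <= p)%nat -> Rabs x <= supb -> Rabs y <= supb ->
  Rabs (x ^ m - y ^ m) <= INR p * supb ^ p * Rabs (x - y).
Proof.
  intros Hm. pose proof supb_ge as HB.
  apply (lipschitz_of_derive (fun z => z ^ m) (fun z => INR m * z ^ (m - 1))).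
  - intros z. auto_derive; [trivial|]. replace (Init.Nat.pred m) with (m - 1)%nat by lia. ring.
  - intros z Hz. rewrite Rabs_mult, (Rabs_right (INR m)) by (apply Rle_ge, pos_INR).
    rewrite <- RPow_abs. apply Rmult_le_compat; [apply pos_INR|apply pow_le, Rabs_pos|now apply le_INR|].
    apply Rle_trans with (supb ^ (m - 1)).
    + apply pow_incr. split; [apply Rabs_pos|assumption].
    + apply Rle_pow; [lra|lia].
Qed.

Lemma rho_lip x y : Rabs x <= supb -> Rabs y <= supb ->
  Rabs ((g0 x - x ^ p) - (g0 y - y ^ p)) <= eps * Rabs (x - y).
Proof.
  apply (lipschitz_of_derive (fun z => g0 z - z ^ p) (fun z => g1 z - INR p * z ^ (p - 1))).
  - intros z. apply (is_derive_minus g0 (fun z => z ^ p)); [apply Hg|].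
    auto_derive; [trivial|]. replace (Init.Nat.pred p) with (p - 1)%nat by lia. ring.
  - intros; now apply Heps.
Qed.

(** Three sources of deviation from [X^p]: the remainder [g0 y - y^p], of Lipschitz constant [eps];
    the change of [w] inside the power; and the second difference of the power in [w'] and [X - X'],
    which is bilinear and therefore small with [w']. *)
Lemma pointwise_diff X X' w w' :
  Rabs X <= 17 * Rm -> Rabs X' <= 17 * Rm -> Rabs w <= 34 -> Rabs w' <= 34 ->
  Rabs ((g0 (X + w) - X ^ p) - (g0 (X' + w') - X' ^ p))
  <= eps * Rabs (X - X') + (eps + Cp) * Rabs (w - w') + Cp * Rabs w' * Rabs (X - X').
Proof.
  intros HX HX' Hw Hw'.
  assert (Hp1 : 1 <= INR p) by (apply (le_INR 1); lia).
  assert (Hs : forall a b, Rabs a <= 17 * Rm -> Rabs b <= 34 -> Rabs (a + b) <= supb).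
  { intros a b Ha Hb. unfold supb. eapply Rle_trans; [apply Rabs_triang|lra]. }
  assert (HCp : INR p * supb ^ p <= Cp).
  { unfold Cp. pose proof supb_ge. assert (0 <= supb ^ p) by (apply pow_le; lra).
    assert (0 <= INR p * supb ^ p) by (apply Rmult_le_pos; lra). rewrite Rmult_assoc. nra. }
  assert (H1 := rho_lip (X + w) (X' + w') (Hs X w HX Hw) (Hs X' w' HX' Hw')).
  assert (H2 := pow_lip p (X + w) (X + w') (le_n p) (Hs X w HX Hw) (Hs X w' HX Hw')).
  assert (H3 : Rabs (((X + w') ^ p - X ^ p) - ((X' + w') ^ p - X' ^ p)) <= Cp * Rabs w' * Rabs (X - X')).
  { apply (lipschitz_of_derive (fun z => (z + w') ^ p - z ^ p)
      (fun z => INR p * ((z + w') ^ (p - 1) - z ^ (p - 1))) (17 * Rm)); auto.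
    - intros z. auto_derive; [trivial|]. replace (Init.Nat.pred p) with (p - 1)%nat by lia. ring.
    - intros z Hz. rewrite Rabs_mult, (Rabs_right (INR p)) by lra.
      assert (Hz' : Rabs z <= supb) by (unfold supb; lra).
      assert (E := pow_lip (p - 1) (z + w') z ltac:(lia) (Hs z w' Hz Hw') Hz').
      replace (z + w' - z) with w' in E by ring. unfold Cp.
      replace (INR p * INR p * supb ^ p * Rabs w') with (INR p * (INR p * supb ^ p * Rabs w')) by ring.
      apply Rmult_le_compat_l; lra. }
  replace ((g0 (X + w) - X ^ p) - (g0 (X' + w') - X' ^ p)) with
    (((g0 (X + w) - (X + w) ^ p) - (g0 (X' + w') - (X' + w') ^ p))
     + ((X + w) ^ p - (X + w') ^ p) + (((X + w') ^ p - X ^ p) - ((X' + w') ^ p - X' ^ p))) by ring.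
  eapply Rle_trans; [apply Rabs_triang|]. apply Rplus_le_compat; [|assumption].
  eapply Rle_trans; [apply Rabs_triang|].
  replace (X + w - (X' + w')) with ((X - X') + (w - w')) in H1 by ring.
  replace (X + w - (X + w')) with (w - w') in H2 by ring.
  assert (E1 : eps * Rabs (X - X' + (w - w')) <= eps * (Rabs (X - X') + Rabs (w - w')))
    by (apply Rmult_le_compat_l; [assumption|apply Rabs_triang]).
  pose proof (Rabs_pos (w - w')).
  assert (E2 : INR p * supb ^ p * Rabs (w - w') <= Cp * Rabs (w - w')) by now apply Rmult_le_compat_r.
  lra.
Qed.

Definition rp (s : mode -> R) : mode -> R := fun k => if res k then s k else 0.
Definition wp (c : mode -> R) : mode -> R := fun k => if res k then 0 else c k.
Definition ray (r : R) (s : mode -> R) : mode -> R := fun k => r * s k.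
Definition Jf (s : mode -> R) : R := Int2 (fun t x => up N 0 (rp s) t x ^ (p + 1)).
(** The deviation of the radial slope of [Psi] from that of the model
    [r^2 / 2 - r^(p+1) Jf s / (p+1)]; see [Dr]. *)
Definition Er (s : mode -> R) (r : R) : R :=
  Int2 (fun t x => (g0 (up N 0 (cs (ray r s)) t x) - (r * up N 0 (rp s) t x) ^ p) * up N 0 (rp s) t x).

Lemma N1_ray r s : N1 (ray r s) = r ^ 2 * N1 s.
Proof.
  unfold N1, ray. rewrite <- lsum_scal. apply lsum_ext_in. intros k _. destruct (res k); ring.
Qed.
Lemma N1_ray_le r s : N1 s = 1 -> Rabs r <= Rm -> N1 (ray r s) <= Rm ^ 2.
Proof.
  intros H Hr. rewrite N1_ray, H, Rmult_1_r, <- (pow2_abs r). apply pow_incr.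
  split; [apply Rabs_pos|assumption].
Qed.
Lemma res_l_ge1 k : In k (box N) -> res k = true -> 1 <= INR (fst k).
Proof.
  destruct k as [l j]. rewrite in_box. unfold res; simpl. intros H E. apply Nat.eqb_eq in E.
  apply (le_INR 1). destruct l; lia.
Qed.
Lemma res_sq_le_N1 s : lsum (box N) (fun k => rp s k ^ 2) <= N1 s.
Proof.
  apply lsum_le. intros k Hk. unfold rp. destruct (res k) eqn:E; [|simpl; lra].
  pose proof (res_l_ge1 k Hk E). rewrite Rpow_mult_distr. pose proof (pow2_ge_0 (s k)).
  assert (1 <= INR (fst k) ^ 2) by nra. nra.
Qed.
Lemma vp_L2 s : Int2 (fun t x => up N 0 (rp s) t x ^ 2) <= N1 s.
Proof. eapply Rle_trans; [apply up_L2_0|apply res_sq_le_N1]. Qed.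
Lemma vp_sup s r t x : 0 <= r -> N1 s <= r ^ 2 -> Rabs (up N 0 (rp s) t x) <= 17 * r.
Proof.
  intros Hr H. eapply Rle_trans; [apply up_sup|].
  apply Rsqr_incr_0_var; [|lra]. unfold Rsqr. pose proof (l1_res s) as E.
  rewrite (lsum_ext_in _ _ (fun k => if res k then Rabs (s k) else 0)); [nra|].
  intros k _. unfold rp. destruct (res k); simpl; rewrite ?Rabs_R0; ring.
Qed.
Lemma wp_sup xi c t x : adm xi c -> Rabs (up N 0 (wp c) t x) <= 34.
Proof.
  intros [_ H]. eapply Rle_trans; [apply up_sup|].
  apply Rsqr_incr_0_var; [|lra]. unfold Rsqr.
  pose proof (l1_lam (wp c)) as E.
  rewrite (lsum_ext_in _ (fun k => (INR (fst k) ^ 2 + lam k ^ 2) * wp c k ^ 2)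
     (fun k => if res k then 0 else (INR (fst k) ^ 2 + lam k ^ 2) * c k ^ 2)) in E.
  - rewrite (lsum_ext_in _ _ (fun k => Rabs (wp c k))) by (intros; simpl; ring). nra.
  - intros k _. unfold wp. destruct (res k); ring.
Qed.
Lemma up_split xi c t x : adm xi c -> up N 0 c t x = up N 0 (rp xi) t x + up N 0 (wp c) t x.
Proof.
  intros [H _]. rewrite up_plus. apply up_ext. intros k Hk. unfold rp, wp.
  destruct (res k) eqn:E; [rewrite (H k Hk E)|]; ring.
Qed.
Lemma vp_ray r s t x : up N 0 (rp (ray r s)) t x = r * up N 0 (rp s) t x.
Proof.
  rewrite <- up_scal. apply up_ext. intros k _. unfold rp, ray. destruct (res k); ring.
Qed.

Lemma dres_ray s r r' : N1 s = 1 -> dres (ray r s) (ray r' s) <= (r - r') ^ 2.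
Proof.
  intros H. rewrite <- (Rmult_1_r ((r - r') ^ 2)), <- H. unfold dres.
  rewrite (lsum_ext_in _ _ (fun k => (r - r') ^ 2 * rp s k ^ 2)).
  - rewrite lsum_scal. apply Rmult_le_compat_l; [apply pow2_ge_0|apply res_sq_le_N1].
  - intros k _. unfold rp, ray. destruct (res k); ring.
Qed.

(** This is the C1-closeness to the model in the form used later: the perturbation of the slope is
    Lipschitz with a small constant, which allows second-order arguments although no second
    derivative of [Psi] is available. The three terms of [pointwise_diff], squared and integrated,
    produce [Hkp2]. *)
Lemma Er_lip s r r' : N1 s = 1 -> Rabs r <= Rm -> Rabs r' <= Rm ->
  Rabs (Er s r - Er s r') <= kp * Rabs (r - r').
Proof.
  intros Hs Hr Hr'.
  pose proof (N1_ray_le r s Hs Hr) as HN. pose proof (N1_ray_le r' s Hs Hr') as HN'.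
  pose proof (cs_FP _ HN) as HF. pose proof (cs_FP _ HN') as HF'.
  set (c := cs (ray r s)) in *. set (c' := cs (ray r' s)) in *. set (v := up N 0 (rp s)).
  set (w := up N 0 (wp c)). set (w' := up N 0 (wp c')).
  assert (Hv : jcont v) by (unfold v; auto with jc).
  assert (Hw : jcont w) by (unfold w; auto with jc).
  assert (Hw' : jcont w') by (unfold w'; auto with jc).
  set (Dl := fun t x => (g0 (up N 0 c t x) - (r * v t x) ^ p) - (g0 (up N 0 c' t x) - (r' * v t x) ^ p)).
  assert (HD : jcont Dl) by (unfold Dl; auto 10 with jc).
  assert (E0 : Er s r - Er s r' = Int2 (fun t x => Dl t x * v t x)).
  { unfold Er. fold c c' v. rewrite <- Int2_minus by auto 10 with jc.
    apply Int2_ext. intros. unfold Dl, v. ring. }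
  rewrite E0. apply sq_le_Rabs_le; [apply Rmult_le_pos; [lra|apply Rabs_pos]|].
  eapply Rle_trans; [apply Int2_CS; assumption|].
  rewrite Rpow_mult_distr, pow2_abs.
  assert (Hv2 : Int2 (fun t x => v t x ^ 2) <= 1) by (rewrite <- Hs; apply vp_L2).
  assert (HD0 : 0 <= Int2 (fun t x => Dl t x ^ 2))
    by (apply Int2_nonneg; auto with jc; intros; apply pow2_ge_0).
  assert (Hvs : forall t x, Rabs (v t x) <= 17).
  { intros t x. rewrite <- (Rmult_1_r 17). apply vp_sup; rewrite ?Hs; lra. }
  (* The factor 3 is from [(x1 + x2 + x3)^2 <= 3 (x1^2 + x2^2 + x3^2)], and [289 = 17^2] bounds
     [v^2]; together with the bound [4 kap^2 G^2] for [w'] it gives the 1156 of [Hkp2]. *)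
  set (a1 := 3 * (eps ^ 2 * (r - r') ^ 2)). set (a2 := 3 * (eps + Cp) ^ 2).
  set (a3 := 3 * (Cp ^ 2 * 289 * (r - r') ^ 2)).
  assert (HDl : Int2 (fun t x => Dl t x ^ 2) <=
     Int2 (fun t x => a1 * v t x ^ 2 + a2 * up N 0 (fun k => wp c k - wp c' k) t x ^ 2 + a3 * w' t x ^ 2)).
  { apply Int2_le; auto 10 with jc. intros t x _ _.
    rewrite <- up_minus. fold (w t x) (w' t x).
    unfold Dl. rewrite (up_split _ c t x (proj1 HF)), (up_split _ c' t x (proj1 HF')).
    rewrite !vp_ray. fold (v t x) (w t x) (w' t x).
    assert (Hrv : forall z, Rabs z <= Rm -> Rabs (z * v t x) <= 17 * Rm).
    { intros z Hz. rewrite Rabs_mult, Rmult_comm.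
      apply Rmult_le_compat; auto using Rabs_pos. }
    pose proof (pointwise_diff (r * v t x) (r' * v t x) (w t x) (w' t x) (Hrv r Hr) (Hrv r' Hr')
      (wp_sup _ c t x (proj1 HF)) (wp_sup _ c' t x (proj1 HF'))) as E.
    replace (r * v t x - r' * v t x) with ((r - r') * v t x) in E by ring.
    rewrite Rabs_mult in E.
    rewrite <- (pow2_abs (_ - _ - _)), <- (pow2_abs (v t x)), <- (pow2_abs (w t x - w' t x)), <- (pow2_abs (w' t x)).
    unfold a1, a2, a3. rewrite <- (pow2_abs (r - r')).
    set (A := Rabs (r - r')) in *. set (V := Rabs (v t x)) in *. set (W := Rabs (w t x - w' t x)) in *.
    set (W' := Rabs (w' t x)) in *.
    assert (HA : 0 <= A) by apply Rabs_pos. assert (HV : 0 <= V <= 17) by (split; [apply Rabs_pos|apply Hvs]).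
    assert (HW' : 0 <= W') by apply Rabs_pos.
    assert (HCp : 0 <= Cp).
    { unfold Cp. pose proof supb_ge. apply Rmult_le_pos; [apply Rmult_le_pos; apply pos_INR|apply pow_le; lra]. }
    set (x1 := eps * (A * V)) in *. set (x2 := (eps + Cp) * W) in *.
    assert (Hx3 : Cp * W' * (A * V) <= Cp * W' * (A * 17)).
    { apply Rmult_le_compat_l; [now apply Rmult_le_pos|]. apply Rmult_le_compat_l; lra. }
    set (x3 := Cp * W' * (A * 17)) in *.
    eapply Rle_trans; [apply pow_incr; split; [apply Rabs_pos|eapply Rle_trans; [apply E|apply Rplus_le_compat_l, Hx3]]|].
    replace (3 * (eps ^ 2 * A ^ 2) * V ^ 2 + 3 * (eps + Cp) ^ 2 * W ^ 2 + 3 * (Cp ^ 2 * 289 * A ^ 2) * W' ^ 2)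
      with (3 * (x1 ^ 2 + x2 ^ 2 + x3 ^ 2)) by (unfold x1, x2, x3; ring).
    pose proof (pow2_ge_0 (x1 - x2)). pose proof (pow2_ge_0 (x1 - x3)). pose proof (pow2_ge_0 (x2 - x3)). nra. }
  rewrite !Int2_plus, !Int2_scal in HDl by auto 10 with jc.
  pose proof (FP_lip _ _ c c' HN HN' HF HF') as [_ E2].
  pose proof (dres_ray s r r' Hs) as E3.
  pose proof (FP_nonres_small _ c' HN' HF') as E4.
  assert (E5 : Int2 (fun t x => up N 0 (fun k => wp c k - wp c' k) t x ^ 2)
     <= 2 * (kap ^ 2 * G ^ 2) * (r - r') ^ 2).
  { eapply Rle_trans; [apply up_L2_0|].
    rewrite (lsum_ext_in _ _ (fun k => if res k then 0 else (c k - c' k) ^ 2))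
      by (intros k _; unfold wp; destruct (res k); ring).
    eapply Rle_trans; [apply E2|]. apply Rmult_le_compat_l; [|assumption].
    pose proof (pow2_ge_0 kap). pose proof (pow2_ge_0 G). nra. }
  assert (E6 : Int2 (fun t x => w' t x ^ 2) <= 4 * (kap ^ 2 * G ^ 2)).
  { eapply Rle_trans; [apply up_L2_0|].
    rewrite (lsum_ext_in _ _ (fun k => if res k then 0 else c' k ^ 2))
      by (intros k _; unfold wp; destruct (res k); ring). lra. }
  assert (P1 : 0 <= (r - r') ^ 2) by apply pow2_ge_0.
  assert (F1 : a1 * Int2 (fun t x => v t x ^ 2) <= a1 * 1).
  { apply Rmult_le_compat_l; [|assumption]. unfold a1. pose proof (pow2_ge_0 eps). nra. }
  assert (F2 : a2 * Int2 (fun t x => up N 0 (fun k => wp c k - wp c' k) t x ^ 2)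
     <= a2 * (2 * (kap ^ 2 * G ^ 2) * (r - r') ^ 2)).
  { apply Rmult_le_compat_l; [|assumption]. unfold a2. pose proof (pow2_ge_0 (eps + Cp)). lra. }
  assert (F3 : a3 * Int2 (fun t x => w' t x ^ 2) <= a3 * (4 * (kap ^ 2 * G ^ 2))).
  { apply Rmult_le_compat_l; [|assumption]. unfold a3. pose proof (pow2_ge_0 Cp). nra. }
  assert (F4 : Int2 (fun t x => Dl t x ^ 2) <= kp ^ 2 * (r - r') ^ 2).
  { eapply Rle_trans; [apply HDl|].
    apply Rle_trans with (3 * (eps ^ 2 + (2 * (eps + Cp) ^ 2 + 1156 * Cp ^ 2) * (kap ^ 2 * G ^ 2)) * (r - r') ^ 2).
    - unfold a1, a2, a3 in *. lra.
    - now apply Rmult_le_compat_r. }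
  apply Rle_trans with (Int2 (fun t x => Dl t x ^ 2) * 1); [now apply Rmult_le_compat_l|lra].
Qed.

Lemma N1_zero : N1 (fun _ => 0) = 0.
Proof.
  unfold N1. rewrite (lsum_ext_in _ _ (fun _ => 0)); [apply lsum_zero|].
  intros k _. destruct (res k); ring.
Qed.
Lemma up_zero i t x : up N i (fun _ => 0) t x = 0.
Proof. unfold up. rewrite (lsum_ext_in _ _ (fun _ => 0)); [apply lsum_zero|]. intros; ring. Qed.
Lemma FP_zero : FP (fun _ => 0) (fun _ => 0).
Proof.
  split; [split; [reflexivity|]|].
  - rewrite (lsum_ext_in _ _ (fun _ => 0)); [rewrite lsum_zero; lra|].
    intros k _. destruct (res k); ring.
  - intros k _ _. unfold bc. rewrite (Int2_ext _ (fun _ _ => 0)).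
    + rewrite Int2_const. ring.
    + intros. rewrite up_zero, Hg00. ring.
Qed.
(** Zero is a fixed point over [xi = 0] because [g0 0 = 0], and [FP_lip] leaves room for only one on
    the box. *)
Lemma cs_ray_0 s k : In k (box N) -> cs (ray 0 s) k = 0.
Proof.
  intros Hk.
  assert (Hz : ray 0 s = (fun _ => 0)) by (apply functional_extensionality; intros; unfold ray; ring).
  rewrite Hz. assert (HN : N1 (fun _ => 0) <= Rm ^ 2) by (rewrite N1_zero; apply pow2_ge_0).
  pose proof (FP_lip _ _ _ _ HN HN (cs_FP _ HN) FP_zero) as [E _].
  replace (dres (fun _ => 0) (fun _ => 0)) with 0 in E.
  - pose proof (lsum_term_le (box N) (fun k => (cs (fun _ => 0) k - 0) ^ 2) k) as E2. cbv beta in E2.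
    assert (E3 : (cs (fun _ => 0) k - 0) ^ 2 <= 2 * 0).
    { eapply Rle_trans; [apply E2; [intros; apply pow2_ge_0|assumption]|assumption]. }
    nra.
  - unfold dres. rewrite (lsum_ext_in _ _ (fun _ => 0)); [symmetry; apply lsum_zero|].
    intros k' _. destruct (res k'); ring.
Qed.
Lemma up_cs_ray_0 s t x : up N 0 (cs (ray 0 s)) t x = 0.
Proof. rewrite (up_ext N 0 _ (fun _ => 0)); [apply up_zero|]. intros; now apply cs_ray_0. Qed.
Lemma Er_0 s : Er s 0 = 0.
Proof.
  unfold Er. rewrite (Int2_ext _ (fun _ _ => 0)); [rewrite Int2_const; ring|].
  intros. rewrite up_cs_ray_0, Hg00, Rmult_0_l, pow_i by lia. ring.
Qed.
Lemma Psi_ray_0 s : Psi (ray 0 s) = 0.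
Proof.
  unfold Psi, Act. rewrite (lsum_ext_in _ _ (fun _ => 0)), lsum_zero.
  - rewrite (Int2_ext _ (fun _ _ => 0)); [rewrite Int2_const; ring|].
    intros. rewrite up_cs_ray_0. unfold GG. apply (RInt_point 0 g0).
  - intros k Hk. rewrite (cs_ray_0 s k Hk). ring.
Qed.

(** The slope of [Psi] along the ray, as [Psi_ray_derive] confirms. *)
Definition Dr (s : mode -> R) (r : R) : R := r - r ^ p * Jf s - Er s r.

Lemma yv_ray s h r : lsum (box N) (fun k => if res k then yv (ray r s) k * h k else 0)
  = r * lsum (box N) (fun k => if res k then INR (fst k) ^ 2 * s k * h k else 0)
    - Int2 (fun t x => g0 (up N 0 (cs (ray r s)) t x) * up N 0 (rp h) t x).
Proof.
  rewrite <- bc_pair, <- lsum_scal, <- lsum_minus. apply lsum_ext_in. intros k _.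
  unfold yv, rp, ray. destruct (res k); ring.
Qed.
Lemma yv_ray_self s r : N1 s = 1 ->
  lsum (box N) (fun k => if res k then yv (ray r s) k * s k else 0) = Dr s r.
Proof.
  intros H. rewrite yv_ray.
  replace (lsum (box N) (fun k => if res k then INR (fst k) ^ 2 * s k * s k else 0)) with (N1 s)
    by (apply lsum_ext_in; intros k _; destruct (res k); ring).
  rewrite H. unfold Dr, Er, Jf. rewrite <- Int2_scal by auto with jc.
  enough (Int2 (fun t x => g0 (up N 0 (cs (ray r s)) t x) * up N 0 (rp s) t x)
     = Int2 (fun t x => r ^ p * up N 0 (rp s) t x ^ (p + 1)) +
       Int2 (fun t x => (g0 (up N 0 (cs (ray r s)) t x) - (r * up N 0 (rp s) t x) ^ p) * up N 0 (rp s) t x)) by lra.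
  rewrite <- Int2_plus by auto 10 with jc. apply Int2_ext. intros.
  rewrite Rpow_mult_distr, pow_add. ring.
Qed.

Lemma dres_ray_gen r s s' : dres (ray r s) (ray r s') = r ^ 2 * dres s s'.
Proof.
  unfold dres. rewrite <- lsum_scal. apply lsum_ext_in. intros k _. unfold ray. destruct (res k); ring.
Qed.

Lemma is_derive_of_quadratic (f : R -> R) x l K d : 0 < d ->
  (forall y, Rabs (y - x) < d -> Rabs (f y - f x - l * (y - x)) <= K * (y - x) ^ 2) -> is_derive f x l.
Proof.
  intros Hd H. apply is_derive_Reals. intros e He.
  assert (HK : 0 < Rabs K + 1) by (pose proof (Rabs_pos K); lra).
  assert (Hm : 0 < Rmin d (e / (Rabs K + 1))).
  { apply Rmin_pos; [assumption|]. now apply Rdiv_lt_0_compat. }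
  exists (mkposreal _ Hm). simpl. intros h Hh Hh2.
  assert (H1 : Rabs h < d) by (eapply Rlt_le_trans; [apply Hh2|apply Rmin_l]).
  assert (H2 : Rabs h < e / (Rabs K + 1)) by (eapply Rlt_le_trans; [apply Hh2|apply Rmin_r]).
  specialize (H (x + h)). replace (x + h - x) with h in H by ring. specialize (H H1).
  replace ((f (x + h) - f x) / h - l) with ((f (x + h) - f x - l * h) / h) by (field; assumption).
  unfold Rdiv. rewrite Rabs_mult, Rabs_inv.
  assert (Hp : 0 < Rabs h) by now apply Rabs_pos_lt.
  apply Rmult_lt_reg_r with (Rabs h); [assumption|].
  rewrite Rmult_assoc, Rinv_l, Rmult_1_r by lra.
  eapply Rle_lt_trans; [apply H|]. rewrite <- (pow2_abs h).
  apply (Rmult_lt_compat_r (Rabs K + 1)) in H2; [|assumption].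
  unfold Rdiv in H2. rewrite Rmult_assoc, Rinv_l, Rmult_1_r in H2 by lra.
  pose proof (Rle_abs K). nra.
Qed.

Lemma Psi_ray_quadratic s : N1 s = 1 -> exists K, 0 <= K /\ forall r y, Rabs r <= Rm -> Rabs y <= Rm ->
  Rabs (Psi (ray y s) - Psi (ray r s) - Dr s r * (y - r)) <= K * (y - r) ^ 2.
Proof.
  intros Hs. destruct Psi_expand as [K [HK H]]. exists K. split; [assumption|]. intros r y Hr Hy.
  specialize (H (ray r s) (ray y s) (N1_ray_le r s Hs Hr) (N1_ray_le y s Hs Hy)).
  rewrite (lsum_ext_in _ _ (fun k => (y - r) * (if res k then yv (ray r s) k * s k else 0))) in H
    by (intros k _; unfold ray; destruct (res k); ring).
  rewrite lsum_scal, (yv_ray_self s r Hs), Rmult_comm in H.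
  eapply Rle_trans; [apply H|]. apply Rmult_le_compat_l; [assumption|]. now apply dres_ray.
Qed.

Lemma Psi_ray_derive s r : N1 s = 1 -> Rabs r < Rm ->
  is_derive (fun r => Psi (ray r s)) r (Dr s r).
Proof.
  intros Hs Hr. destruct (Psi_ray_quadratic s Hs) as [K [HK H]].
  apply (is_derive_of_quadratic _ r _ K (Rm - Rabs r)); [lra|]. intros y Hy. apply H; [lra|].
  replace y with ((y - r) + r) by ring. eapply Rle_trans; [apply Rabs_triang|lra].
Qed.

(** * Levels of rays and their minimiser *)

Variable Rr : R.
Hypothesis HRr1 : 1 <= Rr.
Hypothesis HRmRr : Rm = Rr + 1.
Hypothesis HRrQ : 8 * (1 + INR (p + 1) * 4 ^ (q - 1)) < Rr ^ 2.
Hypothesis HnN : (n <= N)%nat.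

Lemma nonincreasing_of_derive (f f' : R -> R) a b : a <= b ->
  (forall x, a <= x <= b -> is_derive f x (f' x)) -> (forall x, a <= x <= b -> f' x <= 0) -> f b <= f a.
Proof.
  intros Hab Hf H. destruct (MVT_gen f a b f') as [c [Hc E]].
  - rewrite Rmin_left, Rmax_right by assumption. intros; apply Hf; lra.
  - rewrite Rmin_left, Rmax_right by assumption. intros x Hx. apply continuity_pt_filterlim.
    apply (ex_derive_continuous f). eexists. now apply Hf.
  - rewrite Rmin_left, Rmax_right in Hc by assumption. specialize (H c Hc). nra.
Qed.

(** Multiplying the tangent inequality of degree [m + 1] by [y] exceeds the one of degree [m + 2] by
    [(m + 1) t^m (y - t)^2]. *)
Lemma pow_tangent m y t : 0 <= y -> 0 <= t -> t ^ S m + INR (S m) * t ^ m * (y - t) <= y ^ S m.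
Proof.
  intros Hy Ht. induction m as [|m IH]; [simpl; lra|].
  apply Rle_trans with (y * (t ^ S m + INR (S m) * t ^ m * (y - t))).
  - rewrite (S_INR (S m)). simpl pow.
    assert (0 <= INR (S m) * t ^ m) by (apply Rmult_le_pos; [apply pos_INR|now apply pow_le]).
    pose proof (pow2_ge_0 (y - t)). nra.
  - simpl pow at 3. apply Rmult_le_compat_l; assumption.
Qed.

Lemma Jf_nonneg s : 0 <= Jf s.
Proof.
  unfold Jf. apply Int2_nonneg; [auto with jc|]. intros. rewrite Hpq, pow_mult.
  apply pow_le, pow2_ge_0.
Qed.

Lemma Er_le s r : N1 s = 1 -> 0 <= r <= Rm -> Rabs (Er s r) <= kp * r.
Proof.
  intros Hs Hr. pose proof (Er_lip s r 0 Hs) as E. rewrite Er_0, !Rminus_0_r in E.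
  rewrite (Rabs_right r) in E by lra. apply E; [lra|]. rewrite Rabs_R0. lra.
Qed.

Lemma p_minus : exists m, p = S m /\ (2 <= m)%nat.
Proof. exists (p - 1)%nat. lia. Qed.

(** Integration of the slope from 0, where [Psi] vanishes, using [|Er s x| <= kp x]: only the
    quadratic coefficient of the model is blurred. *)
Lemma Psi_ray_bounds s r : N1 s = 1 -> 0 <= r <= Rr ->
  r ^ 2 * (1 - kp) / 2 - r ^ (p + 1) * Jf s / INR (p + 1) <= Psi (ray r s)
  <= r ^ 2 * (1 + kp) / 2 - r ^ (p + 1) * Jf s / INR (p + 1).
Proof.
  intros Hs Hr.
  assert (Hp0 : INR (p + 1) <> 0) by (apply not_0_INR; lia).
  assert (Hd : forall c x, is_derive (fun x => x ^ 2 * c / 2 - x ^ (p + 1) * Jf s / INR (p + 1)) x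
                (x * c - x ^ p * Jf s)).
  { intros c x. auto_derive; [trivial|]. rewrite Nat.add_1_r. simpl Init.Nat.pred.
    rewrite Nat.add_1_r in Hp0. field. assumption. }
  split.
  - assert (E := nonincreasing_of_derive
      (fun x => (x ^ 2 * (1 - kp) / 2 - x ^ (p + 1) * Jf s / INR (p + 1)) - Psi (ray x s))
      (fun x => (x * (1 - kp) - x ^ p * Jf s) - Dr s x) 0 r (proj1 Hr)).
    cbv beta in E. rewrite Psi_ray_0, !pow_i in E by lia.
    enough (forall z, z <= 0 * (1 - kp) / 2 - 0 * Jf s / INR (p + 1) - 0 -> z <= 0) as Hz.
    { apply Rminus_le. apply Hz, E.
      - intros x Hx. apply (is_derive_minus (fun x => x ^ 2 * (1 - kp) / 2 - x ^ (p + 1) * Jf s / INR (p + 1))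
          (fun x => Psi (ray x s))); [apply Hd|]. apply Psi_ray_derive; [assumption|].
        rewrite Rabs_right; lra.
      - intros x Hx. unfold Dr. pose proof (Er_le s x Hs) as E2.
        apply Rabs_le_between in E2; lra. }
    intros z. unfold Rdiv. lra.
  - assert (E := nonincreasing_of_derive
      (fun x => Psi (ray x s) - (x ^ 2 * (1 + kp) / 2 - x ^ (p + 1) * Jf s / INR (p + 1)))
      (fun x => Dr s x - (x * (1 + kp) - x ^ p * Jf s)) 0 r (proj1 Hr)).
    cbv beta in E. rewrite Psi_ray_0, !pow_i in E by lia.
    enough (forall z, z <= 0 - (0 * (1 + kp) / 2 - 0 * Jf s / INR (p + 1)) -> z <= 0) as Hz.
    { apply Rminus_le. apply Hz, E.
      - intros x Hx. apply (is_derive_minus (fun x => Psi (ray x s))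
          (fun x => x ^ 2 * (1 + kp) / 2 - x ^ (p + 1) * Jf s / INR (p + 1))); [|apply Hd].
        apply Psi_ray_derive; [assumption|]. rewrite Rabs_right; lra.
      - intros x Hx. unfold Dr. pose proof (Er_le s x Hs) as E2.
        apply Rabs_le_between in E2; lra. }
    intros z. unfold Rdiv. lra.
Qed.

Lemma Dr_nonpos_bound s r : N1 s = 1 -> 0 < r <= Rm -> Dr s r <= 0 -> 1 - kp <= r ^ (p - 1) * Jf s.
Proof.
  intros Hs Hr H. unfold Dr in H. assert (E : Rabs (Er s r) <= kp * r) by (apply Er_le; [assumption|lra]).
  apply Rabs_le_between in E. apply Rmult_le_reg_l with r; [lra|].
  replace (r * (r ^ (p - 1) * Jf s)) with (r ^ p * Jf s).
  - lra.
  - destruct p_minus as [m [-> _]]. simpl. rewrite Nat.sub_0_r. ring.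
Qed.
Lemma Dr_nonneg_bound s r : N1 s = 1 -> 0 < r <= Rm -> 0 <= Dr s r -> r ^ (p - 1) * Jf s <= 1 + kp.
Proof.
  intros Hs Hr H. unfold Dr in H. assert (E : Rabs (Er s r) <= kp * r) by (apply Er_le; [assumption|lra]).
  apply Rabs_le_between in E. apply Rmult_le_reg_l with r; [lra|].
  replace (r * (r ^ (p - 1) * Jf s)) with (r ^ p * Jf s).
  - lra.
  - destruct p_minus as [m [-> _]]. simpl. rewrite Nat.sub_0_r. ring.
Qed.

(** Uniqueness of the maximum on a ray. A nonpositive slope at [r1] forces
    [r1^(p-1) Jf s >= 1 - kp]; convexity of [r^p] with [p >= 3] then makes the model slope fall at
    rate at least [3 (1 - kp) - 1], faster than [Er], of Lipschitz constant [kp], can rise. *)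
Lemma Dr_sign s r1 r2 : N1 s = 1 -> 0 < r1 -> r1 < r2 -> r2 <= Rm -> Dr s r1 <= 0 -> Dr s r2 < 0.
Proof.
  intros Hs H1 H12 H2 HD.
  pose proof (Dr_nonpos_bound s r1 Hs (conj H1 (Rlt_le _ _ (Rlt_le_trans _ _ _ H12 H2))) HD) as E.
  assert (EL : Rabs (Er s r2 - Er s r1) <= kp * (r2 - r1)).
  { rewrite <- (Rabs_right (r2 - r1)) by lra. apply (Er_lip s r2 r1 Hs); rewrite Rabs_right; lra. }
  apply Rabs_le_between in EL.
  destruct p_minus as [m [Hm Hm2]].
  assert (T : r1 ^ p + INR p * r1 ^ (p - 1) * (r2 - r1) <= r2 ^ p).
  { rewrite Hm. simpl Nat.sub. rewrite Nat.sub_0_r. apply pow_tangent; lra. }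
  assert (Hp3 : 3 <= INR p) by (replace 3 with (INR 3) by (simpl; ring); apply le_INR; lia).
  pose proof (Jf_nonneg s).
  assert (T2 : Jf s * (INR p * r1 ^ (p - 1) * (r2 - r1)) <= Jf s * (r2 ^ p - r1 ^ p))
    by (apply Rmult_le_compat_l; lra).
  assert (T3 : 3 * (1 - kp) * (r2 - r1) <= Jf s * (INR p * r1 ^ (p - 1) * (r2 - r1))).
  { replace (Jf s * (INR p * r1 ^ (p - 1) * (r2 - r1))) with (INR p * (r1 ^ (p - 1) * Jf s) * (r2 - r1)) by ring.
    apply Rmult_le_compat_r; [lra|]. apply Rmult_le_compat; lra. }
  unfold Dr in *. nra.
Qed.

Definition e1 : mode -> R := fun k => if Nat.eqb (fst k) 1 then 1 else 0.
Lemma rp_e1 k : rp e1 k = if (Nat.eqb (fst k) 1 && Nat.eqb (snd k) n)%bool then 1 else 0.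
Proof.
  destruct k as [l j]. unfold rp, e1, res; simpl.
  destruct (Nat.eqb_spec l 1) as [->|]; simpl; [rewrite Nat.mul_1_r; reflexivity|].
  destruct (Nat.eqb j (n * l)); reflexivity.
Qed.
Lemma up_e1 t x : up N 0 (rp e1) t x = psi 0 (1%nat, n) t x.
Proof.
  unfold up. rewrite (lsum_single _ _ (1%nat, n) (NoDup_box N)).
  - rewrite rp_e1. simpl. rewrite Nat.eqb_refl. simpl. ring.
  - apply in_box. lia.
  - intros [l j] _ Hne. rewrite rp_e1. simpl.
    destruct (Nat.eqb_spec l 1) as [->|]; simpl; [|ring].
    destruct (Nat.eqb_spec j n) as [->|]; [congruence|ring].
Qed.
Lemma N1_e1 : N1 e1 = 1.
Proof.
  unfold N1. rewrite (lsum_single _ _ (1%nat, n) (NoDup_box N)).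
  - unfold res, e1; simpl. rewrite Nat.mul_1_r, Nat.eqb_refl. ring.
  - apply in_box. lia.
  - intros [l j] _ Hne. unfold res, e1; simpl.
    destruct (Nat.eqb_spec j (n * l)) as [->|]; [|reflexivity].
    destruct (Nat.eqb_spec l 1) as [->|]; [|ring]. rewrite Nat.mul_1_r in Hne. congruence.
Qed.
(* Jensen: [y^q] lies above its tangent at [1/4], and the mean of [psi^2] over the square
   (total mass 4) is 1. *)
Lemma Jf_e1 : (/ 4) ^ (q - 1) <= Jf e1.
Proof.
  unfold Jf. set (P := psi 0 (1%nat, n)).
  rewrite (Int2_ext _ (fun t x => (P t x ^ 2) ^ q))
    by (intros; rewrite up_e1, Hpq, pow_mult; reflexivity).
  assert (HP : Int2 (fun t x => P t x ^ 2) = 1) by (apply psi0_sq; lia).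
  assert (HPc : jcont P) by (unfold P; auto with jc).
  set (m := (q - 1)%nat). assert (Hqm : q = S m) by lia.
  apply Rle_trans with (Int2 (fun t x => ((/ 4) ^ S m - INR (S m) * (/ 4) ^ m * / 4)
     + INR (S m) * (/ 4) ^ m * P t x ^ 2)).
  - rewrite Int2_plus, Int2_const, Int2_scal, HP by auto with jc. simpl pow. rewrite S_INR. right. field.
  - apply Int2_le; auto with jc. intros t x _ _. rewrite Hqm.
    pose proof (pow_tangent m (P t x ^ 2) (/ 4) (pow2_ge_0 _) ltac:(lra)). lra.
Qed.

(** An upper bound for the maximum of [Psi] over some ray cut at [Rr]. The margin [Rm = Rr + 1]
    keeps [Psi] differentiable up to the cut. *)
Definition level (c : R) : Prop :=
  exists s, N1 s = 1 /\ forall r, 0 <= r <= Rr -> Psi (ray r s) <= c.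

(** The test direction is the lowest resonant mode. Once [r^(p-1)] exceeds [(p+1) 4^(q-1)] the
    potential outweighs the quadratic part; before that, [r^2] is at most 1 or at most [r^(p-1)].
    The bound is explicit so that [Rr] can be fixed in advance. *)
Lemma level_Q : level (1 + INR (p + 1) * 4 ^ (q - 1)).
Proof.
  exists e1. split; [apply N1_e1|]. intros r Hr.
  destruct (Psi_ray_bounds e1 r N1_e1 Hr) as [_ E]. eapply Rle_trans; [apply E|].
  pose proof Jf_e1 as HJ.
  assert (HP : 0 < INR (p + 1)) by (apply lt_0_INR; lia).
  assert (H4 : 0 < 4 ^ (q - 1)) by (apply pow_lt; lra).
  assert (Hr2 : 0 <= r ^ 2) by apply pow2_ge_0.
  assert (Hle : r ^ 2 * (1 + kp) / 2 <= r ^ 2) by nra.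
  rewrite pow_inv in HJ.
  set (X := r ^ (p - 1)). assert (HX : 0 <= X) by (apply pow_le; lra).
  replace (r ^ (p + 1)) with (r ^ 2 * X) by (unfold X; rewrite <- pow_add; f_equal; lia).
  destruct (Rle_dec (INR (p + 1) * 4 ^ (q - 1)) X) as [HX2|HX2].
  - assert (1 <= X * Jf e1 / INR (p + 1)).
    { apply Rmult_le_reg_r with (INR (p + 1)); [assumption|]. unfold Rdiv.
      rewrite Rmult_assoc, Rinv_l, Rmult_1_l, Rmult_1_r by lra.
      apply Rle_trans with (INR (p + 1) * 4 ^ (q - 1) * / 4 ^ (q - 1)).
      - right. field. lra.
      - apply Rmult_le_compat; try lra.
        + apply Rmult_le_pos; lra.
        + left. now apply Rinv_0_lt_compat. }
    replace (r ^ 2 * X * Jf e1 / INR (p + 1)) with (r ^ 2 * (X * Jf e1 / INR (p + 1))) by (unfold Rdiv; ring).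
    assert (0 <= INR (p + 1) * 4 ^ (q - 1)) by (apply Rmult_le_pos; lra). nra.
  - assert (0 <= r ^ 2 * X * Jf e1 / INR (p + 1)).
    { apply Rmult_le_pos; [|left; now apply Rinv_0_lt_compat].
      apply Rmult_le_pos; [now apply Rmult_le_pos|apply Jf_nonneg]. }
    destruct (Rle_dec r 1) as [Hr1|Hr1].
    + assert (r ^ 2 <= 1) by nra. assert (0 <= INR (p + 1) * 4 ^ (q - 1)) by (apply Rmult_le_pos; lra). lra.
    + assert (r ^ 2 <= X) by (apply Rle_pow; [lra|lia]). lra.
Qed.

Lemma level_nonneg c : level c -> 0 <= c.
Proof. intros [s [_ H]]. specialize (H 0). rewrite Psi_ray_0 in H. apply H. lra. Qed.

Lemma Psi_lim (xi : nat -> mode -> R) xi0 : (forall i, N1 (xi i) <= Rm ^ 2) -> N1 xi0 <= Rm ^ 2 ->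
  (forall k, In k (box N) -> res k = true -> is_lim_seq (fun i => xi i k) (xi0 k)) ->
  is_lim_seq (fun i => Psi (xi i)) (Psi xi0).
Proof.
  intros HN HN0 Hl. destruct Psi_expand as [K [HK H]].
  assert (Hd : forall k, In k (box N) -> res k = true -> is_lim_seq (fun i => xi i k - xi0 k) 0).
  { intros k Hk E. replace 0 with (xi0 k - xi0 k) by ring.
    apply is_lim_seq_minus'; [now apply Hl|apply is_lim_seq_const]. }
  assert (L1 : is_lim_seq (fun i => K * dres (xi i) xi0) (K * lsum (box N) (fun _ => 0))).
  { apply is_lim_seq_scal'.
    apply (is_lim_seq_lsum (box N) (fun i k => if res k then (xi i k - xi0 k) ^ 2 else 0) (fun _ => 0)).
    intros k Hk. destruct (res k) eqn:E; [|apply is_lim_seq_const].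
    replace 0 with (0 ^ 2) by ring. apply is_lim_seq_sq. now apply Hd. }
  assert (L2 : is_lim_seq (fun i => lsum (box N) (fun k => if res k then yv xi0 k * (xi i k - xi0 k) else 0))
     (lsum (box N) (fun _ => 0))).
  { apply (is_lim_seq_lsum (box N) (fun i k => if res k then yv xi0 k * (xi i k - xi0 k) else 0) (fun _ => 0)).
    intros k Hk. destruct (res k) eqn:E; [|apply is_lim_seq_const].
    replace 0 with (yv xi0 k * 0) by ring. apply is_lim_seq_scal'. now apply Hd. }
  rewrite lsum_zero in L1, L2. rewrite Rmult_0_r in L1.
  set (L := fun i => lsum (box N) (fun k => if res k then yv xi0 k * (xi i k - xi0 k) else 0)) in *.
  apply (is_lim_seq_le_le (fun i => Psi xi0 + L i - K * dres (xi i) xi0) _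
     (fun i => Psi xi0 + L i + K * dres (xi i) xi0)).
  - intros i. specialize (H xi0 (xi i) HN0 (HN i)). apply Rabs_le_between in H. unfold L. lra.
  - replace (Finite (Psi xi0)) with (Finite (Psi xi0 + 0 - 0)) by (f_equal; ring).
    apply is_lim_seq_minus'; [|exact L1]. apply is_lim_seq_plus'; [apply is_lim_seq_const|exact L2].
  - replace (Finite (Psi xi0)) with (Finite (Psi xi0 + 0 + 0)) by (f_equal; ring).
    apply is_lim_seq_plus'; [|exact L1]. apply is_lim_seq_plus'; [apply is_lim_seq_const|exact L2].
Qed.

Lemma minimal_level : exists c s, N1 s = 1 /\ (forall r, 0 <= r <= Rr -> Psi (ray r s) <= c) /\
  forall c', level c' -> c <= c'.
Proof.
  destruct (completeness (fun c => level (- c))) as [m [Hm1 Hm2]].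
  - exists 0. intros c Hc. apply level_nonneg in Hc. lra.
  - exists (- (1 + INR (p + 1) * 4 ^ (q - 1))). rewrite Ropp_involutive. apply level_Q.
  - assert (Hlow : forall c', level c' -> - m <= c').
    { intros c' Hc'. rewrite <- (Ropp_involutive c') in Hc'. specialize (Hm1 _ Hc'). lra. }
    assert (Hs : forall i : nat, exists s, N1 s = 1 /\ forall r, 0 <= r <= Rr -> Psi (ray r s) <= - m + / (INR i + 1)).
    { intros i. assert (Hi : 0 < / (INR i + 1)) by (apply Rinv_0_lt_compat; pose proof (pos_INR i); lra).
      apply NNPP. intros Hno.
      assert (Hub : is_upper_bound (fun c => level (- c)) (m - / (INR i + 1))).
      { intros c [s [Hs1 Hs2]]. destruct (Rle_dec c (m - / (INR i + 1))) as [|Hc]; [assumption|].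
        exfalso. apply Hno. exists s. split; [assumption|]. intros r Hr. specialize (Hs2 r Hr). lra. }
      specialize (Hm2 _ Hub). lra. }
    set (S0 := fun i => epsilon (inhabits (fun _ : mode => 0))
      (fun s => N1 s = 1 /\ forall r, 0 <= r <= Rr -> Psi (ray r s) <= - m + / (INR i + 1))).
    assert (HS0 : forall i, N1 (S0 i) = 1 /\ forall r, 0 <= r <= Rr -> Psi (ray r (S0 i)) <= - m + / (INR i + 1)).
    { intros i. apply (epsilon_spec (inhabits (fun _ : mode => 0))
        (fun s => N1 s = 1 /\ forall r, 0 <= r <= Rr -> Psi (ray r s) <= - m + / (INR i + 1))). apply Hs. }
    (* Off the resonant modes of the box a minimising direction is arbitrary, whereas the extraction
       needs a bound at every mode. Clipping provides it and changes nothing that counts, since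
       [N1 = 1] forces resonant entries into [[-1, 1]]. *)
    set (clip := fun y => Rmax (-1) (Rmin 1 y)).
    assert (Hclip : forall i k, In k (box N) -> res k = true -> clip (S0 i k) = S0 i k).
    { intros i k Hk E. destruct (HS0 i) as [H1 _].
      assert (Hle : rp (S0 i) k ^ 2 <= 1).
      { rewrite <- H1. eapply Rle_trans; [|apply res_sq_le_N1].
        apply (lsum_term_le (box N) (fun k => rp (S0 i) k ^ 2)); [intros; apply pow2_ge_0|assumption]. }
      unfold rp in Hle. rewrite E in Hle. unfold clip.
      rewrite Rmin_right, Rmax_right; try reflexivity; try nra. }
    destruct (mode_extraction (fun i k => clip (S0 i k)) 1) as [phi [Hphi Hl]].
    { intros i k. unfold clip. apply Rabs_le. split; [apply Rmax_l|].
      apply Rmax_lub; [lra|apply Rmin_l]. }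
    set (s := fun k => real (Lim_seq (fun i => clip (S0 (phi i) k)))) in *.
    assert (Hl' : forall k, In k (box N) -> res k = true -> is_lim_seq (fun i => S0 (phi i) k) (s k)).
    { intros k Hk E. apply (is_lim_seq_ext (fun i => clip (S0 (phi i) k))); [|apply Hl].
      intros i. now apply Hclip. }
    assert (HN : N1 s = 1).
    { assert (E : is_lim_seq (fun i => N1 (S0 (phi i))) (N1 s)).
      { apply (is_lim_seq_lsum (box N) (fun i k => if res k then (INR (fst k) * S0 (phi i) k) ^ 2 else 0)
          (fun k => if res k then (INR (fst k) * s k) ^ 2 else 0)).
        intros k Hk. destruct (res k) eqn:Er; [|apply is_lim_seq_const].
        apply is_lim_seq_sq, is_lim_seq_scal'. now apply Hl'. }
      apply (is_lim_seq_ext _ (fun _ => 1)) in E; [|intros i; apply HS0].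
      apply is_lim_seq_unique in E. rewrite Lim_seq_const in E. now injection E. }
    exists (- m), s. split; [exact HN|]. split; [|exact Hlow]. intros r Hr.
    assert (Hr' : Rabs r <= Rm) by (rewrite Rabs_right; lra).
    assert (E : is_lim_seq (fun i => Psi (ray r (S0 (phi i)))) (Psi (ray r s))).
    { apply Psi_lim.
      - intros i. apply N1_ray_le; [apply HS0|assumption].
      - now apply N1_ray_le.
      - intros k Hk Er. unfold ray. apply is_lim_seq_scal'. now apply Hl'. }
    assert (E2 : is_lim_seq (fun i => - m + / (INR i + 1)) (- m + 0)).
    { apply is_lim_seq_plus'; [apply is_lim_seq_const|].
      apply (is_lim_seq_ext (fun i => / INR (S i))); [intros; now rewrite S_INR|].
      apply (is_lim_seq_incr_1 (fun i => / INR i)).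
      replace (Finite 0) with (Rbar_inv p_infty) by reflexivity.
      apply is_lim_seq_inv; [apply is_lim_seq_INR|discriminate]. }
    rewrite Rplus_0_r in E2.
    assert (Hle : forall i, Psi (ray r (S0 (phi i))) <= - m + / (INR i + 1)).
    { intros i. eapply Rle_trans; [apply HS0; assumption|]. apply Rplus_le_compat_l.
      apply Rinv_le_contravar; [pose proof (pos_INR i); lra|].
      pose proof (le_INR _ _ (extraction_ge phi Hphi i)). lra. }
    apply (is_lim_seq_le _ _ _ _ Hle E E2).
Qed.

(** Turns the strict maximum into a fixed gap: at distance [eta] from [r0] the function stays below
    some [m < phi r0], namely the larger of its values at [r0 - eta] and [r0 + eta]. *)
Lemma monotone_away (phi D : R -> R) (b r0 eta : R) :
  0 < eta -> 0 <= r0 - eta -> r0 + eta <= b ->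
  (forall x, 0 <= x <= b -> is_derive phi x (D x)) ->
  (forall x, 0 < x < r0 -> 0 < D x) -> (forall x, r0 < x <= b -> D x < 0) ->
  exists m, m < phi r0 /\ forall x, 0 <= x <= b -> eta <= Rabs (x - r0) -> phi x <= m.
Proof.
  intros He H1 H2 Hd Hpos Hneg.
  assert (Hmvt : forall x y, 0 <= x -> x < y -> y <= b -> exists z, x < z < y /\ phi y - phi x = D z * (y - x)).
  { intros x y Hx Hxy Hy. destruct (MVT_cor2 phi D x y Hxy) as [z [E Hz]].
    - intros z Hz. apply is_derive_Reals. apply Hd. lra.
    - exists z. split; [exact Hz|exact E]. }
  exists (Rmax (phi (r0 - eta)) (phi (r0 + eta))). split.
  - apply Rmax_lub_lt.
    + destruct (Hmvt (r0 - eta) r0) as [z [Hz E]]; try lra.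
      assert (0 < D z) by (apply Hpos; lra). nra.
    + destruct (Hmvt r0 (r0 + eta)) as [z [Hz E]]; try lra.
      assert (D z < 0) by (apply Hneg; lra). nra.
  - intros x Hx Hxe. destruct (Rle_dec x r0) as [Hx0|Hx0].
    + rewrite Rabs_left1 in Hxe by lra. eapply Rle_trans; [|apply Rmax_l].
      destruct (Req_dec x (r0 - eta)) as [->|Hne]; [lra|].
      destruct (Hmvt x (r0 - eta)) as [z [Hz E]]; try lra.
      assert (0 < D z) by (apply Hpos; lra). nra.
    + rewrite Rabs_right in Hxe by lra. eapply Rle_trans; [|apply Rmax_r].
      destruct (Req_dec x (r0 + eta)) as [->|Hne]; [lra|].
      destruct (Hmvt (r0 + eta) x) as [z [Hz E]]; try lra.
      assert (D z < 0) by (apply Hneg; lra). nra.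
Qed.

Lemma ray_max s : N1 s = 1 -> exists r0, 0 <= r0 <= Rr /\
  forall r, 0 <= r <= Rr -> Psi (ray r s) <= Psi (ray r0 s).
Proof.
  intros Hs. destruct (continuity_ab_maj (fun r => Psi (ray r s)) 0 Rr) as [r0 [H1 H2]].
  - lra.
  - intros r Hr. apply continuity_pt_filterlim. apply (ex_derive_continuous (fun r => Psi (ray r s))).
    eexists. apply Psi_ray_derive; [assumption|]. rewrite Rabs_right; lra.
  - exists r0. split; assumption.
Qed.

Lemma INR_p1_ge4 : 4 <= INR (p + 1).
Proof. replace 4 with (INR 4) by (simpl; ring). apply le_INR. lia. Qed.

Lemma pow_p1 r : r ^ (p + 1) = r ^ 2 * r ^ (p - 1).
Proof. rewrite <- pow_add. f_equal. lia. Qed.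

(* At the endpoint [Rr] a nonnegative slope would force an energy of order [Rr ^ 2]. *)
Lemma Dr_end_neg s c : N1 s = 1 -> (forall r, 0 <= r <= Rr -> Psi (ray r s) <= c) ->
  c <= 1 + INR (p + 1) * 4 ^ (q - 1) -> Dr s Rr < 0.
Proof.
  intros Hs Hc HcQ. apply Rnot_le_lt. intros HD.
  assert (HJ : Rr ^ (p - 1) * Jf s <= 1 + kp) by (apply Dr_nonneg_bound; [assumption|lra|assumption]).
  specialize (Hc Rr ltac:(lra)). destruct (Psi_ray_bounds s Rr Hs ltac:(lra)) as [E _].
  pose proof INR_p1_ge4 as H4. rewrite pow_p1 in E.
  assert (Hq1 : Rr ^ (p - 1) * Jf s / INR (p + 1) <= (1 + kp) / 4).
  { pose proof (Jf_nonneg s). assert (0 <= Rr ^ (p - 1) * Jf s) by (apply Rmult_le_pos; [apply pow_le; lra|assumption]).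
    unfold Rdiv. apply Rmult_le_compat; try lra.
    - left. apply Rinv_0_lt_compat. lra.
    - apply Rinv_le_contravar; lra. }
  replace (Rr ^ 2 * Rr ^ (p - 1) * Jf s / INR (p + 1)) with (Rr ^ 2 * (Rr ^ (p - 1) * Jf s / INR (p + 1))) in E
    by (unfold Rdiv; ring).
  pose proof (pow2_ge_0 Rr). nra.
Qed.

(** At [r = 1 / (1 + Jf s)] one has [r^(p-1) Jf s <= 1], so the potential costs at most [r^2 / 4]
    against [r^2 (1 - kp) / 2]. This excludes a maximum at the origin. *)
Lemma exists_positive_energy s : N1 s = 1 -> exists r, 0 <= r <= Rr /\ 0 < Psi (ray r s).
Proof.
  intros Hs. pose proof (Jf_nonneg s) as HJ. set (r := / (1 + Jf s)).
  assert (Hr : 0 < r <= 1).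
  { split; [apply Rinv_0_lt_compat; lra|]. rewrite <- Rinv_1. apply Rinv_le_contravar; lra. }
  exists r. split; [lra|]. destruct (Psi_ray_bounds s r Hs ltac:(lra)) as [E _].
  eapply Rlt_le_trans; [|apply E]. rewrite pow_p1.
  assert (HrJ : r * Jf s <= 1).
  { unfold r. apply Rmult_le_reg_l with (1 + Jf s); [lra|]. rewrite <- Rmult_assoc, Rinv_r by lra. lra. }
  assert (Hpw : r ^ (p - 1) <= r).
  { destruct p_minus as [m [-> Hm]]. replace (S m - 1)%nat with (S (m - 1)) by lia. simpl.
    rewrite <- (Rmult_1_r r) at 3. apply Rmult_le_compat_l; [lra|].
    rewrite <- (pow1 (m - 1)). apply pow_incr. lra. }
  assert (H1 : r ^ (p - 1) * Jf s <= 1) by (apply Rle_trans with (r * Jf s); [now apply Rmult_le_compat_r|assumption]).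
  pose proof INR_p1_ge4 as H4.
  assert (Hq1 : r ^ (p - 1) * Jf s / INR (p + 1) <= 1 / 4).
  { assert (0 <= r ^ (p - 1) * Jf s) by (apply Rmult_le_pos; [apply pow_le; lra|assumption]).
    unfold Rdiv. apply Rmult_le_compat; try lra.
    - left. apply Rinv_0_lt_compat. lra.
    - apply Rinv_le_contravar; lra. }
  replace (r ^ 2 * r ^ (p - 1) * Jf s / INR (p + 1)) with (r ^ 2 * (r ^ (p - 1) * Jf s / INR (p + 1)))
    by (unfold Rdiv; ring).
  assert (0 < r ^ 2) by (apply pow_lt; lra). nra.
Qed.

(** By minimality of [c] the bound is attained on the ray. The maximum is not at 0 (positive energy
    occurs) nor at [Rr] (negative slope there), hence the slope vanishes. *)
Lemma critical_radius s c : N1 s = 1 -> (forall r, 0 <= r <= Rr -> Psi (ray r s) <= c) ->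
  c <= 1 + INR (p + 1) * 4 ^ (q - 1) -> (forall c', level c' -> c <= c') ->
  exists r0, 0 < r0 < Rr /\ Psi (ray r0 s) = c /\ Dr s r0 = 0.
Proof.
  intros Hs Hc HcQ Hmin. destruct (ray_max s Hs) as [r0 [Hr0 Hmax]].
  assert (E : Psi (ray r0 s) = c).
  { apply Rle_antisym; [now apply Hc|]. apply Hmin. exists s. split; assumption. }
  destruct (Psi_ray_quadratic s Hs) as [K [HK Hquad]].
  assert (Hleft : 0 < r0 -> 0 <= Dr s r0).
  { intros Hp. apply Rnot_lt_le. intros HD.
    (* A step back of this length would gain [|Dr| d], more than the quadratic error [K d^2],
       against the maximality of [r0]. *)
    set (d := Rmin r0 (- Dr s r0 / (2 * (K + 1)))).
    assert (Hd : 0 < d).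
    { apply Rmin_pos; [assumption|]. apply Rdiv_lt_0_compat; lra. }
    assert (Hd1 : d <= r0) by apply Rmin_l.
    assert (Hd2 : d * (2 * (K + 1)) <= - Dr s r0).
    { apply Rle_trans with (- Dr s r0 / (2 * (K + 1)) * (2 * (K + 1))).
      - apply Rmult_le_compat_r; [lra|apply Rmin_r].
      - right. field. lra. }
    specialize (Hquad r0 (r0 - d)). rewrite !Rabs_right in Hquad by lra.
    assert (Hquad' := Hquad ltac:(lra) ltac:(lra)). clear Hquad.
    specialize (Hmax (r0 - d) ltac:(lra)).
    replace (r0 - d - r0) with (- d) in Hquad' by ring.
    assert (Hq2 : Dr s r0 * - d - K * d ^ 2 <= 0).
    { pose proof (Rle_abs (- (Psi (ray (r0 - d) s) - Psi (ray r0 s) - Dr s r0 * - d))) as Ha.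
      rewrite Rabs_Ropp in Ha. replace ((- d) ^ 2) with (d ^ 2) in Hquad' by ring. lra. }
    nra. }
  assert (Hright : r0 < Rr -> Dr s r0 <= 0).
  { intros Hp. apply Rnot_lt_le. intros HD.
    set (d := Rmin (Rr - r0) (Dr s r0 / (2 * (K + 1)))).
    assert (Hd : 0 < d).
    { apply Rmin_pos; [lra|]. apply Rdiv_lt_0_compat; lra. }
    assert (Hd1 : d <= Rr - r0) by apply Rmin_l.
    assert (Hd2 : d * (2 * (K + 1)) <= Dr s r0).
    { apply Rle_trans with (Dr s r0 / (2 * (K + 1)) * (2 * (K + 1))).
      - apply Rmult_le_compat_r; [lra|apply Rmin_r].
      - right. field. lra. }
    specialize (Hquad r0 (r0 + d)). rewrite !(Rabs_right (r0 + _)), !(Rabs_right r0) in Hquad by lra.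
    assert (Hquad' := Hquad ltac:(lra) ltac:(lra)). clear Hquad.
    specialize (Hmax (r0 + d) ltac:(lra)).
    replace (r0 + d - r0) with d in Hquad' by ring.
    assert (Hq2 : Dr s r0 * d - K * d ^ 2 <= 0).
    { pose proof (Rle_abs (- (Psi (ray (r0 + d) s) - Psi (ray r0 s) - Dr s r0 * d))) as Ha.
      rewrite Rabs_Ropp in Ha. lra. }
    nra. }
  assert (H0 : 0 < r0).
  { destruct (Req_dec r0 0) as [->|]; [|lra]. exfalso.
    destruct (exists_positive_energy s Hs) as [r [Hr Hpos]]. specialize (Hmax r Hr).
    rewrite Psi_ray_0 in Hmax. lra. }
  assert (H1 : r0 < Rr).
  { destruct (Req_dec r0 Rr) as [->|]; [|lra]. exfalso.
    pose proof (Dr_end_neg s c Hs Hc HcQ). specialize (Hleft H0). lra. }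
  exists r0. split; [lra|]. split; [assumption|]. apply Rle_antisym; auto.
Qed.

Lemma res_CS (a b : mode -> R) :
  (lsum (box N) (fun k => if res k then a k * b k else 0)) ^ 2 <=
  lsum (box N) (fun k => if res k then a k ^ 2 else 0) * lsum (box N) (fun k => if res k then b k ^ 2 else 0).
Proof.
  rewrite (lsum_ext_in _ _ (fun k => rp a k * rp b k))
    by (intros k _; unfold rp; destruct (res k); ring).
  eapply Rle_trans; [apply lsum_CS|]. right. f_equal; apply lsum_ext_in; intros k _; unfold rp;
    destruct (res k); ring.
Qed.

(* If the gradient did not vanish at [r0 s], moving [s] against it would lower the maximum of
   the energy over the whole ray: near [r0] to first order, elsewhere because the maximum over
   the ray is strict. *)
Lemma critical_point s c r0 : N1 s = 1 -> (forall r, 0 <= r <= Rr -> Psi (ray r s) <= c) ->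
  (forall c', level c' -> c <= c') -> 0 < r0 < Rr -> Psi (ray r0 s) = c -> Dr s r0 = 0 ->
  forall k, In k (box N) -> res k = true -> yv (ray r0 s) k = 0.
Proof.
  intros Hs Hc Hmin Hr0 Hpc HD.
  (* [h] is the gradient for the scalar product of [N1], which carries the weight [l^2]. *)
  set (y0 := yv (ray r0 s)). set (h := fun k => y0 k / INR (fst k) ^ 2).
  set (d := lsum (box N) (fun k => if res k then y0 k * h k else 0)).
  assert (Hterm : forall k, In k (box N) -> 0 <= (if res k then y0 k * h k else 0)).
  { intros k Hk. destruct (res k) eqn:E; [|lra]. pose proof (res_l_ge1 k Hk E). unfold h, Rdiv.
    rewrite <- Rmult_assoc. apply Rmult_le_pos; [nra|].
    left. apply Rinv_0_lt_compat. apply pow_lt. lra. }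
  assert (Hd0 : 0 <= d) by (apply lsum_nonneg; assumption).
  destruct (Req_dec d 0) as [Hd|Hd].
  { intros k Hk E. pose proof (lsum_term_le _ _ k Hterm Hk) as Ht. fold d in Ht. rewrite Hd, E in Ht.
    specialize (Hterm k Hk). rewrite E in Hterm. pose proof (res_l_ge1 k Hk E) as Hl.
    assert (Hz : y0 k * h k = 0) by lra. unfold h, Rdiv in Hz.
    assert (Hi : 0 < / INR (fst k) ^ 2) by (apply Rinv_0_lt_compat, pow_lt; lra).
    rewrite <- Rmult_assoc in Hz. apply Rmult_integral in Hz. destruct Hz as [Hz|Hz]; [|lra].
    nra. }
  exfalso. assert (Hdp : 0 < d) by lra. clear Hd Hd0.
  (* A vanishing radial slope means that [h] is orthogonal to [s]: the displaced direction leaves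
     the sphere only to second order in [t]. *)
  assert (Hsh : lsum (box N) (fun k => if res k then INR (fst k) ^ 2 * s k * h k else 0) = 0).
  { transitivity (Dr s r0); [|exact HD]. rewrite <- (yv_ray_self s r0 Hs). apply lsum_ext_in. intros k Hk.
    destruct (res k) eqn:E; [|reflexivity]. pose proof (res_l_ge1 k Hk E). unfold h. fold y0. field. lra. }
  set (st := fun (t : R) k => s k - t * h k). set (M := N1 h).
  assert (HM : 0 <= M).
  { apply lsum_nonneg. intros k _. destruct (res k); [apply pow2_ge_0|lra]. }
  assert (HNst : forall t, N1 (st t) = 1 + t ^ 2 * M).
  { intros t. rewrite <- Hs. unfold M.
    transitivity (N1 s - 2 * t * lsum (box N) (fun k => if res k then INR (fst k) ^ 2 * s k * h k else 0)
       + t ^ 2 * N1 h); [|rewrite Hsh; ring].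
    unfold N1. rewrite <- !lsum_scal, <- lsum_minus, <- lsum_plus. apply lsum_ext_in. intros k _.
    unfold st. destruct (res k); ring. }
  destruct Psi_expand as [K [HK HPsi]]. destruct yv_lip as [K2 [HK2 Hyv]].
  set (H2 := lsum (box N) (fun k => if res k then h k ^ 2 else 0)).
  assert (HH2 : 0 <= H2) by (apply lsum_nonneg; intros k _; destruct (res k); [apply pow2_ge_0|lra]).
  set (P := fun r => lsum (box N) (fun k => if res k then yv (ray r s) k * h k else 0)).
  set (K3 := sqrt (K2 * H2)).
  assert (HPl : forall r, 0 <= r <= Rr -> Rabs (P r - d) <= K3 * Rabs (r - r0)).
  { intros r Hr. apply sq_le_Rabs_le; [apply Rmult_le_pos; [apply sqrt_pos|apply Rabs_pos]|].
    rewrite Rpow_mult_distr, pow2_abs. unfold K3. rewrite pow2_sqrt by (now apply Rmult_le_pos).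
    unfold P, d. rewrite <- lsum_minus.
    rewrite (lsum_ext_in _ _ (fun k => if res k then (yv (ray r s) k - y0 k) * h k else 0))
      by (intros k _; destruct (res k); ring).
    eapply Rle_trans; [apply (res_CS (fun k => yv (ray r s) k - y0 k) h)|].
    assert (HN1 : N1 (ray r0 s) <= Rm ^ 2) by (apply N1_ray_le; [assumption|rewrite Rabs_right; lra]).
    assert (HN2 : N1 (ray r s) <= Rm ^ 2) by (apply N1_ray_le; [assumption|rewrite Rabs_right; lra]).
    specialize (Hyv _ _ HN1 HN2). pose proof (dres_ray s r r0 Hs) as Hdr. fold y0 in Hyv.
    fold H2. replace (K2 * H2 * (r - r0) ^ 2) with (K2 * (r - r0) ^ 2 * H2) by ring.
    apply Rmult_le_compat_r; [assumption|]. eapply Rle_trans; [apply Hyv|]. now apply Rmult_le_compat_l. }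
  assert (HK3 : 0 <= K3) by apply sqrt_pos.
  set (K4 := K * (Rr ^ 2 * H2)).
  assert (HK4 : 0 <= K4) by (apply Rmult_le_pos; [assumption|apply Rmult_le_pos; [apply pow2_ge_0|assumption]]).
  assert (Hexp : forall t r, 0 <= t -> 0 <= r <= Rr -> N1 (ray r (st t)) <= Rm ^ 2 ->
     Psi (ray r (st t)) <= Psi (ray r s) - t * (r * P r) + K4 * t ^ 2).
  { intros t r Ht Hr HN.
    assert (HN2 : N1 (ray r s) <= Rm ^ 2) by (apply N1_ray_le; [assumption|rewrite Rabs_right; lra]).
    specialize (HPsi _ _ HN2 HN). apply Rabs_le_between in HPsi.
    rewrite (lsum_ext_in _ (fun k => if res k then yv (ray r s) k * (ray r (st t) k - ray r s k) else 0)
      (fun k => (- (t * r)) * (if res k then yv (ray r s) k * h k else 0))) in HPsi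
      by (intros k _; unfold st, ray; destruct (res k); ring).
    rewrite lsum_scal in HPsi. fold (P r) in HPsi.
    assert (Hdr : dres (ray r (st t)) (ray r s) <= Rr ^ 2 * H2 * t ^ 2).
    { rewrite dres_ray_gen.
      replace (dres (st t) s) with (t ^ 2 * H2).
      - replace (Rr ^ 2 * H2 * t ^ 2) with (Rr ^ 2 * (t ^ 2 * H2)) by ring.
        apply Rmult_le_compat_r; [apply Rmult_le_pos; [apply pow2_ge_0|assumption]|].
        apply pow_incr. lra.
      - unfold dres, H2. rewrite <- lsum_scal. apply lsum_ext_in. intros k _. unfold st.
        destruct (res k); ring. }
    assert (K * dres (ray r (st t)) (ray r s) <= K4 * t ^ 2).
    { unfold K4. rewrite Rmult_assoc. now apply Rmult_le_compat_l. }
    lra. }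
  (* Within [eta] of [r0] the directional derivative [P] stays above [d / 2] and the radius above
     [r0 / 2], so the gain per unit of [t] is at least [d1 = r0 d / 4]. *)
  set (eta := Rmin (r0 / 2) (Rmin (Rr - r0) (d / (2 * (K3 + 1))))).
  assert (Heta : 0 < eta).
  { apply Rmin_pos; [lra|]. apply Rmin_pos; [lra|]. apply Rdiv_lt_0_compat; lra. }
  assert (Heta1 : eta <= r0 / 2) by apply Rmin_l.
  assert (Heta2 : eta <= Rr - r0) by (eapply Rle_trans; [apply Rmin_r|apply Rmin_l]).
  assert (Heta3 : eta * (2 * (K3 + 1)) <= d).
  { apply Rle_trans with (d / (2 * (K3 + 1)) * (2 * (K3 + 1))).
    - apply Rmult_le_compat_r; [lra|]. eapply Rle_trans; [apply Rmin_r|apply Rmin_r].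
    - right. field. lra. }
  destruct (monotone_away (fun r => Psi (ray r s)) (Dr s) Rr r0 eta) as [m [Hm1 Hm2]]; try lra.
  { intros r Hr. apply Psi_ray_derive; [assumption|]. rewrite Rabs_right; lra. }
  { intros r Hr. apply Rnot_le_lt. intros Hle.
    pose proof (Dr_sign s r r0 Hs (proj1 Hr) (proj2 Hr) ltac:(lra) Hle). lra. }
  { intros r Hr. apply (Dr_sign s r0 r); lra. }
  rewrite Hpc in Hm1.
  set (d1 := r0 * d / 4). assert (Hd1 : 0 < d1) by (unfold d1; nra).
  set (C1 := Rr * (d + K3 * Rr)).
  assert (HC1 : 0 <= C1) by (unfold C1; apply Rmult_le_pos; [lra|]; nra).
  (* Near [r0] the error [K4 t^2] eats at most half of the gain [t d1]; far from it the total change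
     stays below half of the gap [c - m]. *)
  set (t := Rmin 1 (Rmin (d1 / (2 * (K4 + 1))) ((c - m) / (2 * (C1 + K4 + 1))))).
  assert (Ht : 0 < t).
  { apply Rmin_pos; [lra|]. apply Rmin_pos; apply Rdiv_lt_0_compat; lra. }
  assert (Ht1 : t <= 1) by apply Rmin_l.
  assert (Ht2 : t * (2 * (K4 + 1)) <= d1).
  { apply Rle_trans with (d1 / (2 * (K4 + 1)) * (2 * (K4 + 1))).
    - apply Rmult_le_compat_r; [lra|]. eapply Rle_trans; [apply Rmin_r|apply Rmin_l].
    - right. field. lra. }
  assert (Ht3 : t * (2 * (C1 + K4 + 1)) <= c - m).
  { apply Rle_trans with ((c - m) / (2 * (C1 + K4 + 1)) * (2 * (C1 + K4 + 1))).
    - apply Rmult_le_compat_r; [lra|]. eapply Rle_trans; [apply Rmin_r|apply Rmin_r].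
    - right. field. lra. }
  set (c1 := Rmax (c - t * d1 / 2) (c - (c - m) / 2)).
  assert (Hc1 : c1 < c) by (apply Rmax_lub_lt; nra).
  apply (Rlt_not_le _ _ Hc1). apply Hmin.
  (* Renormalising divides radii by [nu >= 1], so the ray of the new unit direction up to [Rr] only
     meets radii of the unnormalised one that are already estimated. *)
  set (nu := sqrt (1 + t ^ 2 * M)).
  assert (Hnu2 : nu ^ 2 = 1 + t ^ 2 * M).
  { unfold nu. apply pow2_sqrt. pose proof (pow2_ge_0 t). nra. }
  assert (Hnu : 1 <= nu).
  { unfold nu. rewrite <- sqrt_1 at 1. apply sqrt_le_1_alt. pose proof (pow2_ge_0 t). nra. }
  exists (ray (/ nu) (st t)). split.
  { rewrite N1_ray, HNst, <- Hnu2. field. lra. }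
  intros r' Hr'.
  replace (ray r' (ray (/ nu) (st t))) with (ray (r' / nu) (st t))
    by (apply functional_extensionality; intros k; unfold ray; field; lra).
  set (r := r' / nu).
  assert (Hr : 0 <= r <= Rr).
  { assert (0 < / nu <= 1).
    { split; [apply Rinv_0_lt_compat; lra|]. rewrite <- Rinv_1. apply Rinv_le_contravar; lra. }
    unfold r, Rdiv. split; [apply Rmult_le_pos; lra|]. nra. }
  assert (HN : N1 (ray r (st t)) <= Rm ^ 2).
  { rewrite N1_ray, HNst, <- Hnu2. unfold r. replace ((r' / nu) ^ 2 * nu ^ 2) with (r' ^ 2) by (field; lra).
    apply pow_incr. lra. }
  specialize (Hexp t r (Rlt_le _ _ Ht) Hr HN). eapply Rle_trans; [apply Hexp|].
  specialize (HPl r Hr). specialize (Hc r Hr).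
  assert (Htt : t ^ 2 <= t) by nra.
  destruct (Rle_dec eta (Rabs (r - r0))) as [Hfar|Hnear].
  - specialize (Hm2 r Hr Hfar). cbv beta in Hm2. eapply Rle_trans; [|apply Rmax_r].
    assert (HPr : - (r * P r) <= C1).
    { assert (Rabs (r - r0) <= Rr) by (apply Rabs_le; lra).
      apply Rabs_le_between in HPl. assert (K3 * Rabs (r - r0) <= K3 * Rr) by now apply Rmult_le_compat_l.
      assert (- P r <= d + K3 * Rr) by lra. unfold C1.
      replace (- (r * P r)) with (r * - P r) by ring.
      apply Rle_trans with (r * (d + K3 * Rr)); [now apply Rmult_le_compat_l|].
      apply Rmult_le_compat_r; [|lra]. assert (0 <= K3 * Rr) by (apply Rmult_le_pos; lra). lra. }
    nra.
  - apply Rnot_le_lt in Hnear. eapply Rle_trans; [|apply Rmax_l].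
    assert (HPr : d1 <= r * P r).
    { apply Rabs_le_between in HPl. assert (K3 * Rabs (r - r0) <= K3 * eta) by (apply Rmult_le_compat_l; lra).
      assert (d / 2 <= P r) by nra.
      assert (r0 / 2 <= r) by (apply Rabs_def2 in Hnear; lra).
      unfold d1. nra. }
    nra.
Qed.

(** Besides the equations on all modes, records the energy facts for the minimal period. At the
    critical radius [r^(p-1) Jf s] lies between [1 - kp] and [1 + kp], so the level is at least
    [r^2 (1 - kp) / 2 - r^2 (1 + kp) / 4], the source of [1/4 - 3/4 kp]. The last clause says that
    every other ray reaches this level somewhere. *)
Lemma galerkin_solution : exists xi c, FP xi c /\ N1 xi <= Rm ^ 2 /\
  (forall k, In k (box N) -> lam k * c k = - mu * bc c k) /\
  / 400 <= N1 xi /\ (1 - kp) * N1 xi <= Jf xi /\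
  forall y, 0 < N1 y -> exists s, 0 <= s /\
    (1 / 4 - 3 / 4 * kp) * N1 xi <= s ^ 2 * N1 y * (1 + kp) / 2 - s ^ (p + 1) * Jf y / INR (p + 1).
Proof.
  destruct minimal_level as [c [s [Hs [Hc Hmin]]]].
  assert (HcQ : c <= 1 + INR (p + 1) * 4 ^ (q - 1)) by apply Hmin, level_Q.
  destruct (critical_radius s c Hs Hc HcQ Hmin) as [r [Hr [Hpc HD]]].
  pose proof (critical_point s c r Hs Hc Hmin Hr Hpc HD) as Hcrit.
  assert (HN : N1 (ray r s) <= Rm ^ 2) by (apply N1_ray_le; [assumption|rewrite Rabs_right; lra]).
  pose proof (cs_FP _ HN) as HF.
  assert (HJ1 : 1 - kp <= r ^ (p - 1) * Jf s) by (apply Dr_nonpos_bound; [assumption|lra|lra]).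
  assert (HJ2 : r ^ (p - 1) * Jf s <= 1 + kp) by (apply Dr_nonneg_bound; [assumption|lra|lra]).
  assert (HJr : forall z, Jf (ray z s) = z ^ (p + 1) * Jf s).
  { intros z. unfold Jf. rewrite <- Int2_scal by auto with jc. apply Int2_ext. intros.
    rewrite vp_ray, Rpow_mult_distr. reflexivity. }
  assert (HNr : N1 (ray r s) = r ^ 2) by (rewrite N1_ray, Hs; ring).
  assert (Hr2 : 0 <= r ^ 2) by apply pow2_ge_0.
  exists (ray r s), (cs (ray r s)). split; [assumption|]. split; [assumption|]. split; [|split; [|split]].
  - intros k Hk. destruct (res k) eqn:E; [|now apply HF].
    pose proof (Hcrit k Hk E) as Hy. unfold yv in Hy. destruct HF as [[Hres _] _].
    rewrite (lam_res k E), (Hres k Hk E). replace (bc (cs (ray r s)) k) with (INR (fst k) ^ 2 * ray r s k) by lra.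
    ring.
  - rewrite HNr. assert (Hv : forall t x, Rabs (up N 0 (rp s) t x) <= 17).
    { intros t x. rewrite <- (Rmult_1_r 17). apply vp_sup; rewrite ?Hs; lra. }
    assert (HJ3 : Jf s <= 17 ^ (p - 1)).
    { unfold Jf. apply Rle_trans with (Int2 (fun t x => 17 ^ (p - 1) * up N 0 (rp s) t x ^ 2)).
      - apply Int2_le; auto with jc. intros t x _ _. rewrite pow_p1, Rmult_comm.
        apply Rmult_le_compat_r; [apply pow2_ge_0|].
        eapply Rle_trans; [apply Rle_abs|]. rewrite <- RPow_abs. apply pow_incr. split; [apply Rabs_pos|apply Hv].
      - rewrite Int2_scal by auto with jc. rewrite <- (Rmult_1_r (17 ^ (p - 1))) at 2.
        apply Rmult_le_compat_l; [apply pow_le; lra|]. rewrite <- Hs. apply vp_L2. }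
    assert (HJ4 : 1 - kp <= (r * 17) ^ (p - 1)).
    { rewrite Rpow_mult_distr. eapply Rle_trans; [apply HJ1|]. apply Rmult_le_compat_l; [apply pow_le; lra|assumption]. }
    (* For [r < 1/20] one would have [(17 r)^(p-1) <= 17/20], below [1 - kp >= 9/10]. Hence
       [N1 = r^2 >= 1/400]. *)
    destruct (Rle_dec (/ 20) r) as [|Hsmall]; [nra|]. exfalso.
    assert ((r * 17) ^ (p - 1) <= r * 17).
    { replace (p - 1)%nat with (S (p - 2)) by lia. simpl.
      rewrite <- (Rmult_1_r (r * 17)) at 3. apply Rmult_le_compat_l; [lra|].
      rewrite <- (pow1 (p - 2)). apply pow_incr. lra. }
    lra.
  - rewrite HNr, HJr, pow_p1, Rmult_assoc, (Rmult_comm _ (r ^ 2)). now apply Rmult_le_compat_l.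
  - intros y Hy. set (ny := sqrt (N1 y)). assert (Hny : 0 < ny) by now apply sqrt_lt_R0.
    assert (Hny2 : ny ^ 2 = N1 y) by (apply pow2_sqrt; lra).
    assert (Hsy : N1 (ray (/ ny) y) = 1) by (rewrite N1_ray, <- Hny2; field; lra).
    destruct (ray_max _ Hsy) as [z [Hz Hmax]].
    exists (z / ny). split; [apply Rmult_le_pos; [lra|left; now apply Rinv_0_lt_compat]|].
    apply Rle_trans with c.
    + rewrite HNr. destruct (Psi_ray_bounds s r Hs ltac:(lra)) as [E _]. rewrite Hpc in E.
      eapply Rle_trans; [|apply E]. rewrite pow_p1. pose proof INR_p1_ge4 as H4.
      replace (r ^ 2 * r ^ (p - 1) * Jf s / INR (p + 1)) with (r ^ 2 * (r ^ (p - 1) * Jf s / INR (p + 1)))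
        by (unfold Rdiv; ring).
      assert (Hq1 : r ^ (p - 1) * Jf s / INR (p + 1) <= (1 + kp) / 4).
      { unfold Rdiv. apply Rmult_le_compat; try lra.
        - left. apply Rinv_0_lt_compat. lra.
        - apply Rinv_le_contravar; lra. }
      nra.
    + apply Rle_trans with (Psi (ray z (ray (/ ny) y))).
      * apply Hmin. exists (ray (/ ny) y). split; assumption.
      * destruct (Psi_ray_bounds _ z Hsy Hz) as [_ E]. eapply Rle_trans; [apply E|]. right.
        assert (HJy : Jf (ray (/ ny) y) = (/ ny) ^ (p + 1) * Jf y).
        { unfold Jf. rewrite <- Int2_scal by auto with jc. apply Int2_ext. intros.
          rewrite vp_ray, Rpow_mult_distr. reflexivity. }
        rewrite HJy. unfold Rdiv. rewrite !Rpow_mult_distr, <- Hny2, !pow_inv. field.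
        split; [|split]; try lra; [apply not_0_INR; lia|apply pow_nonzero; lra].
Qed.
End Reduction.

(** * Regularity uniform in the dimension *)

Section Regularity.
Variables (n N : nat) (om mu kap Rm G : R) (g0 g1 g2 g3 : R -> R) (xi c : mode -> R).
Hypothesis Hn : (1 <= n)%nat.
Hypothesis Hom : / 2 <= om.
Hypothesis Hmu : mu = (om ^ 2 - 1) * INR n ^ 2.
Hypothesis Hmu0 : mu <> 0.
Hypothesis Hnr : forall k, In k (box N) -> res n k = false ->
  lam n om k <> 0 /\ Rabs mu <= kap * Rabs (lam n om k).
Hypothesis HRm : 0 <= Rm.
Hypothesis HG0 : 0 <= G.
Hypothesis Hg : forall y, is_derive g0 y (g1 y).
Hypothesis Hg1 : forall y, is_derive g1 y (g2 y).
Hypothesis Hg2 : forall y, is_derive g2 y (g3 y).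
Hypothesis Hg3 : cont g3.
Hypothesis Hg00 : g0 0 = 0.
Hypothesis HgB : forall y, Rabs y <= supb Rm ->
  Rabs (g0 y) <= G /\ Rabs (g1 y) <= G /\ Rabs (g2 y) <= G /\ Rabs (g3 y) <= G.
Hypothesis Hkap : 0 <= kap.
Hypothesis Hk2 : kap ^ 2 * (2 * G ^ 2 * (1152 * (Rm ^ 2 + 1) + 1)) <= 1 / 2.
Hypothesis HN1 : N1 n N xi <= Rm ^ 2.
Hypothesis Hadm : adm n N om xi c.
Hypothesis Heq : forall k, In k (box N) -> lam n om k * c k = - mu * bc N g0 c k.

Notation b := (bc N g0 c).
Notation U i := (up N i c).
(** [X i] and [Bq i] dominate the L2 norms of the [i]-th time derivatives of [u] and of the
    projected [g0 u]; [Sl i] dominates the sup norm of the former. *)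
Definition X (i : nat) : R := lsum (box N) (fun k => (c k * INR (fst k) ^ i) ^ 2).
Definition Bq (i : nat) : R := lsum (box N) (fun k => (INR (fst k) ^ i * b k) ^ 2).
Definition Sl (i : nat) : R := lsum (box N) (fun k => INR (fst k) ^ i * Rabs (c k)).

Let Hs : lsum (box N) (fun k => Rabs (c k)) <= supb Rm.
Proof. apply (adm_bounds n N om Rm Hn Hom HRm xi c HN1 Hadm). Qed.
Let Hx1 : X 1 <= Rm ^ 2 + 1.
Proof. apply (adm_bounds n N om Rm Hn Hom HRm xi c HN1 Hadm). Qed.
Let HgB0 : forall y, Rabs y <= supb Rm -> Rabs (g0 y) <= G /\ Rabs (g1 y) <= G.
Proof. intros y Hy. destruct (HgB y Hy) as (? & ? & _). split; assumption. Qed.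
Let Hcg0 : cont g0. Proof. apply (cont_derive g0 g1 Hg). Qed.
Let Hcg1 : cont g1. Proof. apply (cont_derive g1 g2 Hg1). Qed.
Let Hcg2 : cont g2. Proof. apply (cont_derive g2 g3 Hg2). Qed.
Let Hjg (h : R -> R) : cont h -> jcont (fun t x => h (U 0 t x)).
Proof. intros H. apply (jcont_comp (U 0) h); [auto with jc|assumption]. Qed.
Hint Resolve Hjg Hcg0 Hcg1 Hcg2 Hg3 : jc.

Lemma Bq0_le : Bq 0 <= 4 * G ^ 2.
Proof.
  eapply Rle_trans; [|apply (bc_sq_sum N Rm G g0 g1 Hg HgB0 c Hs)].
  right. apply lsum_ext_in. intros. simpl. ring.
Qed.
Lemma Bq1_le : Bq 1 <= G ^ 2 * (Rm ^ 2 + 1).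
Proof.
  apply Rle_trans with (G ^ 2 * X 1); [|apply Rmult_le_compat_l; [apply pow2_ge_0|assumption]].
  eapply Rle_trans; [|apply (bc_l_sum n N Rm G g0 g1 Hn Hg Hcg1 HgB0 c Hs)].
  right. apply lsum_ext_in. intros. rewrite pow_1. reflexivity.
Qed.
Lemma X_nonneg i : 0 <= X i. Proof. apply lsum_nonneg; intros; apply pow2_ge_0. Qed.
Lemma Bq_nonneg i : 0 <= Bq i. Proof. apply lsum_nonneg; intros; apply pow2_ge_0. Qed.
Lemma lam_weighted i : lsum (box N) (fun k => (INR (fst k) ^ 2 + lam n om k ^ 2) * (INR (fst k) ^ i * c k) ^ 2)
  = X (S i) + mu ^ 2 * Bq i.
Proof.
  unfold X, Bq. rewrite <- lsum_scal, <- lsum_plus. apply lsum_ext_in. intros k Hk.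
  replace ((INR (fst k) ^ 2 + lam n om k ^ 2) * (INR (fst k) ^ i * c k) ^ 2) with
    ((c k * INR (fst k) ^ S i) ^ 2 + (INR (fst k) ^ i) ^ 2 * (lam n om k * c k) ^ 2) by (simpl; ring).
  rewrite (Heq k Hk). ring.
Qed.
Lemma Sl_sq i : Sl i ^ 2 <= 1152 * (X (S i) + mu ^ 2 * Bq i).
Proof.
  rewrite <- lam_weighted. eapply Rle_trans; [|apply (l1_lam n N om Hn Hom (fun k => INR (fst k) ^ i * c k))].
  right. f_equal. apply lsum_ext_in. intros k _.
  rewrite Rabs_mult, (Rabs_right (INR (fst k) ^ i)) by (apply Rle_ge, pow_le, pos_INR). reflexivity.
Qed.
(** On resonant modes the equation reads [l^2 c = b] and gains two time derivatives. On the others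
    it gains none but carries the small factor [mu / lam], so the top-order term can be absorbed. *)
Lemma X_le i : X (S (S i)) <= Bq i + kap ^ 2 * Bq (S (S i)).
Proof.
  unfold X, Bq. rewrite <- lsum_scal, <- lsum_plus. apply lsum_le. intros k Hk.
  pose proof (pow2_ge_0 (INR (fst k) ^ i * b k)). pose proof (pow2_ge_0 (INR (fst k) ^ S (S i) * b k)).
  pose proof (pow2_ge_0 kap). specialize (Heq k Hk). destruct (res n k) eqn:E.
  - rewrite (lam_res n om mu Hmu k E) in Heq.
    assert (Hb : b k = INR (fst k) ^ 2 * c k).
    { apply Rmult_eq_reg_l with (- mu); [|lra]. rewrite <- Heq. ring. }
    replace (c k * INR (fst k) ^ S (S i)) with (INR (fst k) ^ i * b k) by (rewrite Hb; simpl; ring). nra.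
  - pose proof (ratio_le n N om mu kap Hnr k Hk E) as Hr. destruct (Hnr k Hk E) as [Hl _].
    assert (Hc : c k = - (mu / lam n om k) * b k).
    { apply Rmult_eq_reg_l with (lam n om k); [|assumption]. rewrite Heq. field. assumption. }
    replace ((c k * INR (fst k) ^ S (S i)) ^ 2) with ((mu / lam n om k) ^ 2 * (INR (fst k) ^ S (S i) * b k) ^ 2)
      by (rewrite Hc; ring). nra.
Qed.

Definition F1 t x : R := g1 (U 0 t x) * U 1 t x.
Definition F2 t x : R := g2 (U 0 t x) * U 1 t x ^ 2 + g1 (U 0 t x) * U 2 t x.
Definition F3 t x : R :=
  g3 (U 0 t x) * U 1 t x ^ 3 + 3 * (g2 (U 0 t x) * (U 1 t x * U 2 t x)) + g1 (U 0 t x) * U 3 t x.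
Lemma jcont_F1 : jcont F1. Proof. unfold F1. auto with jc. Qed.
Lemma jcont_F2 : jcont F2. Proof. unfold F2. auto 10 with jc. Qed.
Lemma jcont_F3 : jcont F3. Proof. unfold F3. auto 12 with jc. Qed.
Hint Resolve jcont_F1 jcont_F2 jcont_F3 : jc.

Lemma derive_comp_t h h' t x : (forall y, is_derive h y (h' y)) ->
  is_derive (fun s => h (U 0 s x)) t (h' (U 0 t x) * U 1 t x).
Proof.
  intros H. rewrite Rmult_comm. apply (is_derive_comp h (fun s => U 0 s x)); [apply H|].
  apply is_derive_up_t. lia.
Qed.
Lemma derive_mult (f k : R -> R) t f' k' : is_derive f t f' -> is_derive k t k' ->
  is_derive (fun s => f s * k s) t (f' * k t + f t * k').
Proof. intros Hf Hk. apply (is_derive_mult f k); auto. intros; apply Rmult_comm. Qed.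

Lemma derive_F1 t x : is_derive (fun s => F1 s x) t (F2 t x).
Proof.
  unfold F1, F2.
  replace (g2 (U 0 t x) * U 1 t x ^ 2 + g1 (U 0 t x) * U 2 t x)
    with ((g2 (U 0 t x) * U 1 t x) * U 1 t x + g1 (U 0 t x) * U 2 t x) by ring.
  apply (derive_mult (fun s => g1 (U 0 s x)) (fun s => U 1 s x)).
  - now apply derive_comp_t.
  - apply is_derive_up_t. lia.
Qed.
Lemma derive_F2 t x : is_derive (fun s => F2 s x) t (F3 t x).
Proof.
  unfold F2, F3.
  assert (E1 : is_derive (fun s => g2 (U 0 s x) * U 1 s x ^ 2) t
    ((g3 (U 0 t x) * U 1 t x) * U 1 t x ^ 2 + g2 (U 0 t x) * (2 * U 2 t x * U 1 t x))).
  { apply (derive_mult (fun s => g2 (U 0 s x)) (fun s => U 1 s x ^ 2)).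
    - now apply derive_comp_t.
    - replace (2 * U 2 t x * U 1 t x) with (INR 2 * U 2 t x * U 1 t x ^ (Init.Nat.pred 2)) by (simpl; ring).
      apply (is_derive_pow (fun s => U 1 s x) 2). apply is_derive_up_t. lia. }
  assert (E2 : is_derive (fun s => g1 (U 0 s x) * U 2 s x) t
    ((g2 (U 0 t x) * U 1 t x) * U 2 t x + g1 (U 0 t x) * U 3 t x)).
  { apply (derive_mult (fun s => g1 (U 0 s x)) (fun s => U 2 s x)).
    - now apply derive_comp_t.
    - apply is_derive_up_t. lia. }
  pose proof (is_derive_plus _ _ _ _ _ E1 E2) as E. unfold plus in E; simpl in E.
  replace (g3 (U 0 t x) * U 1 t x ^ 3 + 3 * (g2 (U 0 t x) * (U 1 t x * U 2 t x)) + g1 (U 0 t x) * U 3 t x)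
    with (g3 (U 0 t x) * U 1 t x * (U 1 t x * (U 1 t x * 1)) + g2 (U 0 t x) * (2 * U 2 t x * U 1 t x)
      + (g2 (U 0 t x) * U 1 t x * U 2 t x + g1 (U 0 t x) * U 3 t x)) by ring.
  exact E.
Qed.

Lemma F1_boundary x : F1 0 x = 0 /\ F1 PI x = 0.
Proof. unfold F1. destruct (up1_t_0 N c x) as [-> ->]. split; ring. Qed.

Lemma b_parts1 k : INR (fst k) * b k = Int2 (fun t x => F1 t x * psi 1 k t x).
Proof.
  unfold bc. apply (parts_t (fun t x => g0 (U 0 t x)) F1); auto with jc; try discriminate.
  intros t x. now apply derive_comp_t.
Qed.
Lemma b_parts2 k : INR (fst k) ^ 2 * b k = Int2 (fun t x => F2 t x * psi 2 k t x).
Proof.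
  replace (INR (fst k) ^ 2 * b k) with (INR (fst k) * (INR (fst k) * b k)) by ring.
  rewrite b_parts1. apply (parts_t F1 F2); auto with jc.
  - apply derive_F1.
  - intros _. apply F1_boundary.
Qed.
Lemma b_parts3 k : INR (fst k) ^ 3 * b k = Int2 (fun t x => F3 t x * psi 3 k t x).
Proof.
  replace (INR (fst k) ^ 3 * b k) with (INR (fst k) * (INR (fst k) ^ 2 * b k)) by ring.
  rewrite b_parts2. apply (parts_t F2 F3); auto with jc; try discriminate. apply derive_F2.
Qed.

Lemma Bq2_Int : Bq 2 <= Int2 (fun t x => F2 t x ^ 2).
Proof.
  eapply Rle_trans; [|apply (bessel (box N) (psi 2) F2); [apply psi_suborth|auto with jc]].
  right. apply lsum_ext_in. intros k _. now rewrite b_parts2.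
Qed.
Lemma Bq3_Int : Bq 3 <= Int2 (fun t x => F3 t x ^ 2).
Proof.
  eapply Rle_trans; [|apply (bessel (box N) (psi 3) F3); [apply psi_suborth|auto with jc]].
  right. apply lsum_ext_in. intros k _. now rewrite b_parts3.
Qed.

Lemma gB_sq t x : g1 (U 0 t x) ^ 2 <= G ^ 2 /\ g2 (U 0 t x) ^ 2 <= G ^ 2 /\ g3 (U 0 t x) ^ 2 <= G ^ 2.
Proof.
  destruct (HgB _ (up0_supb N Rm c t x Hs)) as (_ & E1 & E2 & E3).
  rewrite <- (pow2_abs (g1 _)), <- (pow2_abs (g2 _)), <- (pow2_abs (g3 _)).
  repeat split; apply pow_incr; (split; [apply Rabs_pos|assumption]).
Qed.
Lemma U1_sq t x : U 1 t x ^ 2 <= Sl 1 ^ 2.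
Proof. rewrite <- pow2_abs. apply pow_incr. split; [apply Rabs_pos|apply up_sup]. Qed.
Lemma U_L2 i : Int2 (fun t x => U i t x ^ 2) <= X i.
Proof. apply up_L2. Qed.

Lemma Bq2_le : Bq 2 <= 2 * G ^ 2 * (Sl 1 ^ 2 * X 1 + X 2).
Proof.
  eapply Rle_trans; [apply Bq2_Int|].
  apply Rle_trans with (Int2 (fun t x => (2 * G ^ 2 * Sl 1 ^ 2) * U 1 t x ^ 2 + (2 * G ^ 2) * U 2 t x ^ 2)).
  - apply Int2_le; auto 10 with jc. intros t x _ _. unfold F2.
    destruct (gB_sq t x) as (H1 & H2 & _). pose proof (U1_sq t x) as HU.
    set (a := g2 (U 0 t x)) in *. set (d := g1 (U 0 t x)) in *. set (u := U 1 t x) in *. set (v := U 2 t x).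
    assert (E1 : (a * u ^ 2 + d * v) ^ 2 <= 2 * (a ^ 2 * (u ^ 2 * u ^ 2)) + 2 * (d ^ 2 * v ^ 2))
      by (pose proof (pow2_ge_0 (a * u ^ 2 - d * v)); nra).
    pose proof (pow2_ge_0 u). pose proof (pow2_ge_0 v).
    assert (E2 : a ^ 2 * (u ^ 2 * u ^ 2) <= G ^ 2 * (Sl 1 ^ 2 * u ^ 2)).
    { apply Rmult_le_compat; [apply pow2_ge_0|now apply Rmult_le_pos|assumption|].
      now apply Rmult_le_compat_r. }
    assert (E3 : d ^ 2 * v ^ 2 <= G ^ 2 * v ^ 2) by now apply Rmult_le_compat_r.
    lra.
  - rewrite Int2_plus, !Int2_scal by auto with jc.
    pose proof (U_L2 1). pose proof (U_L2 2). pose proof (pow2_ge_0 G). pose proof (pow2_ge_0 (Sl 1)).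
    assert (0 <= 2 * G ^ 2 * Sl 1 ^ 2) by (apply Rmult_le_pos; lra).
    assert (2 * G ^ 2 * Sl 1 ^ 2 * Int2 (fun t x => U 1 t x ^ 2) <= 2 * G ^ 2 * Sl 1 ^ 2 * X 1)
      by now apply Rmult_le_compat_l.
    assert (2 * G ^ 2 * Int2 (fun t x => U 2 t x ^ 2) <= 2 * G ^ 2 * X 2) by (apply Rmult_le_compat_l; lra).
    lra.
Qed.

Definition bX1 : R := Rm ^ 2 + 1.
Definition bX2 : R := 2 * (4 * G ^ 2 + kap ^ 2 * (2 * G ^ 2 * (1152 * bX1 * (mu ^ 2 * (G ^ 2 * bX1))))).
(** [Bq 2] is bounded by a multiple of [X 2] plus lower order, the quadratic term [u_t^2] being
    handled through the sup bound [Sl 1]. [Hk2] makes the coefficient of [X 2] at most [1/2];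
    absorbing it accounts for the factor 2 in [bX2], and likewise in [bX3]. *)
Lemma X2_le : X 2 <= bX2.
Proof.
  pose proof (X_le 0) as E. pose proof Bq0_le as E0. pose proof Bq1_le as E1. pose proof Bq2_le as E2.
  pose proof (Sl_sq 1) as ES. fold bX1 in E1. fold bX1 in Hk2. fold bX1 in Hx1.
  pose proof (X_nonneg 1). pose proof (X_nonneg 2). pose proof (pow2_ge_0 mu). pose proof (pow2_ge_0 G).
  pose proof (pow2_ge_0 kap). pose proof (Bq_nonneg 1).
  assert (Hx0 : 0 <= bX1) by lra.
  assert (A1 : Sl 1 ^ 2 * X 1 <= 1152 * (X 2 + mu ^ 2 * (G ^ 2 * bX1)) * bX1).
  { apply Rmult_le_compat; try lra; [apply pow2_ge_0|].
    eapply Rle_trans; [apply ES|]. apply Rmult_le_compat_l; [lra|]. apply Rplus_le_compat_l.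
    now apply Rmult_le_compat_l. }
  assert (A2 : Bq 2 <= 2 * G ^ 2 * ((1152 * bX1 + 1) * X 2 + 1152 * bX1 * (mu ^ 2 * (G ^ 2 * bX1)))).
  { eapply Rle_trans; [apply E2|]. apply Rmult_le_compat_l; lra. }
  assert (A3 : kap ^ 2 * Bq 2 <= kap ^ 2 * (2 * G ^ 2 * (1152 * bX1 + 1)) * X 2
      + kap ^ 2 * (2 * G ^ 2 * (1152 * bX1 * (mu ^ 2 * (G ^ 2 * bX1))))).
  { eapply Rle_trans; [apply Rmult_le_compat_l; [assumption|apply A2]|]. right. ring. }
  assert (A4 : kap ^ 2 * (2 * G ^ 2 * (1152 * bX1 + 1)) * X 2 <= 1 / 2 * X 2) by now apply Rmult_le_compat_r.
  unfold bX2. lra.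
Qed.
Definition bS1 : R := 1152 * (bX2 + mu ^ 2 * (G ^ 2 * bX1)).
Lemma Sl1_le : Sl 1 ^ 2 <= bS1.
Proof.
  eapply Rle_trans; [apply Sl_sq|]. unfold bS1. apply Rmult_le_compat_l; [lra|].
  apply Rplus_le_compat; [apply X2_le|]. apply Rmult_le_compat_l; [apply pow2_ge_0|apply Bq1_le].
Qed.
Definition bB2 : R := 2 * G ^ 2 * (bS1 * bX1 + bX2).
Lemma Bq2_le' : Bq 2 <= bB2.
Proof.
  eapply Rle_trans; [apply Bq2_le|]. unfold bB2. pose proof (pow2_ge_0 G).
  apply Rmult_le_compat_l; [lra|]. apply Rplus_le_compat; [|apply X2_le].
  apply Rmult_le_compat; [apply pow2_ge_0|apply X_nonneg|apply Sl1_le|apply Hx1].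
Qed.

Lemma Bq3_le : Bq 3 <= 3 * G ^ 2 * (bS1 ^ 2 * bX1 + 9 * (bS1 * bX2) + X 3).
Proof.
  eapply Rle_trans; [apply Bq3_Int|].
  apply Rle_trans with (Int2 (fun t x => (3 * G ^ 2 * bS1 ^ 2) * U 1 t x ^ 2
      + (27 * G ^ 2 * bS1) * U 2 t x ^ 2 + (3 * G ^ 2) * U 3 t x ^ 2)).
  - apply Int2_le; auto 10 with jc. intros t x _ _. unfold F3.
    destruct (gB_sq t x) as (H1 & H2 & H3). pose proof (Rle_trans _ _ _ (U1_sq t x) Sl1_le) as HU.
    set (e := g3 (U 0 t x)) in *.
    set (a := g2 (U 0 t x)) in *. set (d := g1 (U 0 t x)) in *. set (u := U 1 t x) in *. set (v := U 2 t x).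
    set (w := U 3 t x). set (y1 := e * u ^ 3). set (y2 := 3 * (a * (u * v))). set (y3 := d * w).
    assert (E1 : (y1 + y2 + y3) ^ 2 <= 3 * y1 ^ 2 + 3 * y2 ^ 2 + 3 * y3 ^ 2).
    { pose proof (pow2_ge_0 (y1 - y2)). pose proof (pow2_ge_0 (y1 - y3)). pose proof (pow2_ge_0 (y2 - y3)). nra. }
    pose proof (pow2_ge_0 u). pose proof (pow2_ge_0 v). pose proof (pow2_ge_0 w).
    assert (E2 : y1 ^ 2 <= G ^ 2 * (bS1 ^ 2 * u ^ 2)).
    { unfold y1. replace ((e * u ^ 3) ^ 2) with (e ^ 2 * ((u ^ 2) ^ 2 * u ^ 2)) by ring.
      apply Rmult_le_compat; [apply pow2_ge_0|apply Rmult_le_pos; [apply pow2_ge_0|assumption]|assumption|].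
      apply Rmult_le_compat_r; [assumption|]. apply pow_incr. split; assumption. }
    assert (E3 : y2 ^ 2 <= 9 * (G ^ 2 * (bS1 * v ^ 2))).
    { unfold y2. replace ((3 * (a * (u * v))) ^ 2) with (9 * (a ^ 2 * (u ^ 2 * v ^ 2))) by ring.
      apply Rmult_le_compat_l; [lra|].
      apply Rmult_le_compat; [apply pow2_ge_0|now apply Rmult_le_pos|assumption|].
      now apply Rmult_le_compat_r. }
    assert (E4 : y3 ^ 2 <= G ^ 2 * w ^ 2).
    { unfold y3. rewrite Rpow_mult_distr. now apply Rmult_le_compat_r. }
    lra.
  - rewrite !Int2_plus, !Int2_scal by auto with jc.
    pose proof (U_L2 1). pose proof (U_L2 2). pose proof (U_L2 3). pose proof (pow2_ge_0 G).
    pose proof (Rle_trans _ _ _ (pow2_ge_0 (Sl 1)) Sl1_le) as Hs1. pose proof X2_le.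
    assert (A1 : 3 * G ^ 2 * bS1 ^ 2 * Int2 (fun t x => U 1 t x ^ 2) <= 3 * G ^ 2 * bS1 ^ 2 * bX1).
    { apply Rmult_le_compat_l; [|unfold bX1; lra]. apply Rmult_le_pos; [lra|apply pow2_ge_0]. }
    assert (A2 : 27 * G ^ 2 * bS1 * Int2 (fun t x => U 2 t x ^ 2) <= 27 * G ^ 2 * bS1 * bX2).
    { apply Rmult_le_compat_l; [|lra]. apply Rmult_le_pos; lra. }
    assert (A3 : 3 * G ^ 2 * Int2 (fun t x => U 3 t x ^ 2) <= 3 * G ^ 2 * X 3) by (apply Rmult_le_compat_l; lra).
    lra.
Qed.
Definition bX3 : R := 2 * (G ^ 2 * bX1 + kap ^ 2 * (3 * G ^ 2 * (bS1 ^ 2 * bX1 + 9 * (bS1 * bX2)))).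
Lemma X3_le : X 3 <= bX3.
Proof.
  pose proof (X_le 1) as E. pose proof Bq1_le as E1. pose proof Bq3_le as E3. fold bX1 in E1.
  pose proof (X_nonneg 3). pose proof (pow2_ge_0 G). pose proof (pow2_ge_0 kap). pose proof (pow2_ge_0 Rm).
  assert (A1 : kap ^ 2 * (3 * G ^ 2) <= 1 / 2).
  { eapply Rle_trans; [|apply Hk2]. apply Rmult_le_compat_l; [assumption|]. nra. }
  assert (A2 : kap ^ 2 * Bq 3 <= kap ^ 2 * (3 * G ^ 2 * (bS1 ^ 2 * bX1 + 9 * (bS1 * bX2))) + kap ^ 2 * (3 * G ^ 2) * X 3).
  { eapply Rle_trans; [apply Rmult_le_compat_l; [assumption|apply E3]|]. right. ring. }
  assert (A3 : kap ^ 2 * (3 * G ^ 2) * X 3 <= 1 / 2 * X 3) by now apply Rmult_le_compat_r.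
  unfold bX3. lra.
Qed.

(** * Space and mixed derivatives *)

Definition Yx (i : nat) : R := lsum (box N) (fun k => (c k * INR (fst k) ^ i * INR (snd k)) ^ 2).
(** Write [j^2 = lam + (om n l)^2] and replace [lam c] by [- mu b]: one space derivative costs one
    time derivative plus a product controlled by [X] and [Bq]. *)
Lemma Yx_le i : Yx i <= (mu ^ 2 * Bq i + X i) + (om * INR n) ^ 2 * X (S i).
Proof.
  unfold Yx, Bq, X. rewrite <- !lsum_scal, <- !lsum_plus. apply lsum_le. intros k Hk.
  set (L := INR (fst k) ^ i). replace (INR (fst k) ^ S i) with (L * INR (fst k)) by (unfold L; simpl; ring).
  replace ((c k * L * INR (snd k)) ^ 2) with ((c k * L) * (L * (lam n om k * c k)) + (om * INR n) ^ 2 * (c k * (L * INR (fst k))) ^ 2)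
    by (unfold lam; ring).
  apply Rplus_le_compat_r. rewrite (Heq k Hk).
  replace (c k * L * (L * (- mu * b k))) with ((c k * L) * (- mu * (L * b k))) by ring.
  set (p1 := c k * L). set (p2 := L * b k). pose proof (pow2_ge_0 (p1 + mu * p2)).
  pose proof (pow2_ge_0 p1). pose proof (pow2_ge_0 (mu * p2)). nra.
Qed.
Lemma X0_le : X 0 <= supb Rm ^ 2.
Proof.
  apply Rle_trans with (lsum (box N) (fun k => supb Rm * Rabs (c k))).
  - apply lsum_le. intros k Hk. replace ((c k * INR (fst k) ^ 0) ^ 2) with (Rabs (c k) ^ 2) by (rewrite pow2_abs; simpl; ring).
    replace (Rabs (c k) ^ 2) with (Rabs (c k) * Rabs (c k)) by ring.
    apply Rmult_le_compat_r; [apply Rabs_pos|]. eapply Rle_trans; [|apply Hs].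
    apply (lsum_term_le (box N) (fun k => Rabs (c k))); [intros; apply Rabs_pos|assumption].
  - rewrite lsum_scal. replace (supb Rm ^ 2) with (supb Rm * supb Rm) by ring.
    apply Rmult_le_compat_l; [unfold supb; lra|assumption].
Qed.

Definition Fx t x : R := g1 (U 0 t x) * upx N 0 c t x.
Definition Fxt t x : R := (g2 (U 0 t x) * U 1 t x) * upx N 0 c t x + g1 (U 0 t x) * upx N 1 c t x.
Lemma jcont_Fx : jcont Fx. Proof. unfold Fx. auto with jc. Qed.
Lemma jcont_Fxt : jcont Fxt. Proof. unfold Fxt. auto 10 with jc. Qed.
Hint Resolve jcont_Fx jcont_Fxt : jc.
Lemma derive_Fx t x : is_derive (fun y => g0 (U 0 t y)) x (Fx t x).
Proof.
  unfold Fx. rewrite Rmult_comm. apply (is_derive_comp g0 (fun y => U 0 t y)); [apply Hg|].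
  apply is_derive_up_x.
Qed.
Lemma derive_Fxt t x : is_derive (fun s => Fx s x) t (Fxt t x).
Proof.
  apply (derive_mult (fun s => g1 (U 0 s x)) (fun s => upx N 0 c s x)).
  - now apply derive_comp_t.
  - apply is_derive_upx_t. lia.
Qed.
Lemma parts_chi k : INR (fst k) * Int2 (fun t x => Fx t x * chi 0 k t x) = Int2 (fun t x => Fxt t x * chi 1 k t x).
Proof.
  rewrite <- Int2_scal by auto with jc.
  unfold Int2. f_equal. apply int_ext. intros x _. destruct k as [l j]. unfold chi; simpl fst; simpl snd.
  set (z := nrm l * cos (INR j * x)).
  assert (E : int (fun t => Fxt t x * (z * tr 1 (INR l * t)) + Fx t x * (z * (- (INR l * tr 0 (INR l * t))))) = 0).
  { rewrite (int_derive (fun t => Fx t x * (z * tr 1 (INR l * t)))).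
    - destruct (tr_odd_0 0 ltac:(lia) ltac:(lia) l) as [-> ->]. ring.
    - intros t. apply (derive_mult (fun s => Fx s x) (fun s => z * tr 1 (INR l * s))).
      + apply derive_Fxt.
      + apply is_derive_scal. apply is_derive_tr_S. lia.
    - auto 10 with jc. }
  rewrite int_plus in E by auto 10 with jc.
  rewrite (int_ext (fun t => Fxt t x * (nrm l * tr 1 (INR l * t) * cos (INR j * x)))
    (fun t => Fxt t x * (z * tr 1 (INR l * t)))) by (intros; unfold z; ring).
  rewrite (int_ext (fun t => INR l * (Fx t x * (nrm l * tr 0 (INR l * t) * cos (INR j * x))))
    (fun t => (-1) * (Fx t x * (z * - (INR l * tr 0 (INR l * t)))))) by (intros; unfold z; ring).
  rewrite int_scal by auto 10 with jc. lra.
Qed.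
Lemma b_parts_x k : INR (snd k) * b k = Int2 (fun t x => Fx t x * chi 0 k t x).
Proof.
  unfold bc. apply (parts_x (fun t x => g0 (U 0 t x)) Fx); auto with jc.
  - apply derive_Fx.
  - intros t. destruct (up_x_0 N 0 c t) as [-> ->]. split; assumption.
Qed.

(** [j b] and [l j b] are coefficients of the space and mixed derivatives of [g0 u] on the cosine
    families. The boundary terms vanish since [u] is zero at the ends and [g0 0 = 0]. *)
Lemma Mix_le : lsum (box N) (fun k => (1 + INR (fst k) ^ 2) * (INR (snd k) * b k) ^ 2)
  <= G ^ 2 * Yx 0 + 2 * G ^ 2 * (bS1 * Yx 0 + Yx 1).
Proof.
  apply Rle_trans with (Int2 (fun t x => Fx t x ^ 2) + Int2 (fun t x => Fxt t x ^ 2)).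
  - eapply Rle_trans; [|apply Rplus_le_compat; [apply (bessel (box N) (chi 0)); [apply chi_suborth|auto with jc]
      |apply (bessel (box N) (chi 1)); [apply chi_suborth|auto with jc]]].
    rewrite <- lsum_plus. right. apply lsum_ext_in. intros k _.
    rewrite <- parts_chi, <- b_parts_x. ring.
  - pose proof (pow2_ge_0 G) as HG2. pose proof (Rle_trans _ _ _ (pow2_ge_0 (Sl 1)) Sl1_le) as Hs1.
    assert (E0 : Int2 (fun t x => upx N 0 c t x ^ 2) <= Yx 0) by apply upx_L2.
    assert (E1 : Int2 (fun t x => upx N 1 c t x ^ 2) <= Yx 1) by apply upx_L2.
    apply Rplus_le_compat.
    + apply Rle_trans with (Int2 (fun t x => G ^ 2 * upx N 0 c t x ^ 2)).
      * apply Int2_le; auto with jc. intros t x _ _. unfold Fx. rewrite Rpow_mult_distr.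
        apply Rmult_le_compat_r; [apply pow2_ge_0|apply gB_sq].
      * rewrite Int2_scal by auto with jc. now apply Rmult_le_compat_l.
    + apply Rle_trans with (Int2 (fun t x => (2 * G ^ 2 * bS1) * upx N 0 c t x ^ 2 + (2 * G ^ 2) * upx N 1 c t x ^ 2)).
      * apply Int2_le; auto 10 with jc. intros t x _ _. unfold Fxt.
        destruct (gB_sq t x) as (H1 & H2 & _). pose proof (Rle_trans _ _ _ (U1_sq t x) Sl1_le) as HU.
        set (a := g2 (U 0 t x)) in *. set (d := g1 (U 0 t x)) in *. set (u := U 1 t x) in *.
        set (v := upx N 0 c t x). set (w := upx N 1 c t x).
        assert (A1 : (a * u * v + d * w) ^ 2 <= 2 * (a ^ 2 * (u ^ 2 * v ^ 2)) + 2 * (d ^ 2 * w ^ 2))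
          by (pose proof (pow2_ge_0 (a * u * v - d * w)); nra).
        pose proof (pow2_ge_0 u). pose proof (pow2_ge_0 v). pose proof (pow2_ge_0 w).
        assert (A2 : a ^ 2 * (u ^ 2 * v ^ 2) <= G ^ 2 * (bS1 * v ^ 2)).
        { apply Rmult_le_compat; [apply pow2_ge_0|now apply Rmult_le_pos|assumption|].
          now apply Rmult_le_compat_r. }
        assert (A3 : d ^ 2 * w ^ 2 <= G ^ 2 * w ^ 2) by now apply Rmult_le_compat_r.
        lra.
      * rewrite Int2_plus, !Int2_scal by auto with jc.
        assert (A1 : 2 * G ^ 2 * bS1 * Int2 (fun t x => upx N 0 c t x ^ 2) <= 2 * G ^ 2 * bS1 * Yx 0).
        { apply Rmult_le_compat_l; [|assumption]. apply Rmult_le_pos; lra. }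
        assert (A2 : 2 * G ^ 2 * Int2 (fun t x => upx N 1 c t x ^ 2) <= 2 * G ^ 2 * Yx 1)
          by (apply Rmult_le_compat_l; lra).
        lra.
Qed.

(** This and the next two bounds concern [c], [l^2 c] and [lam c]. Each weight has a summable
    inverse, so each of the three is l1-tight uniformly in [N]. *)
Lemma weighted_c : lsum (box N) (fun k => wt (fun l => om * INR n * INR l) k * c k ^ 2)
  <= 8 * (bX1 + mu ^ 2 * (4 * G ^ 2)).
Proof.
  apply Rle_trans with (8 * (X 1 + mu ^ 2 * Bq 0)).
  - rewrite <- lam_weighted, <- lsum_scal. apply lsum_le. intros k Hk.
    pose proof (wt_le_lam n N om Hn Hom k Hk). pose proof (pow2_ge_0 (c k)). simpl pow at 5. nra.
  - pose proof Bq0_le. pose proof (pow2_ge_0 mu).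
    assert (mu ^ 2 * Bq 0 <= mu ^ 2 * (4 * G ^ 2)) by now apply Rmult_le_compat_l. unfold bX1. lra.
Qed.
Lemma weighted_l2c :
  lsum (box N) (fun k => wt (fun l => om * INR n * INR l) k * (INR (fst k) ^ 2 * c k) ^ 2)
  <= 8 * (bX3 + mu ^ 2 * bB2).
Proof.
  apply Rle_trans with (8 * (X 3 + mu ^ 2 * Bq 2)).
  - rewrite <- lam_weighted, <- lsum_scal. apply lsum_le. intros k Hk.
    pose proof (wt_le_lam n N om Hn Hom k Hk). pose proof (pow2_ge_0 (INR (fst k) ^ 2 * c k)). nra.
  - pose proof Bq2_le'. pose proof X3_le. pose proof (pow2_ge_0 mu).
    assert (mu ^ 2 * Bq 2 <= mu ^ 2 * bB2) by now apply Rmult_le_compat_l. lra.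
Qed.
Definition bY0 : R := mu ^ 2 * (4 * G ^ 2) + supb Rm ^ 2 + (om * INR n) ^ 2 * bX1.
Definition bY1 : R := mu ^ 2 * (G ^ 2 * bX1) + bX1 + (om * INR n) ^ 2 * bX2.
(** Here the weight is [(1 + l^2) (1 + j^2)]. It cannot be read off the symbol, but [lam c = - mu b]
    transfers it to [b], where mixed derivatives of [g0 u] control it. *)
Lemma weighted_lam_c :
  lsum (box N) (fun k => wt (fun _ => 0) k * (lam n om k * c k) ^ 2)
  <= 2 * mu ^ 2 * (G ^ 2 * bY0 + 2 * G ^ 2 * (bS1 * bY0 + bY1)).
Proof.
  pose proof (pow2_ge_0 mu) as Hmu2. pose proof (pow2_ge_0 G) as HG2.
  pose proof (Rle_trans _ _ _ (pow2_ge_0 (Sl 1)) Sl1_le) as Hs1.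
  assert (E0 : Yx 0 <= bY0).
  { eapply Rle_trans; [apply Yx_le|]. unfold bY0, bX1. pose proof Bq0_le. pose proof X0_le.
    pose proof (pow2_ge_0 (om * INR n)).
    assert (mu ^ 2 * Bq 0 <= mu ^ 2 * (4 * G ^ 2)) by now apply Rmult_le_compat_l.
    assert ((om * INR n) ^ 2 * X 1 <= (om * INR n) ^ 2 * (Rm ^ 2 + 1)) by now apply Rmult_le_compat_l. lra. }
  assert (E1 : Yx 1 <= bY1).
  { eapply Rle_trans; [apply Yx_le|]. unfold bY1, bX1. pose proof Bq1_le. pose proof X2_le.
    pose proof (pow2_ge_0 (om * INR n)).
    assert (mu ^ 2 * Bq 1 <= mu ^ 2 * (G ^ 2 * (Rm ^ 2 + 1))) by now apply Rmult_le_compat_l.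
    assert ((om * INR n) ^ 2 * X 2 <= (om * INR n) ^ 2 * bX2) by now apply Rmult_le_compat_l. lra. }
  apply Rle_trans with (2 * mu ^ 2 * lsum (box N) (fun k => (1 + INR (fst k) ^ 2) * (INR (snd k) * b k) ^ 2)).
  - rewrite <- lsum_scal. apply lsum_le. intros k Hk. rewrite (Heq k Hk). destruct k as [l j].
    rewrite in_box in Hk. unfold wt; simpl fst; simpl snd. rewrite Rminus_0_r.
    assert (Hj : 1 <= INR j) by (apply (le_INR 1); lia).
    set (z := mu ^ 2 * ((1 + INR l ^ 2) * b (l, j) ^ 2)).
    assert (Hz : 0 <= z).
    { apply Rmult_le_pos; [assumption|]. apply Rmult_le_pos; [|apply pow2_ge_0]. pose proof (pow2_ge_0 (INR l)). lra. }
    replace ((1 + INR l ^ 2) * (1 + INR j ^ 2) * (- mu * b (l, j)) ^ 2) with ((1 + INR j ^ 2) * z) by (unfold z; ring).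
    replace (2 * mu ^ 2 * ((1 + INR l ^ 2) * (INR j * b (l, j)) ^ 2)) with ((2 * INR j ^ 2) * z) by (unfold z; ring).
    apply Rmult_le_compat_r; [assumption|]. nra.
  - apply Rmult_le_compat_l; [lra|]. eapply Rle_trans; [apply Mix_le|].
    apply Rplus_le_compat; [now apply Rmult_le_compat_l|].
    apply Rmult_le_compat_l; [lra|]. apply Rplus_le_compat; [|assumption]. now apply Rmult_le_compat_l.
Qed.
End Regularity.

(** * Completeness and uniform limits *)

Lemma cont_eps h x : cont h -> forall e, 0 < e -> exists d, 0 < d /\ forall y, Rabs (y - x) < d -> Rabs (h y - h x) < e.
Proof.
  intros H e He. specialize (H x). apply continuity_pt_filterlim in H.
  destruct (H e He) as [d [Hd H']]. exists d. split; [assumption|]. intros y Hy.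
  destruct (Req_dec y x) as [->|Hne]; [rewrite Rminus_diag, Rabs_R0; assumption|].
  apply H'. split; [split; [exact I|congruence]|exact Hy].
Qed.

Lemma zero_on_closure h : cont h -> (forall x, 0 < x < PI -> h x = 0) -> forall x, 0 <= x <= PI -> h x = 0.
Proof.
  intros Hc H x Hx. pose proof PI_RGT_0 as Hpi. apply NNPP. intros Hne.
  destruct (cont_eps h x Hc (Rabs (h x))) as [d [Hd Hd2]]; [now apply Rabs_pos_lt|].
  set (e := Rmin (d / 2) (PI / 4)).
  assert (He : 0 < e) by (apply Rmin_pos; lra).
  assert (He1 : e <= d / 2) by apply Rmin_l. assert (He2 : e <= PI / 4) by apply Rmin_r.
  destruct (Rle_dec x (PI / 2)) as [Hx2|Hx2].
  - specialize (Hd2 (x + e)). rewrite (H (x + e)) in Hd2 by lra.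
    replace (0 - h x) with (- h x) in Hd2 by ring. rewrite Rabs_Ropp in Hd2.
    assert (Rabs (x + e - x) < d) by (rewrite Rabs_right; lra). specialize (Hd2 H0). lra.
  - specialize (Hd2 (x - e)). rewrite (H (x - e)) in Hd2 by lra.
    replace (0 - h x) with (- h x) in Hd2 by ring. rewrite Rabs_Ropp in Hd2.
    assert (Rabs (x - e - x) < d) by (rewrite Rabs_left; lra). specialize (Hd2 H0). lra.
Qed.

Lemma moments_poly h A B C : cont h -> (forall N, int (fun x => h x * cos x ^ N) = 0) ->
  forall N M, int (fun x => h x * (A + B * cos x + C * cos x ^ 2) ^ N * cos x ^ M) = 0.
Proof.
  intros Hc H N. induction N as [|N IH]; intros M.
  - rewrite (int_ext _ (fun x => h x * cos x ^ M)) by (intros; simpl; ring). apply H.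
  - rewrite (int_ext _ (fun x => A * (h x * (A + B * cos x + C * cos x ^ 2) ^ N * cos x ^ M)
       + B * (h x * (A + B * cos x + C * cos x ^ 2) ^ N * cos x ^ S M)
       + C * (h x * (A + B * cos x + C * cos x ^ 2) ^ N * cos x ^ S (S M)))) by (intros; simpl; ring).
    rewrite !int_plus, !int_scal, !IH by auto 12 with jc. ring.
Qed.

(* Otherwise the powers of [1 + (m / 2 - (cos x - cos x1)^2) / 4], large only near a point
   [x1] where [h] is positive, would have a positive integral against [h]. *)
Lemma moments_nonpos h : cont h -> (forall N, int (fun x => h x * cos x ^ N) = 0) ->
  forall x, 0 < x < PI -> h x <= 0.
Proof.
  intros Hc H x1 Hx1. apply Rnot_lt_le. intros Hpos. pose proof PI_RGT_0 as Hpi.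
  set (c := h x1 / 2). assert (Hcp : 0 < c) by (unfold c; lra).
  destruct (cont_eps h x1 Hc c Hcp) as [d0 [Hd0 Hd0']].
  set (d := Rmin (d0 / 2) (Rmin (x1 / 2) ((PI - x1) / 2))).
  assert (Hd : 0 < d) by (apply Rmin_pos; [lra|apply Rmin_pos; lra]).
  assert (Hd1 : d <= d0 / 2) by apply Rmin_l.
  assert (Hd2 : d <= x1 / 2) by (eapply Rle_trans; [apply Rmin_r|apply Rmin_l]).
  assert (Hd3 : d <= (PI - x1) / 2) by (eapply Rle_trans; [apply Rmin_r|apply Rmin_r]).
  set (D := fun x => (cos x - cos x1) ^ 2).
  set (m := Rmin (D (x1 - d)) (D (x1 + d))).
  assert (Hcl : cos x1 < cos (x1 - d)) by (apply cos_decreasing_1; lra).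
  assert (Hcr : cos (x1 + d) < cos x1) by (apply cos_decreasing_1; lra).
  assert (Hm : 0 < m) by (apply Rmin_pos; unfold D; apply pow2_gt_0; lra).
  assert (Hfar : forall x, 0 <= x <= PI -> d <= Rabs (x - x1) -> m <= D x).
  { intros x Hx Hxd. destruct (Rle_dec x x1) as [Hl|Hl].
    - rewrite Rabs_left1 in Hxd by lra. eapply Rle_trans; [apply Rmin_l|]. unfold D. apply pow_incr.
      assert (cos (x1 - d) <= cos x); [|lra].
      destruct (Req_dec x (x1 - d)) as [->|]; [lra|]. left. apply cos_decreasing_1; lra.
    - rewrite Rabs_right in Hxd by lra. eapply Rle_trans; [apply Rmin_r|]. unfold D.
      replace ((cos (x1 + d) - cos x1) ^ 2) with ((cos x1 - cos (x1 + d)) ^ 2) by ring.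
      replace ((cos x - cos x1) ^ 2) with ((cos x1 - cos x) ^ 2) by ring. apply pow_incr.
      assert (cos x <= cos (x1 + d)); [|lra].
      destruct (Req_dec x (x1 + d)) as [->|]; [lra|]. left. apply cos_decreasing_1; lra. }
  assert (HD4 : forall x, 0 <= D x <= 4).
  { intros x. unfold D. split; [apply pow2_ge_0|]. pose proof (COS_bound x). pose proof (COS_bound x1). nra. }
  assert (HcD : cont D) by (unfold D; auto with jc).
  destruct (cont_eps D x1 HcD (m / 4)) as [d1 [Hd1p Hd1']]; [lra|].
  set (e := Rmin (d / 2) (d1 / 2)).
  assert (He : 0 < e) by (apply Rmin_pos; lra).
  assert (He1 : e <= d / 2) by apply Rmin_l. assert (He2 : e <= d1 / 2) by apply Rmin_r.
  (* [D <= 4] keeps [Q] nonnegative; [Q <= 1] where [D >= m], and [Q >= 1 + m / 16] where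
     [D < m / 4]. *)
  set (Q := fun x => 1 + (m / 2 - D x) / 4).
  assert (HcQ : cont Q) by (unfold Q; apply cont_plus; [auto with jc|]; apply (cont_mult (fun x => m / 2 - D x) (fun _ => / 4)); auto with jc).
  assert (HQ0 : forall x, 0 <= Q x) by (intros x; specialize (HD4 x); unfold Q; lra).
  assert (Hhpos : forall x, Rabs (x - x1) < d0 -> c <= h x).
  { intros x Hx. specialize (Hd0' x Hx). apply Rabs_def2 in Hd0'. unfold c in *. lra. }
  destruct (continuity_ab_maj (fun x => Rabs (h x)) 0 PI) as [xm [Hxm _]]; [lra| |].
  { intros x _. apply continuity_pt_filterlim. apply (continuous_comp h Rabs); [apply Hc|apply continuous_Rabs]. }
  set (Hb := Rabs (h xm)) in *.
  assert (HHb : 0 <= Hb) by apply Rabs_pos.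
  assert (Hlow : forall N x, 0 <= x <= PI -> - Hb <= h x * Q x ^ N).
  { intros N x Hx. specialize (Hxm x Hx). cbv beta in Hxm. fold Hb in Hxm.
    assert (HQN : 0 <= Q x ^ N) by now apply pow_le.
    destruct (Rle_dec d (Rabs (x - x1))) as [Hf|Hn].
    - specialize (Hfar x Hx Hf). assert (HQ1 : Q x ^ N <= 1).
      { rewrite <- (pow1 N). apply pow_incr. split; [apply HQ0|]. unfold Q. lra. }
      apply Rabs_le_between in Hxm. nra.
    - assert (c <= h x) by (apply Hhpos; lra). nra. }
  assert (Hnear : forall N x, x1 - e <= x <= x1 + e -> c * (1 + m / 16) ^ N <= h x * Q x ^ N).
  { intros N x Hx. assert (Hxe : Rabs (x - x1) <= e) by (apply Rabs_le; lra).
    assert (HQ1 : 1 + m / 16 <= Q x).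
    { specialize (Hd1' x ltac:(lra)). apply Rabs_def2 in Hd1'.
      replace (D x1) with 0 in Hd1' by (unfold D; ring). unfold Q. lra. }
    apply Rmult_le_compat; [lra|apply pow_le; lra|apply Hhpos; lra|]. apply pow_incr. lra. }
  assert (Hint : forall N, int (fun x => h x * Q x ^ N) = 0).
  { intros N. rewrite <- (moments_poly h (1 + (m / 2 - cos x1 ^ 2) / 4) (cos x1 / 2) (- / 4) Hc H N 0).
    apply int_ext. intros x _. rewrite pow_O, Rmult_1_r. f_equal. f_equal. unfold Q, D. field. }
  assert (Hex : forall N a b, ex_RInt (fun x => h x * Q x ^ N) a b) by (intros; apply ex_int; auto with jc).
  assert (Hbound : forall N, 2 * e * (c * (1 + m / 16) ^ N) <= 2 * PI * Hb).
  { intros N. specialize (Hint N). unfold int in Hint.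
    rewrite <- (RInt_Chasles _ 0 (x1 - e) PI), <- (RInt_Chasles _ (x1 - e) (x1 + e) PI) in Hint by apply Hex.
    unfold plus in Hint; simpl in Hint.
    assert (I1 : (x1 - e - 0) * (- Hb) <= RInt (fun x => h x * Q x ^ N) 0 (x1 - e)).
    { rewrite <- (RInt_const 0 (x1 - e) (- Hb) : _ = (x1 - e - 0) * (- Hb)).
      apply RInt_le; [lra|apply ex_RInt_const|apply Hex|]. intros; apply Hlow; lra. }
    assert (I3 : (PI - (x1 + e)) * (- Hb) <= RInt (fun x => h x * Q x ^ N) (x1 + e) PI).
    { rewrite <- (RInt_const (x1 + e) PI (- Hb) : _ = (PI - (x1 + e)) * (- Hb)).
      apply RInt_le; [lra|apply ex_RInt_const|apply Hex|]. intros; apply Hlow; lra. }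
    assert (I2 : (x1 + e - (x1 - e)) * (c * (1 + m / 16) ^ N) <= RInt (fun x => h x * Q x ^ N) (x1 - e) (x1 + e)).
    { rewrite <- (RInt_const (x1 - e) (x1 + e) (c * (1 + m / 16) ^ N) : _ = (x1 + e - (x1 - e)) * (c * (1 + m / 16) ^ N)).
      apply RInt_le; [lra|apply ex_RInt_const|apply Hex|]. intros; apply Hnear; lra. }
    nra. }
  destruct (archimed_cor1 ((2 * e * c * (m / 16)) / (2 * PI * Hb + 1))) as [N [HN1 HN2]].
  { apply Rdiv_lt_0_compat; [|nra]. apply Rmult_lt_0_compat; [nra|lra]. }
  specialize (Hbound N). pose proof (poly N (m / 16) ltac:(lra)) as Hpoly.
  assert (HNp : 0 < INR N) by (apply lt_0_INR; lia).
  assert (HX : 0 < 2 * PI * Hb + 1) by nra.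
  apply (Rmult_lt_compat_r (INR N * (2 * PI * Hb + 1))) in HN1; [|now apply Rmult_lt_0_compat].
  replace (/ INR N * (INR N * (2 * PI * Hb + 1))) with (2 * PI * Hb + 1) in HN1 by (field; lra).
  replace (2 * e * c * (m / 16) / (2 * PI * Hb + 1) * (INR N * (2 * PI * Hb + 1)))
    with (2 * e * c * (INR N * (m / 16))) in HN1 by (field; lra).
  assert (2 * e * c * (1 + INR N * (m / 16)) <= 2 * e * c * (1 + m / 16) ^ N).
  { apply Rmult_le_compat_l; [nra|assumption]. }
  assert (0 < 2 * e * c) by nra. lra.
Qed.

Lemma moments_zero h : cont h -> (forall N, int (fun x => h x * cos x ^ N) = 0) ->
  forall x, 0 <= x <= PI -> h x = 0.
Proof.
  intros Hc H. apply zero_on_closure; [assumption|]. intros x Hx. apply Rle_antisym.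
  - now apply moments_nonpos.
  - enough (- h x <= 0) by lra. apply (moments_nonpos (fun y => - h y)); auto with jc.
    intros N. rewrite (int_ext _ (fun x => (-1) * (h x * cos x ^ N))) by (intros; ring).
    rewrite int_scal, H by auto with jc. ring.
Qed.

(** The formula for [2 cos y cos t] trades one power of [cos t] for two neighbouring frequencies, so
    vanishing for all frequencies propagates to all moments in [cos t]. *)
Lemma cos_coefs_zero h : cont h -> (forall l, int (fun t => h t * cos (INR l * t)) = 0) ->
  forall t, 0 <= t <= PI -> h t = 0.
Proof.
  intros Hc H. apply moments_zero; [assumption|].
  assert (E : forall N l, int (fun t => h t * cos (INR l * t) * cos t ^ N) = 0).
  { induction N as [|N IH]; intros l.
    - rewrite (int_ext _ (fun t => h t * cos (INR l * t))) by (intros; simpl; ring). apply H.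
    - destruct l as [|l].
      + rewrite (int_ext _ (fun t => h t * cos (INR 1 * t) * cos t ^ N)).
        * apply IH.
        * intros t _. simpl INR. rewrite Rmult_0_l, cos_0, Rmult_1_l. simpl. ring.
      + rewrite (int_ext _ (fun t => / 2 * (h t * cos (INR (S (S l)) * t) * cos t ^ N)
           + / 2 * (h t * cos (INR l * t) * cos t ^ N))).
        * rewrite int_plus, !int_scal, !IH by auto 10 with jc. ring.
        * intros t _. rewrite !S_INR. set (y := (INR l + 1) * t).
          replace ((INR l + 1 + 1) * t) with (y + t) by (unfold y; ring).
          replace (INR l * t) with (y - t) by (unfold y; ring).
          rewrite cos_plus, cos_minus. simpl. field. }
  intros N. rewrite <- (E N 0%nat). apply int_ext. intros t _. simpl INR. rewrite Rmult_0_l, cos_0. ring.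
Qed.

(** The same product formula shows that all cosine moments of [h sin] vanish; the sine is positive
    inside the interval and continuity covers the ends. *)
Lemma sin_coefs_zero h : cont h -> (forall j, (1 <= j)%nat -> int (fun x => h x * sin (INR j * x)) = 0) ->
  forall x, 0 <= x <= PI -> h x = 0.
Proof.
  intros Hc H.
  assert (E : forall N j, int (fun x => h x * sin (INR j * x) * cos x ^ N) = 0).
  { induction N as [|N IH]; intros j.
    - rewrite (int_ext _ (fun x => h x * sin (INR j * x))) by (intros; simpl; ring).
      destruct j as [|j]; [|apply H; lia].
      rewrite (int_ext _ (fun _ => 0)); [rewrite int_const; ring|].
      intros. simpl INR. rewrite Rmult_0_l, sin_0. ring.
    - destruct j as [|j].
      + rewrite (int_ext _ (fun _ => 0)); [rewrite int_const; ring|].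
        intros. simpl INR. rewrite Rmult_0_l, sin_0. ring.
      + rewrite (int_ext _ (fun x => / 2 * (h x * sin (INR (S (S j)) * x) * cos x ^ N)
           + / 2 * (h x * sin (INR j * x) * cos x ^ N))).
        * rewrite int_plus, !int_scal, !IH by auto 10 with jc. ring.
        * intros x _. rewrite !S_INR. set (y := (INR j + 1) * x).
          replace ((INR j + 1 + 1) * x) with (y + x) by (unfold y; ring).
          replace (INR j * x) with (y - x) by (unfold y; ring).
          rewrite sin_plus, sin_minus. simpl. field. }
  assert (Hs : forall x, 0 <= x <= PI -> h x * sin x = 0).
  { apply (moments_zero (fun x => h x * sin x)); [auto with jc|]. intros N. rewrite <- (E N 1%nat).
    apply int_ext. intros. simpl INR. rewrite Rmult_1_l. reflexivity. }
  apply zero_on_closure; [assumption|]. intros x Hx. specialize (Hs x ltac:(lra)).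
  pose proof (sin_gt_0 x (proj1 Hx) (proj2 Hx)). apply Rmult_integral in Hs. destruct Hs; lra.
Qed.

Lemma psi0_complete F : jcont F ->
  (forall l j, (1 <= j)%nat -> Int2 (fun t x => F t x * psi 0 (l, j) t x) = 0) ->
  forall t x, 0 <= t <= PI -> 0 <= x <= PI -> F t x = 0.
Proof.
  intros HF H t x Ht Hx.
  refine (cos_coefs_zero (fun t => F t x) _ _ t Ht); [auto with jc|]. intros l.
  refine (sin_coefs_zero (fun x => int (fun t => F t x * cos (INR l * t))) _ _ x Hx).
  - apply (cont_inner (fun t x => F t x * cos (INR l * t))). apply jcont_mult; [assumption|].
    apply (jcont_fst (fun t => cos (INR l * t))). auto with jc.
  - intros j Hj. specialize (H l j Hj). unfold Int2 in H.
    pose proof Int2_factor_pos. pose proof (nrm_bound l).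
    apply Rmult_integral in H. destruct H as [H|H]; [lra|].
    apply Rmult_eq_reg_l with (nrm l); [|lra]. rewrite Rmult_0_r, <- H.
    assert (Hc : cont (fun x => int (fun t => F t x * cos (INR l * t)))).
    { apply (cont_inner (fun t x => F t x * cos (INR l * t))). apply jcont_mult; [assumption|].
      apply (jcont_fst (fun t => cos (INR l * t))). auto with jc. }
    rewrite <- int_scal by auto with jc. apply int_ext. intros y _.
    replace (nrm l * (int (fun t => F t y * cos (INR l * t)) * sin (INR j * y)))
      with ((nrm l * sin (INR j * y)) * int (fun t => F t y * cos (INR l * t))) by ring.
    rewrite <- int_scal by auto with jc. apply int_ext. intros. unfold psi; simpl. ring.
Qed.

(** * Tightness in weighted l2 spaces *)

Lemma wt_pos Om k : 0 < wt Om k. Proof. pose proof (wt_ge1 Om k). lra. Qed.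

Definition inb (N : nat) (k : mode) : bool :=
  (Nat.leb (fst k) N && (Nat.leb 1 (snd k) && Nat.leb (snd k) N))%bool.
Lemma inb_spec N k : inb N k = true <-> In k (box N).
Proof.
  destruct k as [l j]. rewrite in_box. unfold inb; simpl fst; simpl snd.
  rewrite !Bool.andb_true_iff, !Nat.leb_le. tauto.
Qed.
Lemma lsum_box_inb N0 N F : (N0 <= N)%nat ->
  lsum (box N) (fun k => if inb N0 k then F k else 0) = lsum (box N0) F.
Proof.
  intros H. rewrite (lsum_incl (box N0) (box N)); auto using NoDup_box, box_incl.
  - apply lsum_ext_in. intros k Hk. apply inb_spec in Hk. now rewrite Hk.
  - intros k _ Hn. destruct (inb N0 k) eqn:E; [|reflexivity]. apply inb_spec in E. contradiction.
Qed.
Lemma lsum_box_zero N0 N F : (N0 <= N)%nat -> (forall k, ~ In k (box N0) -> F k = 0) ->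
  lsum (box N) F = lsum (box N0) F.
Proof.
  intros H Hz. rewrite <- (lsum_box_inb N0 N F H). apply lsum_ext_in. intros k _.
  destruct (inb N0 k) eqn:E; [reflexivity|]. apply Hz. intros Hk. apply inb_spec in Hk. congruence.
Qed.

(** The sums over boxes increase and stay below 144, hence are Cauchy. [N0] may depend on [Om], as
    [omega] and [n] are fixed when it is used. *)
Lemma wt_tail Om e : 0 < e -> exists N0, forall N, (N0 <= N)%nat ->
  lsum (box N) (fun k => if inb N0 k then 0 else / wt Om k) <= e.
Proof.
  intros He. set (T := fun N => lsum (box N) (fun k => / wt Om k)).
  assert (Hpos : forall k, 0 <= / wt Om k) by (intros; left; apply Rinv_0_lt_compat, wt_pos).
  assert (Hmono : forall N, T N <= T (S N)).
  { intros N. apply lsum_incl_le; auto using NoDup_box. apply box_incl. lia. }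
  destruct (ex_finite_lim_seq_incr T 144 Hmono (wt_sum Om)) as [l Hl].
  apply is_lim_seq_spec in Hl. destruct (Hl (mkposreal (e / 2) ltac:(lra))) as [N0 HN0].
  exists N0. intros N HN. pose proof (HN0 N HN) as H1. pose proof (HN0 N0 (le_n N0)) as H2. simpl in H1, H2.
  apply Rabs_def2 in H1. apply Rabs_def2 in H2.
  pose proof (lsum_box_inb N0 N (fun k => / wt Om k) HN) as E.
  assert (E2 : T N = lsum (box N) (fun k => if inb N0 k then / wt Om k else 0)
     + lsum (box N) (fun k => if inb N0 k then 0 else / wt Om k)).
  { rewrite <- lsum_plus. apply lsum_ext_in. intros k _. destruct (inb N0 k); ring. }
  rewrite E in E2. fold (T N0) in E2. lra.
Qed.

(* A bounded set of the weighted l2 space is l1-tight, so coordinatewise convergence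
   upgrades to l1 convergence. *)
Lemma l1_cauchy Om (M : nat -> nat) (z : nat -> mode -> R) (z0 : mode -> R) K :
  (forall i k, ~ In k (box (M i)) -> z i k = 0) ->
  (forall i, lsum (box (M i)) (fun k => wt Om k * z i k ^ 2) <= K) ->
  (forall k, is_lim_seq (fun i => z i k) (z0 k)) ->
  forall e, 0 < e -> exists i0, forall i j N, (i0 <= i)%nat -> (i0 <= j)%nat ->
    lsum (box N) (fun k => Rabs (z i k - z j k)) <= e.
Proof.
  intros Hz HK Hl e He.
  assert (HK0 : 0 <= K).
  { eapply Rle_trans; [|apply (HK 0%nat)]. apply lsum_nonneg. intros k _.
    apply Rmult_le_pos; [left; apply wt_pos|apply pow2_ge_0]. }
  assert (HKN : forall i N, lsum (box N) (fun k => wt Om k * z i k ^ 2) <= K).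
  { intros i N. apply Rle_trans with (lsum (box (N + M i)) (fun k => wt Om k * z i k ^ 2)).
    - apply lsum_incl_le; auto using NoDup_box; [apply box_incl; lia|].
      intros k _. apply Rmult_le_pos; [left; apply wt_pos|apply pow2_ge_0].
    - rewrite (lsum_box_zero (M i)); [apply HK|lia|]. intros k Hk. rewrite (Hz i k Hk). ring. }
  set (e1 := (e / 2) ^ 2 / (4 * K + 1)).
  assert (He1 : 0 < e1) by (apply Rdiv_lt_0_compat; [apply pow_lt|]; lra).
  destruct (wt_tail Om e1 He1) as [N0 HN0].
  assert (Hin : is_lim_seq (fun i => lsum (box N0) (fun k => Rabs (z i k - z0 k))) 0).
  { replace 0 with (lsum (box N0) (fun _ => Rabs 0)) by (rewrite Rabs_R0; apply lsum_zero).
    apply (is_lim_seq_lsum (box N0) (fun i k => Rabs (z i k - z0 k)) (fun _ => Rabs 0)). intros k _.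
    apply (is_lim_seq_abs (fun i => z i k - z0 k) 0).
    replace (Finite 0) with (Finite (z0 k - z0 k)) by (f_equal; ring).
    apply is_lim_seq_minus'; [apply Hl|apply is_lim_seq_const]. }
  apply is_lim_seq_spec in Hin. destruct (Hin (mkposreal (e / 4) ltac:(lra))) as [i0 Hi0].
  exists i0. intros i j N Hi Hj. set (N' := (N + N0)%nat).
  apply Rle_trans with (lsum (box N') (fun k => Rabs (z i k - z j k))).
  { apply lsum_incl_le; auto using NoDup_box; [apply box_incl; unfold N'; lia|]. intros; apply Rabs_pos. }
  replace (lsum (box N') (fun k => Rabs (z i k - z j k))) with
    (lsum (box N') (fun k => if inb N0 k then Rabs (z i k - z j k) else 0)
     + lsum (box N') (fun k => Rabs (if inb N0 k then 0 else z i k - z j k))).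
  2: { rewrite <- lsum_plus. apply lsum_ext_in. intros k _. destruct (inb N0 k); rewrite ?Rabs_R0; ring. }
  replace e with (e / 2 + e / 2) by field. apply Rplus_le_compat.
  - rewrite (lsum_box_inb N0 N' (fun k => Rabs (z i k - z j k))) by (unfold N'; lia).
    pose proof (Hi0 i Hi) as A1. pose proof (Hi0 j Hj) as A2. simpl in A1, A2.
    rewrite Rminus_0_r in A1, A2. apply Rabs_def2 in A1. apply Rabs_def2 in A2.
    apply Rle_trans with (lsum (box N0) (fun k => Rabs (z i k - z0 k)) + lsum (box N0) (fun k => Rabs (z j k - z0 k))); [|lra].
    rewrite <- lsum_plus. apply lsum_le. intros k _.
    replace (z i k - z j k) with ((z i k - z0 k) - (z j k - z0 k)) by ring.
    eapply Rle_trans; [apply Rabs_triang|]. rewrite Rabs_Ropp. lra.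
  - apply Rsqr_incr_0_var; [|lra]. unfold Rsqr.
    set (zz := fun k => if inb N0 k then 0 else z i k - z j k).
    assert (E : (lsum (box N') (fun k => Rabs (zz k))) ^ 2 <= e1 * (4 * K)).
    { replace (lsum (box N') (fun k => Rabs (zz k))) with
        (lsum (box N') (fun k => (if inb N0 k then 0 else / sqrt (wt Om k)) * (sqrt (wt Om k) * Rabs (zz k)))).
      - eapply Rle_trans; [apply lsum_CS|].
        assert (Hnn : forall F : mode -> R, 0 <= lsum (box N') (fun k => F k ^ 2)) by (intros; apply lsum_nonneg; intros; apply pow2_ge_0).
        apply Rmult_le_compat; [apply Hnn|apply (Hnn (fun k => sqrt (wt Om k) * Rabs (zz k)))| |].
        + eapply Rle_trans; [|apply (HN0 N'); unfold N'; lia]. right. apply lsum_ext_in. intros k _.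
          destruct (inb N0 k); [ring|]. rewrite pow_inv, pow2_sqrt; [reflexivity|left; apply wt_pos].
        + apply Rle_trans with (lsum (box N') (fun k => 2 * (wt Om k * z i k ^ 2) + 2 * (wt Om k * z j k ^ 2))).
          * apply lsum_le. intros k _. rewrite Rpow_mult_distr, pow2_sqrt, pow2_abs by (left; apply wt_pos).
            pose proof (wt_pos Om k). pose proof (pow2_ge_0 (z i k + z j k)). pose proof (pow2_ge_0 (z i k)). pose proof (pow2_ge_0 (z j k)).
            assert (0 <= wt Om k * z i k ^ 2) by (apply Rmult_le_pos; lra).
            assert (0 <= wt Om k * z j k ^ 2) by (apply Rmult_le_pos; lra).
            unfold zz. destruct (inb N0 k); [lra|].
            assert ((z i k - z j k) ^ 2 <= 2 * z i k ^ 2 + 2 * z j k ^ 2) by nra. nra.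
          * rewrite lsum_plus, !lsum_scal. pose proof (HKN i N'). pose proof (HKN j N'). lra.
      - apply lsum_ext_in. intros k _. unfold zz. destruct (inb N0 k); [rewrite Rabs_R0; ring|].
        field. apply Rgt_not_eq, sqrt_lt_R0, wt_pos. }
    assert (E1 : e1 * (4 * K) <= (e / 2) ^ 2).
    { unfold e1. apply Rle_trans with ((e / 2) ^ 2 / (4 * K + 1) * (4 * K + 1)).
      - apply Rmult_le_compat_l; [left; exact He1|lra].
      - right. field. lra. }
    change (lsum (box N') (fun k => Rabs (zz k)) * lsum (box N') (fun k => Rabs (zz k)) <= e / 2 * (e / 2)).
    simpl in E, E1. lra.
Qed.

(** * Uniform limits of functions and derivatives *)

Section UniformLimit.
Variable F : nat -> R -> R -> R.
Hypothesis HF : forall e, 0 < e -> exists i0, forall i j t x, (i0 <= i)%nat -> (i0 <= j)%nat ->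
  Rabs (F i t x - F j t x) <= e.
Definition ulim (t x : R) : R := real (Lim_seq (fun i => F i t x)).
Lemma ulim_lim t x : is_lim_seq (fun i => F i t x) (ulim t x).
Proof.
  apply Lim_seq_correct'. apply ex_lim_seq_cauchy_corr. intros e.
  destruct (HF (e / 2)) as [i0 Hi0]; [destruct e; simpl; lra|].
  exists i0. intros i j Hi Hj. eapply Rle_lt_trans; [apply Hi0; assumption|]. destruct e; simpl; lra.
Qed.
Lemma ulim_unif e : 0 < e -> exists i0, forall i t x, (i0 <= i)%nat -> Rabs (F i t x - ulim t x) <= e.
Proof.
  intros He. destruct (HF e He) as [i0 Hi0]. exists i0. intros i t x Hi.
  assert (L : is_lim_seq (fun j => Rabs (F i t x - F (j + i0)%nat t x)) (Rabs (F i t x - ulim t x))).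
  { apply (is_lim_seq_abs (fun j => F i t x - F (j + i0)%nat t x) (F i t x - ulim t x)).
    apply is_lim_seq_minus'; [apply is_lim_seq_const|].
    apply (is_lim_seq_incr_n (fun j => F j t x) i0). apply ulim_lim. }
  apply (is_lim_seq_le _ (fun _ => e) _ e (fun j => Hi0 i (j + i0)%nat t x Hi ltac:(lia)) L).
  apply is_lim_seq_const.
Qed.
Lemma ulim_jcont : (forall i, jcont (F i)) -> jcont ulim.
Proof.
  intros Hc t x. apply continuity_2d_pt_filterlim. intros e.
  destruct (ulim_unif (e / 3)) as [i Hi]; [destruct e; simpl; lra|].
  assert (Hci := Hc i t x). apply (continuity_2d_pt_filterlim (F i) t x) in Hci.
  assert (He : 0 < e / 3) by (destruct e; simpl; lra).
  destruct (Hci (mkposreal _ He)) as [d Hd]. exists d. intros u v Hu Hv.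
  specialize (Hd u v Hu Hv). simpl in Hd.
  pose proof (Hi i u v (le_n i)) as A1. pose proof (Hi i t x (le_n i)) as A2.
  apply Rabs_def2 in Hd. apply Rabs_le_between in A1. apply Rabs_le_between in A2.
  simpl fst. simpl snd. apply Rabs_def1; lra.
Qed.
End UniformLimit.

Lemma ulim_derive (f f' : nat -> R -> R) (g g' : R -> R) :
  (forall i s, is_derive (f i) s (f' i s)) ->
  (forall s, is_lim_seq (fun i => f i s) (g s)) ->
  (forall e, 0 < e -> exists i0, forall i s, (i0 <= i)%nat -> Rabs (f' i s - g' s) <= e) ->
  forall s, is_derive g s (g' s).
Proof.
  intros Hd Hl Hu s. apply is_derive_Reals.
  apply (CVU_derivable f f' g g' s (mkposreal 1 Rlt_0_1)).
  - intros e He. destruct (Hu (e / 2)) as [i0 Hi0]; [lra|]. exists i0. intros i y Hi _.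
    rewrite Rabs_minus_sym. eapply Rle_lt_trans; [apply Hi0; assumption|lra].
  - intros y _. apply is_lim_seq_Reals. apply Hl.
  - intros i y _. apply is_derive_Reals. apply Hd.
  - apply Boule_center.
Qed.

(** For an even function of period [2 PI], reflection about [m PI] shows that all intervals
    [[m PI, (m+1) PI]] carry the same integral, so the mean over [[0, k PI]] is the mean over
    [[0, PI]]. *)
Lemma int_dilate h k : cont h -> (forall y, h (- y) = h y) -> (forall y, h (y + 2 * PI) = h y) ->
  (1 <= k)%nat -> int (fun y => h (INR k * y)) = int h.
Proof.
  intros Hc He Hp Hk.
  assert (Hper : forall m y, h (y + INR m * (2 * PI)) = h y).
  { induction m as [|m IH]; intros y; [simpl; f_equal; ring|].
    rewrite S_INR. replace (y + (INR m + 1) * (2 * PI)) with ((y + INR m * (2 * PI)) + 2 * PI) by ring.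
    now rewrite Hp, IH. }
  assert (Hex : forall a b, ex_RInt h a b) by (intros; now apply ex_int).
  assert (Hint : forall m, RInt h (INR m * PI) (INR (S m) * PI) = int h).
  { induction m as [|m IH].
    - simpl INR. rewrite Rmult_0_l, Rmult_1_l. reflexivity.
    - rewrite <- IH. set (w := INR (S m) * (2 * PI)).
      pose proof (RInt_comp_lin h (-1) w (INR m * PI) (INR (S m) * PI) (Hex _ _)) as E.
      replace (-1 * (INR m * PI) + w) with (INR (S (S m)) * PI) in E by (unfold w; rewrite !S_INR; ring).
      replace (-1 * (INR (S m) * PI) + w) with (INR (S m) * PI) in E by (unfold w; rewrite !S_INR; ring).
      rewrite <- (opp_RInt_swap h (INR (S m) * PI)) in E by apply Hex.
      rewrite (RInt_ext _ (fun y => scal (-1) (h y))) in E.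
      + rewrite (RInt_scal h) in E by apply Hex. revert E.
        generalize (RInt h (INR m * PI) (INR (S m) * PI)) (RInt h (INR (S m) * PI) (INR (S (S m)) * PI)).
        unfold scal, opp; simpl; unfold mult; simpl. intros; lra.
      + intros y _. f_equal. replace (-1 * y + w) with (- y + w) by ring. unfold w. rewrite Hper. apply He. }
  assert (Hsum : forall m, RInt h 0 (INR m * PI) = INR m * int h).
  { induction m as [|m IH].
    - simpl INR. rewrite !Rmult_0_l. apply (RInt_point 0 h).
    - rewrite <- (RInt_Chasles h 0 (INR m * PI)) by apply Hex. rewrite IH, Hint, S_INR.
      unfold plus; simpl. ring. }
  pose proof (RInt_comp_lin h (INR k) 0 0 PI (Hex _ _)) as E.
  rewrite Rmult_0_r, !Rplus_0_r, Hsum in E.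
  assert (Hk' : 0 < INR k) by (apply lt_0_INR; lia).
  rewrite (RInt_ext _ (fun y => scal (INR k) (h (INR k * y)))) in E by (intros; now rewrite Rplus_0_r).
  rewrite (RInt_scal (fun y => h (INR k * y))) in E by (apply ex_int; now apply cont_lin).
  unfold scal in E; simpl in E; unfold mult in E; simpl in E. fold (int (fun y => h (INR k * y))) in E.
  apply Rmult_eq_reg_l with (INR k); lra.
Qed.

Lemma Int2_dilate F k : jcont F -> (forall t x, F (- t) x = F t x) -> (forall t x, F (t + 2 * PI) x = F t x) ->
  (forall t x, F t (- x) = F t x) -> (forall t x, F t (x + 2 * PI) = F t x) -> (1 <= k)%nat ->
  Int2 (fun t x => F (INR k * t) (INR k * x)) = Int2 F.
Proof.
  intros HF H1 H2 H3 H4 Hk. unfold Int2. f_equal.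
  rewrite (int_ext _ (fun x => int (fun t => F t (INR k * x)))).
  - apply (int_dilate (fun x => int (fun t => F t x))); auto with jc;
      intros y; apply int_ext; intros; auto.
  - intros x _. apply (int_dilate (fun t => F t (INR k * x))); auto with jc.
Qed.

Lemma lsum_multiples (F : nat -> R) k N : (1 <= k)%nat ->
  lsum (seq 1 N) (fun m => F (k * m)%nat)
  = lsum (seq 1 (k * N)) (fun m => if Nat.eqb (m mod k) 0 then F m else 0).
Proof.
  intros Hk. symmetry. rewrite (lsum_incl (map (fun m => (k * m)%nat) (seq 1 N)) (seq 1 (k * N))).
  - rewrite lsum_map. apply lsum_ext_in. intros m _.
    replace ((k * m) mod k) with 0%nat; [reflexivity|].
    symmetry. rewrite Nat.mul_comm. apply Nat.Div0.mod_mul.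
  - apply FinFun.Injective_map_NoDup; [|apply seq_NoDup]. intros a b H. nia.
  - apply seq_NoDup.
  - intros m Hm. apply in_map_iff in Hm. destruct Hm as [m' [<- Hm']]. apply in_seq in Hm'. apply in_seq. nia.
  - intros m Hm Hn. destruct (Nat.eqb_spec (m mod k) 0) as [E|]; [|reflexivity]. exfalso. apply Hn.
    apply in_map_iff. exists (m / k)%nat. apply in_seq in Hm.
    pose proof (Nat.div_mod_eq m k) as Ed. rewrite E in Ed. split; [lia|]. apply in_seq. nia.
Qed.

(** Explicit derivatives, with one function for both mixed ones, so that affine changes of variables
    can be performed without manipulating [Derive]. *)
Definition C2_data (u ut ux utt utx uxx : R -> R -> R) : Prop :=
  (jcont u /\ jcont ut /\ jcont ux /\ jcont utt /\ jcont utx /\ jcont uxx) /\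
  (forall t x, is_derive (fun s => u s x) t (ut t x) /\ is_derive (fun y => u t y) x (ux t x)) /\
  (forall t x, is_derive (fun s => ut s x) t (utt t x) /\ is_derive (fun y => ut t y) x (utx t x)) /\
  (forall t x, is_derive (fun s => ux s x) t (utx t x) /\ is_derive (fun y => ux t y) x (uxx t x)).

Lemma C2_of_data u ut ux utt utx uxx : C2_data u ut ux utt utx uxx ->
  C2 u /\ d_t (d_t u) = utt /\ d_x (d_x u) = uxx.
Proof.
  intros ((J1 & J2 & J3 & J4 & J5 & J6) & D1 & D2 & D3).
  assert (Et : d_t u = ut).
  { do 2 (apply functional_extensionality; intro). apply is_derive_unique, D1. }
  assert (Ex : d_x u = ux).
  { do 2 (apply functional_extensionality; intro). apply is_derive_unique, D1. }
  assert (Ett : d_t ut = utt).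
  { do 2 (apply functional_extensionality; intro). apply is_derive_unique, D2. }
  assert (Etx : d_x ut = utx).
  { do 2 (apply functional_extensionality; intro). apply is_derive_unique, D2. }
  assert (Ext : d_t ux = utx).
  { do 2 (apply functional_extensionality; intro). apply is_derive_unique, D3. }
  assert (Exx : d_x ux = uxx).
  { do 2 (apply functional_extensionality; intro). apply is_derive_unique, D3. }
  unfold C2. rewrite Et, Ex, Ett, Etx, Ext, Exx.
  assert (P : forall F Ft Fx, (forall t x, is_derive (fun s => F s x) t (Ft t x) /\ is_derive (fun y => F t y) x (Fx t x)) ->
    partials_exist F).
  { intros F Ft Fx H t x. destruct (H t x) as [H1 H2]. split; [exists (Ft t x)|exists (Fx t x)]; assumption. }
  pose proof (P _ _ _ D1). pose proof (P _ _ _ D2). pose proof (P _ _ _ D3). tauto.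
Qed.

Lemma is_derive_affine (h h' : R -> R) d a b t : (forall s, is_derive h s (h' s)) ->
  is_derive (fun s => d * h (a * s + b)) t (d * a * h' (a * t + b)).
Proof.
  intros H. replace (d * a * h' (a * t + b)) with (d * (a * h' (a * t + b))) by ring.
  apply is_derive_scal. apply (is_derive_comp h (fun s => a * s + b)); [apply H|].
  auto_derive; [trivial|ring].
Qed.

Lemma C2_data_affine u ut ux utt utx uxx d a b c e : C2_data u ut ux utt utx uxx ->
  C2_data (fun t x => d * u (a * t + b) (c * x + e))
    (fun t x => d * a * ut (a * t + b) (c * x + e)) (fun t x => d * c * ux (a * t + b) (c * x + e))
    (fun t x => d * a * a * utt (a * t + b) (c * x + e)) (fun t x => d * a * c * utx (a * t + b) (c * x + e))
    (fun t x => d * c * c * uxx (a * t + b) (c * x + e)).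
Proof.
  intros ((J1 & J2 & J3 & J4 & J5 & J6) & D1 & D2 & D3).
  assert (HJ : forall F z, jcont F -> jcont (fun t x => z * F (a * t + b) (c * x + e))).
  { intros F z HF. apply jcont_mult; [apply jcont_const|].
    apply (jcont_reparam F (fun t => a * t + b) (fun x => c * x + e)); auto with jc. }
  split; [split; [|split; [|split; [|split; [|split]]]]; now apply HJ|]. split; [|split]; intros t x; split.
  - apply (is_derive_affine (fun s => u s (c * x + e)) (fun s => ut s (c * x + e))). intros; apply D1.
  - apply (is_derive_affine (fun y => u (a * t + b) y) (fun y => ux (a * t + b) y)). intros; apply D1.
  - apply (is_derive_affine (fun s => ut s (c * x + e)) (fun s => utt s (c * x + e))). intros; apply D2.
  - apply (is_derive_affine (fun y => ut (a * t + b) y) (fun y => utx (a * t + b) y)). intros; apply D2.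
  - replace (d * a * c) with (d * c * a) by ring.
    apply (is_derive_affine (fun s => ux s (c * x + e)) (fun s => utx s (c * x + e))). intros; apply D3.
  - apply (is_derive_affine (fun y => ux (a * t + b) y) (fun y => uxx (a * t + b) y)). intros; apply D3.
Qed.

(** * Passage to the limit and minimal period *)

(** [cos (l y)] is a polynomial in [cos y] by the Chebyshev recurrence, so the equation
    [cos a = cos b] need not be solved. *)
Lemma cos_eq_mult a b : cos a = cos b -> forall l, cos (INR l * a) = cos (INR l * b).
Proof.
  intros H.
  assert (E : forall l, cos (INR l * a) = cos (INR l * b) /\ cos (INR (S l) * a) = cos (INR (S l) * b)).
  { induction l as [|l [IH1 IH2]].
    - simpl INR. rewrite !Rmult_0_l, !Rmult_1_l. split; [reflexivity|assumption].
    - split; [assumption|].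
      assert (R1 : forall y, cos (INR (S (S l)) * y) = 2 * cos y * cos (INR (S l) * y) - cos (INR l * y)).
      { intros y. rewrite !S_INR. set (z := (INR l + 1) * y).
        replace ((INR l + 1 + 1) * y) with (z + y) by (unfold z; ring).
        replace (INR l * y) with (z - y) by (unfold z; ring). rewrite cos_plus, cos_minus. ring. }
      rewrite !R1, H, IH1, IH2. reflexivity. }
  intros l. apply E.
Qed.

Section Solve.
Variables (n : nat) (om mu kap Rm G : R) (g0 g1 g2 g3 : R -> R) (p q : nat) (eps kp Rr : R).
Hypothesis Hn : (1 <= n)%nat.
Hypothesis Hom : / 2 <= om.
Hypothesis Hmu : mu = (om ^ 2 - 1) * INR n ^ 2.
Hypothesis Hmu0 : mu <> 0.
Hypothesis Hnr : forall k : mode, (1 <= snd k)%nat -> res n k = false ->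
  lam n om k <> 0 /\ Rabs mu <= kap * Rabs (lam n om k).
Hypothesis HG0 : 0 <= G.
Hypothesis Hg : forall y, is_derive g0 y (g1 y).
Hypothesis Hg1 : forall y, is_derive g1 y (g2 y).
Hypothesis Hg2 : forall y, is_derive g2 y (g3 y).
Hypothesis Hg3 : cont g3.
Hypothesis Hg00 : g0 0 = 0.
Hypothesis HgB : forall y, Rabs y <= supb Rm ->
  Rabs (g0 y) <= G /\ Rabs (g1 y) <= G /\ Rabs (g2 y) <= G /\ Rabs (g3 y) <= G.
Hypothesis Hkap : 0 <= kap.
Hypothesis Hball : (kap ^ 2 + mu ^ 2) * (G ^ 2 * (Rm ^ 2 + 5)) <= 1.
Hypothesis Hk2 : kap ^ 2 * (2 * G ^ 2 * (1152 * (Rm ^ 2 + 1) + 1)) <= 1 / 2.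
Hypothesis Hq : (2 <= q)%nat.
Hypothesis Hpq : (p + 1 = 2 * q)%nat.
Hypothesis Heps : forall y, Rabs y <= supb Rm -> Rabs (g1 y - INR p * y ^ (p - 1)) <= eps.
Hypothesis Heps0 : 0 <= eps.
Hypothesis Hkp : 0 < kp <= 1 / 10.
Hypothesis Hkp2 :
  3 * (eps ^ 2 + (2 * (eps + Cp Rm p) ^ 2 + 1156 * Cp Rm p ^ 2) * (kap ^ 2 * G ^ 2)) <= kp ^ 2.
Hypothesis HRr1 : 1 <= Rr.
Hypothesis HRmRr : Rm = Rr + 1.
Hypothesis HRrQ : 8 * (1 + INR (p + 1) * 4 ^ (q - 1)) < Rr ^ 2.

(** All that has to pass to the limit: the equation, the sup bound, the three weighted bounds that
    give compactness, and the energy facts that decide the minimal period. *)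
Definition good_coefs (K : R) (N : nat) (c : mode -> R) : Prop :=
  (forall k, ~ In k (box N) -> c k = 0) /\
  (forall k, In k (box N) -> lam n om k * c k = - mu * bc N g0 c k) /\
  lsum (box N) (fun k => Rabs (c k)) <= supb Rm /\
  lsum (box N) (fun k => wt (fun l => om * INR n * INR l) k * c k ^ 2) <= K /\
  lsum (box N) (fun k => wt (fun l => om * INR n * INR l) k * (INR (fst k) ^ 2 * c k) ^ 2) <= K /\
  lsum (box N) (fun k => wt (fun _ => 0) k * (lam n om k * c k) ^ 2) <= K /\
  / 400 <= N1 n N c /\ (1 - kp) * N1 n N c <= Jf n N p c /\
  forall y, 0 < N1 n N y -> exists s, 0 <= s /\
    (1 / 4 - 3 / 4 * kp) * N1 n N c <= s ^ 2 * N1 n N y * (1 + kp) / 2 - s ^ (p + 1) * Jf n N p y / INR (p + 1).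

Lemma Rm_nonneg : 0 <= Rm. Proof. lra. Qed.

Lemma N1_ext N c c' : (forall k, In k (box N) -> res n k = true -> c k = c' k) -> N1 n N c = N1 n N c'.
Proof.
  intros H. apply lsum_ext_in. intros k Hk. destruct (res n k) eqn:E; [|reflexivity].
  now rewrite (H k Hk E).
Qed.
Lemma Jf_ext N c c' : (forall k, In k (box N) -> res n k = true -> c k = c' k) -> Jf n N p c = Jf n N p c'.
Proof.
  intros H. apply Int2_ext. intros t x _ _. f_equal. apply up_ext. intros k Hk. unfold rp.
  destruct (res n k) eqn:E; [now apply H|reflexivity].
Qed.

(** The order of the quantifiers matters: [K] is built from [n], [om], [mu], [kap], [Rm] and [G]
    before [N] is chosen. *)
Lemma galerkin_good : exists K, forall N, (n <= N)%nat -> exists c, good_coefs K N c.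
Proof.
  set (K1 := 8 * (bX1 Rm + mu ^ 2 * (4 * G ^ 2))).
  set (K2 := 8 * (bX3 mu kap Rm G + mu ^ 2 * bB2 mu kap Rm G)).
  set (K3 := 2 * mu ^ 2 * (G ^ 2 * bY0 n om mu Rm G +
        2 * G ^ 2 * (bS1 mu kap Rm G * bY0 n om mu Rm G + bY1 n om mu kap Rm G))).
  exists (Rmax K1 (Rmax K2 K3)). intros N HN. pose proof Rm_nonneg as HRm.
  assert (Hnr' : forall k, In k (box N) -> res n k = false ->
    lam n om k <> 0 /\ Rabs mu <= kap * Rabs (lam n om k)).
  { intros [l j] Hk. apply in_box in Hk. apply Hnr. simpl. lia. }
  assert (HgB0 : forall y, Rabs y <= supb Rm -> Rabs (g0 y) <= G /\ Rabs (g1 y) <= G).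
  { intros y Hy. destruct (HgB y Hy) as (? & ? & _). split; assumption. }
  assert (Hcg1 : cont g1) by apply (cont_derive g1 g2 Hg1).
  destruct (galerkin_solution n N om mu kap Rm G g0 g1 Hn Hom Hmu Hnr' HRm HG0 Hg Hcg1 HgB0 Hkap Hball Hmu0
    p q eps kp Hq Hpq Hg00 Heps Heps0 (conj (Rlt_le _ _ (proj1 Hkp)) (proj2 Hkp)) Hkp2 Rr HRr1 HRmRr HRrQ HN)
    as (xi & c & HF & HN1 & Heq & H400 & HJ & Hlev).
  destruct HF as [Hadm _]. pose proof Hadm as [Hres _].
  (* Coefficients are cut to zero outside the box so that solutions for different [N] can be
     compared on a common larger box. *)
  set (c' := fun k => if inb N k then c k else 0).
  assert (Hc : forall k, In k (box N) -> c' k = c k).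
  { intros k Hk. unfold c'. apply inb_spec in Hk. now rewrite Hk. }
  assert (HN1c : N1 n N c' = N1 n N xi).
  { apply N1_ext. intros k Hk E. rewrite (Hc k Hk). now apply Hres. }
  assert (HJc : Jf n N p c' = Jf n N p xi).
  { apply Jf_ext. intros k Hk E. rewrite (Hc k Hk). now apply Hres. }
  assert (Hsum : forall F : mode -> R -> R, lsum (box N) (fun k => F k (c' k)) = lsum (box N) (fun k => F k (c k))).
  { intros F. apply lsum_ext_in. intros k Hk. now rewrite (Hc k Hk). }
  exists c'. unfold good_coefs. rewrite HN1c, HJc.
  split; [|split; [|split; [|split; [|split; [|split; [|split; [|split]]]]]]].
  - intros k Hk. unfold c'. destruct (inb N k) eqn:E; [|reflexivity]. apply inb_spec in E. contradiction.
  - intros k Hk. rewrite (Hc k Hk), (Heq k Hk). f_equal. unfold bc. apply Int2_ext. intros.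
    f_equal. f_equal. apply up_ext. intros; symmetry; now apply Hc.
  - rewrite (Hsum (fun _ z => Rabs z)). apply (adm_bounds n N om Rm Hn Hom HRm xi c HN1 Hadm).
  - rewrite (Hsum (fun k z => wt (fun l => om * INR n * INR l) k * z ^ 2)).
    eapply Rle_trans; [apply (weighted_c n N om mu Rm G g0 g1 g2 g3 xi c); assumption|apply Rmax_l].
  - rewrite (Hsum (fun k z => wt (fun l => om * INR n * INR l) k * (INR (fst k) ^ 2 * z) ^ 2)).
    eapply Rle_trans; [apply (weighted_l2c n N om mu kap Rm G g0 g1 g2 g3 xi c); assumption|].
    eapply Rle_trans; [|apply Rmax_r]. apply Rmax_l.
  - rewrite (Hsum (fun k z => wt (fun _ => 0) k * (lam n om k * z) ^ 2)).
    eapply Rle_trans; [apply (weighted_lam_c n N om mu kap Rm G g0 g1 g2 g3 xi c); assumption|].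
    eapply Rle_trans; [|apply Rmax_r]. apply Rmax_r.
  - exact H400.
  - exact HJ.
  - exact Hlev.
Qed.

(** Dominates the factors [1], [l], [j], [l^2], [l j], [j^2] that differentiation up to order two
    brings out. *)
Definition mw (k : mode) : R := 1 + INR (fst k) ^ 2 + INR (snd k) ^ 2.

(** Since [j^2 <= |lam| + (om n)^2 l^2], l1 convergence with weight [mw] reduces to plain l1
    convergence of [c], [l^2 c] and [lam c], each obtained from its weighted bound by
    [l1_cauchy]. *)
Lemma galerkin_sequence : exists (M : nat -> nat) (v : nat -> mode -> R) (K : R),
  (forall i, (i <= M i)%nat /\ (n <= M i)%nat /\ good_coefs K (M i) (v i)) /\
  forall e, 0 < e -> exists i0, forall i j N, (i0 <= i)%nat -> (i0 <= j)%nat ->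
    lsum (box N) (fun k => mw k * Rabs (v i k - v j k)) <= e.
Proof.
  destruct galerkin_good as [K HK].
  set (u := fun i => epsilon (inhabits (fun _ : mode => 0)) (good_coefs K (n + i))).
  assert (Hu : forall i, good_coefs K (n + i) (u i)).
  { intros i. apply epsilon_spec. apply HK. lia. }
  assert (Hb : forall i k, Rabs (u i k) <= supb Rm).
  { intros i k. destruct (Hu i) as (Hz & _ & Hs & _).
    destruct (inb (n + i) k) eqn:E.
    - apply inb_spec in E. eapply Rle_trans; [|apply Hs].
      apply (lsum_term_le (box (n + i)) (fun k => Rabs (u i k))); [intros; apply Rabs_pos|assumption].
    - rewrite (Hz k), Rabs_R0; [unfold supb; lra|]. intros Hk. apply inb_spec in Hk. congruence. }
  destruct (mode_extraction u (supb Rm) Hb) as [phi [Hphi Hl]].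
  set (v := fun i => u (phi i)). set (M := fun i => (n + phi i)%nat).
  set (c := fun k => real (Lim_seq (fun i => u (phi i) k))) in *.
  assert (Hgood : forall i, good_coefs K (M i) (v i)) by (intros; apply Hu).
  exists M, v, K. split.
  { intros i. pose proof (extraction_ge phi Hphi i). unfold M. split; [lia|]. split; [lia|apply Hgood]. }
  intros e He. set (C := 1 + (om * INR n) ^ 2). assert (HC : 1 <= C) by (unfold C; pose proof (pow2_ge_0 (om * INR n)); lra).
  set (e1 := e / (3 * C)). assert (He1 : 0 < e1) by (apply Rdiv_lt_0_compat; lra).
  destruct (l1_cauchy (fun l => om * INR n * INR l) M v c K) with (e := e1) as [i1 H1]; auto.
  { intros i; apply Hgood. } { intros i; apply Hgood. }
  destruct (l1_cauchy (fun l => om * INR n * INR l) M (fun i k => INR (fst k) ^ 2 * v i k)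
    (fun k => INR (fst k) ^ 2 * c k) K) with (e := e1) as [i2 H2]; auto.
  { intros i k Hk. destruct (Hgood i) as (Hz & _). rewrite (Hz k Hk). ring. }
  { intros i; apply Hgood. } { intros k. apply is_lim_seq_scal'. apply Hl. }
  destruct (l1_cauchy (fun _ => 0) M (fun i k => lam n om k * v i k)
    (fun k => lam n om k * c k) K) with (e := e1) as [i3 H3]; auto.
  { intros i k Hk. destruct (Hgood i) as (Hz & _). rewrite (Hz k Hk). ring. }
  { intros i; apply Hgood. } { intros k. apply is_lim_seq_scal'. apply Hl. }
  exists (i1 + i2 + i3)%nat. intros i j N Hi Hj.
  specialize (H1 i j N ltac:(lia) ltac:(lia)). specialize (H2 i j N ltac:(lia) ltac:(lia)).
  specialize (H3 i j N ltac:(lia) ltac:(lia)).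
  apply Rle_trans with (lsum (box N) (fun k => Rabs (v i k - v j k))
    + C * lsum (box N) (fun k => Rabs (INR (fst k) ^ 2 * v i k - INR (fst k) ^ 2 * v j k))
    + lsum (box N) (fun k => Rabs (lam n om k * v i k - lam n om k * v j k))).
  - rewrite <- lsum_scal, <- !lsum_plus. apply lsum_le. intros k _.
    rewrite <- !Rmult_minus_distr_l, !Rabs_mult, (Rabs_right (INR (fst k) ^ 2)) by (apply Rle_ge, pow2_ge_0).
    set (d := Rabs (v i k - v j k)). assert (Hd : 0 <= d) by apply Rabs_pos.
    assert (E : INR (snd k) ^ 2 <= Rabs (lam n om k) + (om * INR n) ^ 2 * INR (fst k) ^ 2).
    { pose proof (Rle_abs (lam n om k)) as Ha. unfold lam in Ha at 1.
      replace ((om * INR n * INR (fst k)) ^ 2) with ((om * INR n) ^ 2 * INR (fst k) ^ 2) in Ha by ring. lra. }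
    unfold mw, C. pose proof (Rmult_le_compat_r d _ _ Hd E). lra.
  - replace e with (e1 * C + C * e1 + e1 * C) by (unfold e1; field; lra).
    assert (e1 <= e1 * C) by nra.
    apply Rplus_le_compat; [apply Rplus_le_compat|]; [lra| |lra]. apply Rmult_le_compat_l; lra.
Qed.

(** * The limit solution *)

Section Limit.
Variables (M : nat -> nat) (v : nat -> mode -> R) (K : R).
Hypothesis HM : forall i, (i <= M i)%nat /\ (n <= M i)%nat /\ good_coefs K (M i) (v i).
Hypothesis Hcauchy : forall e, 0 < e -> exists i0, forall i j N, (i0 <= i)%nat -> (i0 <= j)%nat ->
    lsum (box N) (fun k => mw k * Rabs (v i k - v j k)) <= e.

Definition fam (Phi : mode -> R -> R -> R) (i : nat) (t x : R) : R :=
  lsum (box (M i)) (fun k => v i k * Phi k t x).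
Definition bounded_by_mw (Phi : mode -> R -> R -> R) : Prop := forall k t x, Rabs (Phi k t x) <= mw k.

Lemma fam_cauchy Phi : bounded_by_mw Phi -> forall e, 0 < e -> exists i0, forall i j t x,
  (i0 <= i)%nat -> (i0 <= j)%nat -> Rabs (fam Phi i t x - fam Phi j t x) <= e.
Proof.
  intros HPhi e He. destruct (Hcauchy e He) as [i0 H]. exists i0. intros i j t x Hi Hj.
  unfold fam.
  assert (E : forall i, (M i <= M i + M j)%nat) by (intros; lia).
  rewrite <- (lsum_box_zero (M i) (M i + M j)), <- (lsum_box_zero (M j) (M i + M j)); try lia.
  - rewrite <- lsum_minus. eapply Rle_trans; [apply lsum_abs|].
    eapply Rle_trans; [|apply (H i j (M i + M j)%nat Hi Hj)]. apply lsum_le. intros k _.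
    rewrite <- Rmult_minus_distr_r, Rabs_mult, Rmult_comm. apply Rmult_le_compat_r; [apply Rabs_pos|apply HPhi].
  - intros k Hk. destruct (HM j) as (_ & _ & Hz & _). rewrite (Hz k Hk). ring.
  - intros k Hk. destruct (HM i) as (_ & _ & Hz & _). rewrite (Hz k Hk). ring.
Qed.

Definition lfam (Phi : mode -> R -> R -> R) : R -> R -> R := ulim (fam Phi).

Lemma jcont_fam Phi i : (forall k, jcont (Phi k)) -> jcont (fam Phi i).
Proof. intros H. apply (jcont_lsum (box (M i)) (fun k t x => v i k * Phi k t x)). auto with jc. Qed.
Lemma jcont_lfam Phi : bounded_by_mw Phi -> (forall k, jcont (Phi k)) -> jcont (lfam Phi).
Proof. intros H1 H2. apply ulim_jcont; [now apply fam_cauchy|]. intros; now apply jcont_fam. Qed.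

Lemma lfam_derive_t Phi Phi' : bounded_by_mw Phi -> bounded_by_mw Phi' ->
  (forall k t x, is_derive (fun s => Phi k s x) t (Phi' k t x)) ->
  forall t x, is_derive (fun s => lfam Phi s x) t (lfam Phi' t x).
Proof.
  intros H1 H2 Hd t x.
  apply (ulim_derive (fun i s => fam Phi i s x) (fun i s => fam Phi' i s x)
    (fun s => lfam Phi s x) (fun s => lfam Phi' s x)).
  - intros i s. apply (is_derive_lsum (box (M i)) (fun k s => v i k * Phi k s x) (fun k s => v i k * Phi' k s x)).
    intros k. apply is_derive_scal. apply Hd.
  - intros s. apply (ulim_lim (fam Phi) (fam_cauchy Phi H1)).
  - intros e He. destruct (ulim_unif (fam Phi') (fam_cauchy Phi' H2) e He) as [i0 Hi0].
    exists i0. intros i s Hi. now apply Hi0.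
Qed.
Lemma lfam_derive_x Phi Phi' : bounded_by_mw Phi -> bounded_by_mw Phi' ->
  (forall k t x, is_derive (fun y => Phi k t y) x (Phi' k t x)) ->
  forall t x, is_derive (fun y => lfam Phi t y) x (lfam Phi' t x).
Proof.
  intros H1 H2 Hd t x.
  apply (ulim_derive (fun i s => fam Phi i t s) (fun i s => fam Phi' i t s)
    (fun s => lfam Phi t s) (fun s => lfam Phi' t s)).
  - intros i s. apply (is_derive_lsum (box (M i)) (fun k s => v i k * Phi k t s) (fun k s => v i k * Phi' k t s)).
    intros k. apply is_derive_scal. apply Hd.
  - intros s. apply (ulim_lim (fam Phi) (fam_cauchy Phi H1)).
  - intros e He. destruct (ulim_unif (fam Phi') (fam_cauchy Phi' H2) e He) as [i0 Hi0].
    exists i0. intros i s Hi. now apply Hi0.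
Qed.

(** [f] with indices [a b] stands for [a] time derivatives and [b] space derivatives of a mode, now
    with their factors [l] and [j] included. *)
Definition f00 (k : mode) t x := psi 0 k t x.
Definition f10 (k : mode) t x := INR (fst k) * psi 1 k t x.
Definition f20 (k : mode) t x := INR (fst k) * (INR (fst k) * psi 2 k t x).
Definition f01 (k : mode) t x := INR (snd k) * chi 0 k t x.
Definition f11 (k : mode) t x := INR (fst k) * (INR (snd k) * chi 1 k t x).
Definition f02 (k : mode) t x := INR (snd k) * (- INR (snd k) * psi 0 k t x).

Lemma bounded_scal a (F : mode -> R -> R -> R) : (forall k t x, Rabs (F k t x) <= 1) ->
  (forall k, Rabs (a k) <= mw k) -> bounded_by_mw (fun k t x => a k * F k t x).
Proof.
  intros HF Ha k t x. rewrite Rabs_mult. specialize (HF k t x). specialize (Ha k).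
  pose proof (Rabs_pos (F k t x)). pose proof (Rabs_pos (a k)). nra.
Qed.
Lemma mw_bounds k : 1 <= mw k /\ INR (fst k) <= mw k /\ INR (snd k) <= mw k /\
  INR (fst k) * INR (fst k) <= mw k /\ INR (snd k) * INR (snd k) <= mw k /\ INR (fst k) * INR (snd k) <= mw k.
Proof.
  unfold mw. set (a := INR (fst k)). set (b := INR (snd k)).
  pose proof (pow2_ge_0 a). pose proof (pow2_ge_0 b). pose proof (pow2_ge_0 (a - b)).
  pose proof (pow2_ge_0 (a - 1)). pose proof (pow2_ge_0 (b - 1)). repeat split; nra.
Qed.
Lemma Rabs_INR m : Rabs (INR m) = INR m.
Proof. apply Rabs_right, Rle_ge, pos_INR. Qed.
Lemma b00 : bounded_by_mw f00.
Proof. intros k t x. eapply Rle_trans; [apply psi_bound|apply mw_bounds]. Qed.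
Lemma b10 : bounded_by_mw f10.
Proof. apply (bounded_scal (fun k => INR (fst k))); [intros; apply psi_bound|]. intros k. rewrite Rabs_INR. apply mw_bounds. Qed.
Lemma b01 : bounded_by_mw f01.
Proof. apply (bounded_scal (fun k => INR (snd k))); [intros; apply chi_bound|]. intros k. rewrite Rabs_INR. apply mw_bounds. Qed.
Lemma b20 : bounded_by_mw f20.
Proof.
  intros k t x. unfold f20. rewrite <- Rmult_assoc. revert k t x.
  apply (bounded_scal (fun k => INR (fst k) * INR (fst k))); [intros; apply psi_bound|].
  intros k. rewrite Rabs_mult, !Rabs_INR. apply mw_bounds.
Qed.
Lemma b11 : bounded_by_mw f11.
Proof.
  intros k t x. unfold f11. rewrite <- Rmult_assoc. revert k t x.
  apply (bounded_scal (fun k => INR (fst k) * INR (snd k))); [intros; apply chi_bound|].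
  intros k. rewrite Rabs_mult, !Rabs_INR. apply mw_bounds.
Qed.
Lemma b02 : bounded_by_mw f02.
Proof.
  intros k t x. unfold f02. rewrite <- Rmult_assoc. revert k t x.
  apply (bounded_scal (fun k => INR (snd k) * - INR (snd k))); [intros; apply psi_bound|].
  intros k. rewrite Rabs_mult, Rabs_Ropp, !Rabs_INR. apply mw_bounds.
Qed.
Lemma j00 k : jcont (f00 k). Proof. unfold f00. auto with jc. Qed.
Lemma j10 k : jcont (f10 k). Proof. unfold f10. auto with jc. Qed.
Lemma j01 k : jcont (f01 k). Proof. unfold f01. auto with jc. Qed.
Lemma j20 k : jcont (f20 k). Proof. unfold f20. auto with jc. Qed.
Lemma j11 k : jcont (f11 k). Proof. unfold f11. auto with jc. Qed.
Lemma j02 k : jcont (f02 k). Proof. unfold f02. auto with jc. Qed.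
Lemma d00t k t x : is_derive (fun s => f00 k s x) t (f10 k t x).
Proof. apply is_derive_psi_t. lia. Qed.
Lemma d10t k t x : is_derive (fun s => f10 k s x) t (f20 k t x).
Proof. apply is_derive_scal. apply is_derive_psi_t. lia. Qed.
Lemma d01t k t x : is_derive (fun s => f01 k s x) t (f11 k t x).
Proof.
  unfold f01, f11.
  replace (INR (fst k) * (INR (snd k) * chi 1 k t x)) with (INR (snd k) * (INR (fst k) * chi 1 k t x)) by ring.
  apply is_derive_scal. apply is_derive_chi_t. lia.
Qed.
Lemma d00x k t x : is_derive (fun y => f00 k t y) x (f01 k t x).
Proof. apply is_derive_psi_x. Qed.
Lemma d10x k t x : is_derive (fun y => f10 k t y) x (f11 k t x).
Proof. apply is_derive_scal. apply is_derive_psi_x. Qed.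
Lemma d01x k t x : is_derive (fun y => f01 k t y) x (f02 k t x).
Proof. apply is_derive_scal. apply is_derive_chi_x. Qed.

Definition u00 := lfam f00.
Lemma fam_f00 i t x : fam f00 i t x = up (M i) 0 (v i) t x.
Proof. apply lsum_ext_in. intros k _. unfold f00. simpl. ring. Qed.
Lemma fam_supb i t x : Rabs (fam f00 i t x) <= supb Rm.
Proof. rewrite fam_f00. apply up0_supb. apply (HM i). Qed.

Lemma lfam_ext Phi t x t' x' : (forall k, Phi k t x = Phi k t' x') -> lfam Phi t x = lfam Phi t' x'.
Proof.
  intros H. unfold lfam, ulim. f_equal. apply Lim_seq_ext. intros i. apply lsum_ext_in.
  intros k _. now rewrite H.
Qed.
Lemma lfam_zero Phi t x : (forall k, Phi k t x = 0) -> lfam Phi t x = 0.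
Proof.
  intros H. unfold lfam, ulim. rewrite (Lim_seq_ext _ (fun _ => 0)); [now rewrite Lim_seq_const|].
  intros i. unfold fam. rewrite (lsum_ext_in _ _ (fun _ => 0)); [apply lsum_zero|].
  intros k _. rewrite H. ring.
Qed.

Lemma u00_x_0 t : u00 t 0 = 0 /\ u00 t PI = 0.
Proof. split; apply lfam_zero; intros k; apply psi_x_0. Qed.
Lemma u00_even t x : u00 (- t) x = u00 t x.
Proof.
  apply lfam_ext. intros k. unfold f00, psi; simpl tr.
  rewrite Ropp_mult_distr_r_reverse, cos_neg. reflexivity.
Qed.
Lemma u00_per t x : u00 (t + 2 * PI) x = u00 t x.
Proof.
  apply lfam_ext. intros k. unfold f00, psi; simpl tr.
  rewrite (cos_eq_mult (t + 2 * PI) t); [reflexivity|]. rewrite cos_plus, cos_2PI, sin_2PI. ring.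
Qed.

Definition resid (t x : R) : R :=
  (om * INR n) ^ 2 * lfam f20 t x - lfam f02 t x + mu * g0 (u00 t x).
Definition residi (i : nat) (t x : R) : R :=
  (om * INR n) ^ 2 * fam f20 i t x - fam f02 i t x + mu * g0 (fam f00 i t x).
Let Hcg0 : cont g0. Proof. apply (cont_derive g0 g1 Hg). Qed.
Lemma jcont_resid : jcont resid.
Proof.
  unfold resid, u00. apply jcont_plus; [apply jcont_minus|]; try apply jcont_mult; try apply jcont_const.
  - apply jcont_lfam; [apply b20|apply j20].
  - apply jcont_lfam; [apply b02|apply j02].
  - apply (jcont_comp (lfam f00) g0); [|assumption]. apply jcont_lfam; [apply b00|apply j00].
Qed.
Lemma jcont_residi i : jcont (residi i).
Proof.
  unfold residi. apply jcont_plus; [apply jcont_minus|]; try apply jcont_mult; try apply jcont_const.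
  - apply jcont_fam, j20.
  - apply jcont_fam, j02.
  - apply (jcont_comp (fam f00 i) g0); [|assumption]. apply jcont_fam, j00.
Qed.

(** The projection of the residual on a mode of the box is [lam c + mu bc], zero by the Galerkin
    equation. *)
Lemma residi_orth i k : In k (box (M i)) -> Int2 (fun t x => residi i t x * psi 0 k t x) = 0.
Proof.
  intros Hk. destruct (HM i) as (_ & _ & _ & Heq & _). specialize (Heq k Hk).
  rewrite (Int2_ext _ (fun t x => lsum (box (M i)) (fun k' => (lam n om k' * v i k') * psi 0 k' t x) * psi 0 k t x
     + mu * (g0 (up (M i) 0 (v i) t x) * psi 0 k t x))).
  - rewrite Int2_plus, Int2_scal.
    + rewrite (suborth_coef (box (M i)) (psi 0) (fun k' => lam n om k' * v i k') k (psi_suborth 0 (M i)) Hk).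
      fold (bc (M i) g0 (v i) k). destruct k as [l j]. apply in_box in Hk. rewrite psi0_sq by lia.
      rewrite Heq. ring.
    + apply jcont_mult; [|auto with jc]. apply (jcont_comp (up (M i) 0 (v i)) g0); auto with jc.
    + apply jcont_mult; [|auto with jc].
      apply (jcont_lsum (box (M i)) (fun k' t x => (lam n om k' * v i k') * psi 0 k' t x)). auto with jc.
    + apply jcont_mult; [apply jcont_const|]. apply jcont_mult; [|auto with jc].
      apply (jcont_comp (up (M i) 0 (v i)) g0); auto with jc.
  - intros t x _ _. unfold residi. rewrite fam_f00.
    replace ((om * INR n) ^ 2 * fam f20 i t x - fam f02 i t x)
      with (lsum (box (M i)) (fun k' => (lam n om k' * v i k') * psi 0 k' t x)); [ring|].
    unfold fam. rewrite <- lsum_scal, <- lsum_minus. apply lsum_ext_in. intros k' _.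
    unfold f20, f02, lam, psi; simpl tr. ring.
Qed.

Lemma resid_unif e : 0 < e -> exists i0, forall i t x, (i0 <= i)%nat -> Rabs (resid t x - residi i t x) <= e.
Proof.
  intros He. set (C := (om * INR n) ^ 2 + 1 + Rabs mu * G).
  assert (HC : 1 <= C).
  { unfold C. pose proof (pow2_ge_0 (om * INR n)). pose proof (Rabs_pos mu).
    assert (0 <= Rabs mu * G) by now apply Rmult_le_pos. lra. }
  assert (He1 : 0 < e / C) by (apply Rdiv_lt_0_compat; lra).
  destruct (ulim_unif (fam f20) (fam_cauchy f20 b20) (e / C) He1) as [i1 H1].
  destruct (ulim_unif (fam f02) (fam_cauchy f02 b02) (e / C) He1) as [i2 H2].
  destruct (ulim_unif (fam f00) (fam_cauchy f00 b00) (e / C) He1) as [i3 H3].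
  assert (Hsup : forall t x, Rabs (u00 t x) <= supb Rm).
  { intros t x. assert (L := is_lim_seq_abs _ _ (ulim_lim (fam f00) (fam_cauchy f00 b00) t x)).
    apply (is_lim_seq_le (fun i => Rabs (fam f00 i t x)) (fun _ => supb Rm) (Rabs (u00 t x)) (supb Rm));
      [intros; apply fam_supb|exact L|apply is_lim_seq_const]. }
  exists (i1 + i2 + i3)%nat. intros i t x Hi.
  specialize (H1 i t x ltac:(lia)). specialize (H2 i t x ltac:(lia)). specialize (H3 i t x ltac:(lia)).
  fold (lfam f20 t x) in H1. fold (lfam f02 t x) in H2. fold (lfam f00 t x) in H3. fold (u00 t x) in H3.
  unfold resid, residi.
  replace (_ - _) with ((om * INR n) ^ 2 * (lfam f20 t x - fam f20 i t x) + - (lfam f02 t x - fam f02 i t x)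
    + mu * (g0 (u00 t x) - g0 (fam f00 i t x))) by ring.
  assert (HgB0 : forall y, Rabs y <= supb Rm -> Rabs (g1 y) <= G) by (intros y Hy; apply (HgB y Hy)).
  pose proof (lipschitz_of_derive g0 g1 (supb Rm) G Hg HgB0 _ _ (Hsup t x) (fam_supb i t x)) as HL.
  eapply Rle_trans; [apply Rabs_triang|]. eapply Rle_trans; [apply Rplus_le_compat_r, Rabs_triang|].
  rewrite Rabs_Ropp, !Rabs_mult, (Rabs_right ((om * INR n) ^ 2)) by (apply Rle_ge, pow2_ge_0).
  rewrite Rabs_minus_sym in H1. rewrite Rabs_minus_sym in H2. rewrite Rabs_minus_sym in H3.
  replace e with ((om * INR n) ^ 2 * (e / C) + e / C + Rabs mu * (G * (e / C))) by (unfold C in *; field; lra).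
  apply Rplus_le_compat; [apply Rplus_le_compat|].
  - apply Rmult_le_compat_l; [apply pow2_ge_0|assumption].
  - assumption.
  - apply Rmult_le_compat_l; [apply Rabs_pos|]. eapply Rle_trans; [apply HL|]. now apply Rmult_le_compat_l.
Qed.

Lemma Rabs_le_all_zero a : (forall e, 0 < e -> Rabs a <= e) -> a = 0.
Proof.
  intros H. destruct (Req_dec a 0) as [|Hne]; [assumption|]. exfalso.
  pose proof (Rabs_pos_lt a Hne). specialize (H (Rabs a / 2) ltac:(lra)). lra.
Qed.

(** A fixed mode belongs to all large boxes, so uniform convergence makes the limit residual
    orthogonal to it, and completeness applies. Completeness covers [0 <= t <= PI] only; a general
    [t] is folded there by [acos (cos t)], since [t] enters through cosines. *)
Lemma resid_zero t x : 0 <= x <= PI -> resid t x = 0.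
Proof.
  intros Hx.
  assert (E : resid t x = resid (acos (cos t)) x).
  { assert (Hc : cos t = cos (acos (cos t))) by (symmetry; apply cos_acos; pose proof (COS_bound t); lra).
    pose proof (cos_eq_mult _ _ Hc) as Hm. unfold resid, u00.
    rewrite (lfam_ext f20 t x (acos (cos t)) x), (lfam_ext f02 t x (acos (cos t)) x),
      (lfam_ext f00 t x (acos (cos t)) x); [reflexivity| | |];
      intros k; unfold f00, f02, f20, psi; simpl tr; rewrite Hm; reflexivity. }
  rewrite E. apply (psi0_complete resid jcont_resid); [|apply acos_bound|assumption].
  intros l j Hj. apply Rabs_le_all_zero. intros e He.
  destruct (resid_unif (e / 4) ltac:(lra)) as [i0 Hi0].
  set (i := (i0 + l + j)%nat).
  assert (Hk : In (l, j) (box (M i))).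
  { apply in_box. destruct (HM i) as [HMi _]. unfold i in *. lia. }
  replace (Int2 (fun t x => resid t x * psi 0 (l, j) t x))
    with (Int2 (fun t x => (resid t x - residi i t x) * psi 0 (l, j) t x)).
  - replace e with (4 * (e / 4)) by field. rewrite <- Int2_const.
    assert (Hj1 := jcont_resid). assert (Hj2 := jcont_residi i).
    apply Int2_abs_le; auto with jc. intros t' x' _ _. rewrite Rabs_mult.
    specialize (Hi0 i t' x' ltac:(unfold i; lia)). pose proof (psi_bound 0 (l, j) t' x').
    pose proof (Rabs_pos (psi 0 (l, j) t' x')). pose proof (Rabs_pos (resid t' x' - residi i t' x')). nra.
  - assert (Hj1 := jcont_resid). assert (Hj2 := jcont_residi i).
    rewrite (Int2_ext _ (fun t x => resid t x * psi 0 (l, j) t x - residi i t x * psi 0 (l, j) t x))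
      by (intros; ring).
    rewrite Int2_minus, (residi_orth i (l, j) Hk) by auto with jc. ring.
Qed.


(** * Exclusion of smaller periods *)

Definition cl (k : mode) : R := real (Lim_seq (fun i => v i k)).
Lemma v_cauchy_term i j k : (1 <= snd k)%nat ->
  Rabs (v i k - v j k) <= lsum (box (fst k + snd k)) (fun k => mw k * Rabs (v i k - v j k)).
Proof.
  intros Hk. apply Rle_trans with (mw k * Rabs (v i k - v j k)).
  - pose proof (proj1 (mw_bounds k)). pose proof (Rabs_pos (v i k - v j k)). nra.
  - apply (lsum_term_le (box (fst k + snd k)) (fun k => mw k * Rabs (v i k - v j k))).
    + intros k' _. apply Rmult_le_pos; [|apply Rabs_pos]. pose proof (proj1 (mw_bounds k')). lra.
    + destruct k as [l m]. apply in_box. simpl in *. lia.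
Qed.
Lemma cl_lim k : (1 <= snd k)%nat -> is_lim_seq (fun i => v i k) (cl k).
Proof.
  intros Hk. apply Lim_seq_correct'. apply ex_lim_seq_cauchy_corr. intros e.
  destruct (Hcauchy (e / 2)) as [i0 H]; [destruct e; simpl; lra|]. exists i0. intros i j Hi Hj.
  eapply Rle_lt_trans; [apply v_cauchy_term; assumption|].
  eapply Rle_lt_trans; [apply H; assumption|]. destruct e; simpl; lra.
Qed.
Lemma v_cl_l1 e : 0 < e -> exists i0, forall i N, (i0 <= i)%nat ->
  lsum (box N) (fun k => Rabs (v i k - cl k)) <= e.
Proof.
  intros He. destruct (Hcauchy e He) as [i0 H]. exists i0. intros i N Hi.
  assert (L : is_lim_seq (fun j => lsum (box N) (fun k => Rabs (v i k - v (j + i0)%nat k)))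
     (lsum (box N) (fun k => Rabs (v i k - cl k)))).
  { apply (is_lim_seq_lsum (box N) (fun j k => Rabs (v i k - v (j + i0)%nat k)) (fun k => Rabs (v i k - cl k))).
    intros [l m] Hk. apply in_box in Hk.
    apply (is_lim_seq_abs (fun j => v i (l, m) - v (j + i0)%nat (l, m)) (v i (l, m) - cl (l, m))).
    apply is_lim_seq_minus'; [apply is_lim_seq_const|].
    apply (is_lim_seq_incr_n (fun j => v j (l, m)) i0). apply cl_lim. simpl. lia. }
  apply (is_lim_seq_le _ (fun _ => e) _ e) with (2 := L); [|apply is_lim_seq_const].
  intros j. eapply Rle_trans; [|apply (H i (j + i0)%nat N Hi ltac:(lia))].
  apply lsum_le. intros k _. pose proof (proj1 (mw_bounds k)). pose proof (Rabs_pos (v i k - v (j + i0)%nat k)). nra.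
Qed.

(** The symmetric second difference [u (t + P) + u (t - P) - 2 u t] keeps the series in cosines of
    time and multiplies its coefficients by [2 (cos (l P) - 1)]; periodicity makes it vanish. *)
Lemma period_coef P k : (forall t x, 0 <= x <= PI -> u00 (t + P) x = u00 t x) ->
  (1 <= snd k)%nat -> cl k * (cos (INR (fst k) * P) - 1) = 0.
Proof.
  intros HP Hk. set (w := cos (INR (fst k) * P) - 1).
  apply Rabs_le_all_zero. intros e He.
  destruct (ulim_unif (fam f00) (fam_cauchy f00 b00) (e / 32) ltac:(lra)) as [i1 H1].
  destruct (v_cl_l1 (e / 4) ltac:(lra)) as [i2 H2].
  set (i := (i1 + i2 + fst k + snd k)%nat).
  assert (Hin : In k (box (M i))).
  { destruct k as [l j]. apply in_box. destruct (HM i) as [HMi _]. unfold i in *. simpl in *. lia. }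
  set (D := fun t x => fam f00 i (t + P) x + fam f00 i (t + - P) x - 2 * fam f00 i t x).
  assert (HjF : jcont (fam f00 i)) by apply jcont_fam, j00.
  assert (HjD : jcont D).
  { unfold D. apply jcont_minus; [apply jcont_plus|].
    - apply (jcont_reparam (fam f00 i) (fun t => t + P) (fun x => x)); auto with jc.
    - apply (jcont_reparam (fam f00 i) (fun t => t + - P) (fun x => x)); auto with jc.
    - auto with jc. }
  assert (HD : forall t x, D t x = lsum (box (M i)) (fun k => (2 * v i k * (cos (INR (fst k) * P) - 1)) * psi 0 k t x)).
  { intros t x. unfold D, fam. rewrite <- lsum_scal, <- lsum_plus, <- lsum_minus. apply lsum_ext_in. intros k' _.
    unfold f00, psi; simpl tr.
    rewrite !Rmult_plus_distr_l, !cos_plus, Ropp_mult_distr_r_reverse, cos_neg, sin_neg. ring. }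
  assert (HDk : Int2 (fun t x => D t x * psi 0 k t x) = 2 * v i k * w).
  { rewrite (Int2_ext _ (fun t x => lsum (box (M i)) (fun k => (2 * v i k * (cos (INR (fst k) * P) - 1)) * psi 0 k t x) * psi 0 k t x))
      by (intros; now rewrite HD).
    rewrite (suborth_coef (box (M i)) (psi 0) (fun k => 2 * v i k * (cos (INR (fst k) * P) - 1)) k (psi_suborth 0 (M i)) Hin).
    destruct k as [l j]. rewrite psi0_sq by (simpl in Hk; lia). unfold w. ring. }
  assert (HDs : Rabs (2 * v i k * w) <= e / 2).
  { rewrite <- HDk. replace (e / 2) with (4 * (4 * (e / 32))) by field. rewrite <- Int2_const.
    apply Int2_abs_le; auto with jc. intros t x _ Hx. rewrite Rabs_mult.
    assert (HDb : Rabs (D t x) <= 4 * (e / 32)).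
    { pose proof (H1 i (t + P) x ltac:(unfold i; lia)) as A1. pose proof (H1 i (t + - P) x ltac:(unfold i; lia)) as A2.
      pose proof (H1 i t x ltac:(unfold i; lia)) as A3.
      fold (lfam f00 (t + P) x) in A1. fold (lfam f00 (t + - P) x) in A2. fold (lfam f00 t x) in A3.
      fold (u00 (t + P) x) in A1. fold (u00 (t + - P) x) in A2. fold (u00 t x) in A3.
      pose proof (HP t x Hx) as E1. pose proof (HP (t + - P) x Hx) as E2.
      replace (t + - P + P) with t in E2 by ring. rewrite E1 in A1. rewrite <- E2 in A2.
      apply Rabs_le_between in A1. apply Rabs_le_between in A2. apply Rabs_le_between in A3.
      unfold D. apply Rabs_le. lra. }
    pose proof (psi_bound 0 k t x). pose proof (Rabs_pos (psi 0 k t x)). pose proof (Rabs_pos (D t x)). nra. }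
  assert (Hcl : Rabs (v i k - cl k) <= e / 4).
  { eapply Rle_trans; [|apply (H2 i (M i) ltac:(unfold i; lia))].
    apply (lsum_term_le (box (M i)) (fun k => Rabs (v i k - cl k))); [intros; apply Rabs_pos|assumption]. }
  assert (Hw : Rabs w <= 2) by (unfold w; pose proof (COS_bound (INR (fst k) * P)); apply Rabs_le; lra).
  replace (cl k * w) with (/ 2 * (2 * v i k * w) + - ((v i k - cl k) * w)) by field.
  eapply Rle_trans; [apply Rabs_triang|]. rewrite Rabs_Ropp, Rabs_mult, (Rabs_right (/ 2)), (Rabs_mult (_ - _)) by lra.
  assert (Rabs (v i k - cl k) * Rabs w <= e / 4 * 2) by (apply Rmult_le_compat; auto using Rabs_pos). lra.
Qed.

Lemma cos_one_sin_zero a : cos a = 1 -> sin a = 0.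
Proof. intros H. pose proof (sin2_cos2 a) as E. rewrite H in E. unfold Rsqr in E. nra. Qed.
Lemma cos_one_mult a k : cos a = 1 -> cos (INR k * a) = 1.
Proof.
  intros H. rewrite (cos_eq_mult a 0) by (rewrite cos_0; assumption). rewrite Rmult_0_r. apply cos_0.
Qed.

(** [d] is the least positive [m] for which [m P] is a multiple of [2 PI]; it is not 1 as
    [P < 2 PI], and division with remainder shows that it divides all others. If no such [m] exists,
    only [m = 0] satisfies the condition and [d = 2] will do. *)
Lemma period_divisor P : 0 < P < 2 * PI ->
  exists d, (2 <= d)%nat /\ forall m, cos (INR m * P) = 1 -> (m mod d = 0)%nat.
Proof.
  intros HP. destruct (classic (exists m, (1 <= m)%nat /\ cos (INR m * P) = 1)) as [Hex|Hno].
  - destruct (dec_inh_nat_subset_has_unique_least_element (fun m => (1 <= m)%nat /\ cos (INR m * P) = 1))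
      as [d [[[Hd1 Hd2] Hmin] _]]; [intros m; apply classic|assumption|].
    exists d. split.
    + destruct (Nat.eq_dec d 1) as [->|]; [|lia]. exfalso. simpl INR in Hd2. rewrite Rmult_1_l in Hd2.
      replace P with (2 * (P / 2)) in Hd2 by field. rewrite cos_2a_sin in Hd2.
      pose proof (sin_gt_0 (P / 2) ltac:(lra) ltac:(lra)). nra.
    + intros m Hm. destruct (Nat.eq_dec (m mod d) 0) as [|Hne]; [assumption|]. exfalso.
      assert (Hr : (m mod d < d)%nat) by (apply Nat.mod_upper_bound; lia).
      assert (Hc : cos (INR (m mod d) * P) = 1).
      { pose proof (Nat.div_mod_eq m d) as E.
        replace (INR (m mod d) * P) with (INR m * P - INR (m / d) * (INR d * P)).
        - rewrite cos_minus, Hm, (cos_one_mult _ _ Hd2), (cos_one_sin_zero _ Hm). ring.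
        - rewrite E at 1. rewrite plus_INR, mult_INR. ring. }
      assert (Hr1 : (1 <= m mod d)%nat) by (revert Hne; generalize (m mod d)%nat; intros; lia).
      specialize (Hmin (m mod d)%nat (conj Hr1 Hc)). revert Hr Hmin. generalize (m mod d)%nat. intros; lia.
  - exists 2%nat. split; [lia|]. intros m Hm. destruct m as [|m]; [reflexivity|].
    exfalso. apply Hno. exists (S m). split; [lia|assumption].
Qed.

Lemma lsum_res N (F : mode -> R) : (forall k, ~ In k (box N) -> F k = 0) ->
  lsum (box N) (fun k => if res n k then F k else 0) = lsum (seq 1 N) (fun m => F (m, (n * m)%nat)).
Proof.
  intros Hz. unfold box. rewrite lsum_list_prod. simpl seq. simpl lsum at 1.
  rewrite (lsum_ext_in (seq 1 N) (fun b => if res n (0%nat, b) then F (0%nat, b) else 0) (fun _ => 0)).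
  - rewrite lsum_zero, Rplus_0_l. apply lsum_ext_in. intros m Hm. apply in_seq in Hm.
    destruct (Compare_dec.le_dec (n * m) N) as [Hle|Hgt].
    + rewrite (lsum_single _ _ (n * m)%nat (seq_NoDup _ _)).
      * unfold res; simpl. now rewrite Nat.eqb_refl.
      * apply in_seq. nia.
      * intros j _ Hj. unfold res; simpl. destruct (Nat.eqb_spec j (n * m)); [contradiction|reflexivity].
    + rewrite Hz by (rewrite in_box; lia).
      rewrite (lsum_ext_in _ _ (fun _ => 0)); [apply lsum_zero|]. intros j Hj. apply in_seq in Hj.
      unfold res; simpl. destruct (Nat.eqb_spec j (n * m)); [lia|reflexivity].
  - intros j Hj. apply in_seq in Hj. unfold res; simpl. rewrite Nat.mul_0_r.
    destruct (Nat.eqb_spec j 0); [lia|reflexivity].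
Qed.

Lemma vp_res N c t x : (forall k, ~ In k (box N) -> c k = 0) ->
  up N 0 (rp n c) t x = lsum (seq 1 N) (fun m => c (m, (n * m)%nat) * psi 0 (m, (n * m)%nat) t x).
Proof.
  intros Hz. rewrite <- (lsum_res N (fun k => c k * psi 0 k t x)).
  - apply lsum_ext_in. intros k _. unfold rp. destruct (res n k); simpl; ring.
  - intros k Hk. rewrite (Hz k Hk). ring.
Qed.

Lemma pow_p1_lip x y : Rabs x <= supb Rm -> Rabs y <= supb Rm ->
  Rabs (x ^ (p + 1) - y ^ (p + 1)) <= INR (p + 1) * supb Rm ^ p * Rabs (x - y).
Proof.
  apply (lipschitz_of_derive (fun z => z ^ (p + 1)) (fun z => INR (p + 1) * z ^ p)).
  - intros z. auto_derive; [trivial|]. rewrite Nat.add_1_r. simpl Init.Nat.pred. ring.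
  - intros z Hz. rewrite Rabs_mult, Rabs_INR, <- RPow_abs.
    apply Rmult_le_compat_l; [apply pos_INR|]. apply pow_incr. split; [apply Rabs_pos|assumption].
Qed.

(* Undoing the dilation by [d] of the multiples-of-[d] part of [c] keeps the power [p + 1]
   energy up to the discarded modes, but divides the quadratic energy by [d ^ 2]. *)
Lemma dilation_energies N d c : (2 <= d)%nat -> (forall k, ~ In k (box N) -> c k = 0) ->
  lsum (box N) (fun k => Rabs (c k)) <= supb Rm ->
  exists y, N1 n N y <= N1 n N c / 4 /\
    Jf n N p c - 4 * (INR (p + 1) * supb Rm ^ p *
       lsum (seq 1 N) (fun m => if Nat.eqb (m mod d) 0 then 0 else Rabs (c (m, (n * m)%nat)))) <= Jf n N p y.
Proof.
  intros Hd Hz Hs.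
  assert (Hd' : 2 <= INR d) by (replace 2 with (INR 2) by reflexivity; now apply le_INR).
  set (y := fun k : mode => c ((d * fst k)%nat, (d * snd k)%nat)).
  assert (Hyz : forall k, ~ In k (box N) -> y k = 0).
  { intros [l j] Hk. unfold y. apply Hz. rewrite in_box in *. simpl. nia. }
  assert (Hyc : forall m, y (m, (n * m)%nat) = c ((d * m)%nat, (n * (d * m))%nat)).
  { intros m. unfold y; simpl. f_equal. f_equal. ring. }
  (* Multiples of [d] up to [d N] overshoot the box; the coefficients vanish there, so the sum can
     be cut back to [N]. *)
  assert (Hbeyond : forall (F : nat -> R), (forall m, c (m, (n * m)%nat) = 0 -> F m = 0) ->
     lsum (seq 1 (d * N)) F = lsum (seq 1 N) F).
  { intros F HF. apply lsum_incl; try apply seq_NoDup.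
    - intros m Hm. apply in_seq in Hm. apply in_seq. nia.
    - intros m Hm Hm'. apply HF. apply Hz. rewrite in_box. rewrite in_seq in Hm, Hm'. lia. }
  exists y. split.
  - assert (E1 : N1 n N c = lsum (seq 1 N) (fun m => (INR m * c (m, (n * m)%nat)) ^ 2)).
    { apply (lsum_res N (fun k => (INR (fst k) * c k) ^ 2)). intros k Hk. rewrite (Hz k Hk). ring. }
    assert (E2 : N1 n N y = lsum (seq 1 N) (fun m => (INR m * y (m, (n * m)%nat)) ^ 2)).
    { apply (lsum_res N (fun k => (INR (fst k) * y k) ^ 2)). intros k Hk. rewrite (Hyz k Hk). ring. }
    set (A := fun m => (INR m * c (m, (n * m)%nat)) ^ 2).
    assert (E3 : INR d ^ 2 * N1 n N y <= N1 n N c).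
    { rewrite E1, E2, <- lsum_scal.
      rewrite (lsum_ext_in _ _ (fun m => A (d * m)%nat)).
      - rewrite (lsum_multiples A d N) by lia. fold A. rewrite <- (Hbeyond A).
        + apply lsum_le. intros m _. destruct (Nat.eqb (m mod d) 0); [lra|apply pow2_ge_0].
        + intros m Hm. unfold A. rewrite Hm. ring.
      - intros m _. unfold A. rewrite Hyc, mult_INR. ring. }
    assert (0 <= N1 n N y).
    { apply lsum_nonneg. intros k _. destruct (res n k); [apply pow2_ge_0|lra]. }
    assert (4 <= INR d ^ 2) by nra. nra.
  - set (w := up N 0 (rp n y)). set (vv := up N 0 (rp n c)).
    assert (Hwj : jcont w) by (unfold w; auto with jc). assert (Hvj : jcont vv) by (unfold vv; auto with jc).
    set (eta := lsum (seq 1 N) (fun m => if Nat.eqb (m mod d) 0 then 0 else Rabs (c (m, (n * m)%nat)))).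
    assert (Hwd : forall t x, w (INR d * t) (INR d * x)
       = lsum (seq 1 N) (fun m => if Nat.eqb (m mod d) 0 then c (m, (n * m)%nat) * psi 0 (m, (n * m)%nat) t x else 0)).
    { intros t x. unfold w. rewrite (vp_res N y _ _ Hyz).
      set (B := fun m => c (m, (n * m)%nat) * psi 0 (m, (n * m)%nat) t x).
      rewrite (lsum_ext_in _ _ (fun m => B (d * m)%nat)).
      - rewrite (lsum_multiples B d N) by lia. apply (Hbeyond (fun m => if Nat.eqb (m mod d) 0 then B m else 0)).
        intros m Hm. unfold B. rewrite Hm. destruct (Nat.eqb (m mod d) 0); ring.
      - intros m Hm. apply in_seq in Hm. unfold B. rewrite Hyc. f_equal. unfold psi; simpl fst; simpl snd.
        unfold nrm. destruct (Nat.eqb_spec m 0); [lia|]. destruct (Nat.eqb_spec (d * m) 0); [nia|].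
        rewrite !mult_INR. f_equal; [f_equal|]; f_equal; ring. }
    assert (Hdiff : forall t x, Rabs (vv t x - w (INR d * t) (INR d * x)) <= eta).
    { intros t x. rewrite Hwd. unfold vv. rewrite (vp_res N c _ _ Hz), <- lsum_minus.
      eapply Rle_trans; [apply lsum_abs|]. apply lsum_le. intros m _.
      destruct (Nat.eqb (m mod d) 0); [rewrite Rminus_diag, Rabs_R0; lra|].
      rewrite Rminus_0_r, Rabs_mult. pose proof (psi_bound 0 (m, (n * m)%nat) t x).
      pose proof (Rabs_pos (c (m, (n * m)%nat))). pose proof (Rabs_pos (psi 0 (m, (n * m)%nat) t x)). nra. }
    assert (Hres_l1 : lsum (seq 1 N) (fun m => Rabs (c (m, (n * m)%nat))) <= supb Rm).
    { rewrite <- (lsum_res N (fun k => Rabs (c k))).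
      - eapply Rle_trans; [|apply Hs]. apply lsum_le. intros k _. destruct (res n k); [lra|apply Rabs_pos].
      - intros k Hk. rewrite (Hz k Hk). apply Rabs_R0. }
    assert (Hterm : forall m t x, Rabs (c (m, (n * m)%nat) * psi 0 (m, (n * m)%nat) t x) <= Rabs (c (m, (n * m)%nat))).
    { intros m t x. rewrite Rabs_mult. pose proof (psi_bound 0 (m, (n * m)%nat) t x).
      pose proof (Rabs_pos (c (m, (n * m)%nat))). pose proof (Rabs_pos (psi 0 (m, (n * m)%nat) t x)). nra. }
    assert (Hvs : forall t x, Rabs (vv t x) <= supb Rm).
    { intros t x. unfold vv. rewrite (vp_res N c _ _ Hz). eapply Rle_trans; [apply lsum_abs|].
      eapply Rle_trans; [|apply Hres_l1]. apply lsum_le. intros m _. apply Hterm. }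
    assert (Hws : forall t x, Rabs (w (INR d * t) (INR d * x)) <= supb Rm).
    { intros t x. rewrite Hwd. eapply Rle_trans; [apply lsum_abs|].
      eapply Rle_trans; [|apply Hres_l1]. apply lsum_le. intros m _.
      destruct (Nat.eqb (m mod d) 0); [apply Hterm|rewrite Rabs_R0; apply Rabs_pos]. }
    (* [w] is odd in [x], but [p + 1] is even, so the integrand is even and [2 PI]-periodic in both
       variables as the dilation lemma demands. *)
    assert (HJ : Jf n N p y = Int2 (fun t x => w (INR d * t) (INR d * x) ^ (p + 1))).
    { symmetry. unfold Jf. fold w. apply (Int2_dilate (fun t x => w t x ^ (p + 1)) d); try lia; auto with jc;
        intros t x; rewrite Hpq, !pow_mult; f_equal.
      - f_equal. unfold w, up. apply lsum_ext_in. intros k _. f_equal. unfold psi; simpl tr.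
        rewrite Ropp_mult_distr_r_reverse, cos_neg. reflexivity.
      - f_equal. unfold w, up. apply lsum_ext_in. intros k _. f_equal. unfold psi; simpl tr.
        rewrite (cos_eq_mult (t + 2 * PI) t); [reflexivity|]. rewrite cos_plus, cos_2PI, sin_2PI. ring.
      - replace (w t (- x)) with (- w t x); [ring|]. unfold w, up.
        rewrite <- (Rmult_1_l (lsum _ _)), Ropp_mult_distr_l, <- lsum_scal. apply lsum_ext_in. intros k _.
        unfold psi. rewrite Ropp_mult_distr_r_reverse, sin_neg. ring.
      - f_equal. unfold w, up. apply lsum_ext_in. intros k _. f_equal. unfold psi. f_equal.
        rewrite Rmult_plus_distr_l. replace (INR (snd k) * (2 * PI)) with (2 * INR (snd k) * PI) by ring.
        apply sin_period. }
    rewrite HJ. unfold Jf. fold vv.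
    assert (Hwdj : jcont (fun t x => w (INR d * t) (INR d * x))).
    { apply (jcont_reparam w (fun t => INR d * t) (fun x => INR d * x)); auto with jc. }
    assert (E : Rabs (Int2 (fun t x => vv t x ^ (p + 1) - w (INR d * t) (INR d * x) ^ (p + 1)))
      <= 4 * (INR (p + 1) * supb Rm ^ p * eta)).
    { rewrite <- Int2_const. apply Int2_abs_le; auto with jc.
      intros t x _ _. eapply Rle_trans; [apply pow_p1_lip; auto|].
      apply Rmult_le_compat_l; [|apply Hdiff]. apply Rmult_le_pos; [apply pos_INR|].
      apply pow_le. unfold supb. lra. }
    rewrite Int2_minus in E; [|auto with jc|apply (jcont_pow (fun t x => w (INR d * t) (INR d * x))); assumption].
    apply Rabs_le_between in E. lra.
Qed.

(** A smaller period confines the resonant limit coefficients to multiples of some [d >= 2], so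
    those of a late Galerkin solution nearly are. Undoing the dilation gives a competitor with at
    most a quarter of the quadratic energy and almost the same potential. Its ray cannot reach the
    minimal level, against the last clause of [good_coefs]. *)
Lemma no_smaller_period P : 0 < P < 2 * PI -> ~ (forall t x, 0 <= x <= PI -> u00 (t + P) x = u00 t x).
Proof.
  intros HP Hper. destruct (period_divisor P HP) as [d [Hd Hdiv]].
  set (C := INR (p + 1) * supb Rm ^ p + 1).
  assert (HC : 1 <= C).
  { unfold C. assert (0 <= INR (p + 1) * supb Rm ^ p); [|lra].
    apply Rmult_le_pos; [apply pos_INR|]. apply pow_le. unfold supb. lra. }
  (* Chosen so that the loss [4 C e] in the potential is [kp / 400], at most [kp] times the
     quadratic energy [N1 >= 1/400]. *)
  assert (He : 0 < kp / (1600 * C)) by (apply Rdiv_lt_0_compat; lra).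
  destruct (v_cl_l1 _ He) as [i H]. specialize (H i (M i) (le_n i)).
  destruct (HM i) as (_ & HnM & Hz & _ & Hs & _ & _ & _ & H400 & HJ & Hlev).
  set (N := M i) in *. set (c := v i) in *.
  assert (Heta : lsum (seq 1 N) (fun m => if Nat.eqb (m mod d) 0 then 0 else Rabs (c (m, (n * m)%nat))) <= kp / (1600 * C)).
  { eapply Rle_trans; [|apply H].
    apply Rle_trans with (lsum (box N) (fun k => if res n k then if Nat.eqb (fst k mod d) 0 then 0 else Rabs (c k) else 0)).
    - right. symmetry. apply (lsum_res N (fun k => if Nat.eqb (fst k mod d) 0 then 0 else Rabs (c k))).
      intros k Hk. rewrite (Hz k Hk), Rabs_R0. destruct (Nat.eqb (fst k mod d) 0); reflexivity.
    - apply lsum_le. intros [l j] Hk. apply in_box in Hk.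
      destruct (res n (l, j)); [|apply Rabs_pos]. simpl fst.
      destruct (Nat.eqb_spec (l mod d) 0) as [|Hne]; [apply Rabs_pos|].
      pose proof (period_coef P (l, j) Hper ltac:(simpl; lia)) as E. simpl fst in E.
      apply Rmult_integral in E. destruct E as [->|E]; [rewrite Rminus_0_r; lra|].
      exfalso. apply Hne, Hdiv. lra. }
  destruct (dilation_energies N d c Hd Hz Hs) as [y [Hy1 Hy2]].
  set (eta := lsum (seq 1 N) (fun m => if Nat.eqb (m mod d) 0 then 0 else Rabs (c (m, (n * m)%nat)))) in *.
  set (A := N1 n N c) in *.
  assert (Heta0 : 0 <= eta).
  { apply lsum_nonneg. intros m _. destruct (Nat.eqb (m mod d) 0); [lra|apply Rabs_pos]. }
  assert (HJy : (1 - 2 * kp) * A <= Jf n N p y).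
  { eapply Rle_trans; [|apply Hy2].
    assert (4 * (INR (p + 1) * supb Rm ^ p * eta) <= kp * A); [|lra].
    apply Rle_trans with (4 * (C * (kp / (1600 * C)))).
    - apply Rmult_le_compat_l; [lra|]. apply Rmult_le_compat; try lra; [|unfold C; lra].
      unfold C in HC. lra.
    - replace (4 * (C * (kp / (1600 * C)))) with (kp * / 400) by (field; lra).
      apply Rmult_le_compat_l; lra. }
  assert (HN1y : 0 < N1 n N y).
  { assert (H0 : 0 <= N1 n N y) by (apply lsum_nonneg; intros k _; destruct (res n k); [apply pow2_ge_0|lra]).
    destruct (Req_dec (N1 n N y) 0) as [E|]; [|lra]. exfalso.
    assert (Jf n N p y = 0).
    { unfold Jf. rewrite (Int2_ext _ (fun _ _ => 0)); [rewrite Int2_const; ring|].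
      intros t x _ _. assert (E2 : up N 0 (rp n y) t x = 0).
      { pose proof (vp_sup n N Hn y 0 t x (Rle_refl 0)) as E3. rewrite E in E3.
        assert (E4 : Rabs (up N 0 (rp n y) t x) <= 17 * 0) by (apply E3; simpl; lra).
        apply Rabs_le_between in E4. lra. }
      rewrite E2. apply pow_i. lia. }
    assert (0 < (1 - 2 * kp) * A) by (apply Rmult_lt_0_compat; lra). lra. }
  destruct (Hlev y HN1y) as [s [Hs0 Hle]].
  assert (Hp1 : 4 <= INR (p + 1)) by (replace 4 with (INR 4) by (simpl; ring); apply le_INR; lia).
  set (z := s ^ 2) in *. assert (Hz0 : 0 <= z) by apply pow2_ge_0.
  assert (Hsz : s ^ (p + 1) = z ^ q) by (unfold z; rewrite <- pow_mult, Hpq; reflexivity).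
  rewrite Hsz in Hle.
  assert (Hzq : 0 <= z ^ q) by now apply pow_le.
  assert (Htan : 1 + INR q * (z - 1) <= z ^ q).
  { pose proof (pow_tangent (q - 1) z 1 Hz0 ltac:(lra)) as E. replace (S (q - 1)) with q in E by lia.
    rewrite !pow1 in E. lra. }
  assert (Hpq' : INR (p + 1) = 2 * INR q) by (rewrite Hpq, mult_INR; reflexivity).
  assert (HA : 0 < A) by lra.
  assert (B1 : z * N1 n N y * (1 + kp) / 2 <= z * (A / 4) * (1 + kp) / 2).
  { unfold Rdiv at 1 3. apply Rmult_le_compat_r; [lra|]. apply Rmult_le_compat_r; [lra|].
    now apply Rmult_le_compat_l. }
  assert (B2 : z ^ q * ((1 - 2 * kp) * A) / INR (p + 1) <= z ^ q * Jf n N p y / INR (p + 1)).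
  { unfold Rdiv. apply Rmult_le_compat_r; [left; apply Rinv_0_lt_compat; lra|]. now apply Rmult_le_compat_l. }
  assert (B3 : 0 <= z ^ q / INR (p + 1)).
  { apply Rmult_le_pos; [assumption|left; apply Rinv_0_lt_compat; lra]. }
  replace (z ^ q * ((1 - 2 * kp) * A) / INR (p + 1)) with (z ^ q / INR (p + 1) * ((1 - 2 * kp) * A)) in B2
    by (unfold Rdiv; ring).
  (* The contradiction is numerical. The left side is at least 0.175; by the tangent at [z = 1] and
     [p + 1 = 2 q] the right side is at most [(1 + kp) / 8 <= 0.1375], for [z <= 1] directly and for
     [z > 1] because the resulting bound decreases in [z]. *)
  assert (B4 : 1 / 4 - 3 / 4 * kp <= z / 4 * (1 + kp) / 2 - z ^ q / INR (p + 1) * (1 - 2 * kp)).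
  { apply Rmult_le_reg_r with A; [assumption|]. unfold Rdiv in *. lra. }
  destruct (Rle_dec z 1) as [Hz1|Hz1].
  - assert (0 <= z ^ q / INR (p + 1) * (1 - 2 * kp)) by (apply Rmult_le_pos; lra). nra.
  - assert (B5 : (z - 1) / 2 <= z ^ q / INR (p + 1)).
    { apply Rmult_le_reg_r with (INR (p + 1)); [lra|]. unfold Rdiv at 2.
      rewrite Rmult_assoc, Rinv_l, Rmult_1_r by lra. rewrite Hpq'. lra. }
    assert (B6 : (z - 1) / 2 * (1 - 2 * kp) <= z ^ q / INR (p + 1) * (1 - 2 * kp)) by (apply Rmult_le_compat_r; lra).
    nra.
Qed.

End Limit.

Lemma scaled_solution : exists U Ut Ux Utt Utx Uxx : R -> R -> R,
  C2_data U Ut Ux Utt Utx Uxx /\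
  (forall t x, 0 <= x <= PI -> (om * INR n) ^ 2 * Utt t x - Uxx t x + mu * g0 (U t x) = 0) /\
  (forall t, U t 0 = 0 /\ U t PI = 0) /\
  (forall t x, U (- t) x = U t x) /\ (forall t x, U (t + 2 * PI) x = U t x) /\
  (forall P, 0 < P < 2 * PI -> ~ (forall t x, 0 <= x <= PI -> U (t + P) x = U t x)).
Proof.
  destruct galerkin_sequence as (M & v & K & HM & Hc).
  exists (lfam M v f00), (lfam M v f10), (lfam M v f01), (lfam M v f20), (lfam M v f11), (lfam M v f02).
  pose proof b00. pose proof b10. pose proof b01. pose proof b20. pose proof b11. pose proof b02.
  split; [split; [|split; [|split]]|].
  - split; [|split; [|split; [|split; [|split]]]]; (eapply jcont_lfam; [exact HM|exact Hc|assumption|]);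
      first [apply j00|apply j10|apply j01|apply j20|apply j11|apply j02].
  - intros t x; split.
    + eapply lfam_derive_t; [exact HM|exact Hc|assumption|assumption|apply d00t].
    + eapply lfam_derive_x; [exact HM|exact Hc|assumption|assumption|apply d00x].
  - intros t x; split.
    + eapply lfam_derive_t; [exact HM|exact Hc|assumption|assumption|apply d10t].
    + eapply lfam_derive_x; [exact HM|exact Hc|assumption|assumption|apply d10x].
  - intros t x; split.
    + eapply lfam_derive_t; [exact HM|exact Hc|assumption|assumption|apply d01t].
    + eapply lfam_derive_x; [exact HM|exact Hc|assumption|assumption|apply d01x].
  - split; [|split; [|split; [|split]]].
    + intros t x Hx. exact (resid_zero M v K HM Hc t x Hx).
    + apply u00_x_0.
    + apply u00_even.
    + apply u00_per.
    + exact (no_smaller_period M v K HM Hc).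
Qed.
End Solve.

(** * Rescaling the nonlinearity *)

Section Nonlinearity.
Variables (p : nat) (f : R -> R) (a : R).
Hypothesis HC : Ck p f.
Hypothesis Hz : forall k, (k < p)%nat -> Derive_n f k 0 = 0.
Hypothesis Hap : Derive_n f p 0 = a * INR (fact p).
Hypothesis Hp3 : (3 <= p)%nat.
Hypothesis Ha : a <> 0.

Notation fd := (Derive_n f).

Lemma fd_derive i y : (i < p)%nat -> is_derive (fd i) y (fd (S i) y).
Proof. intros Hi. apply Derive_correct. apply (proj1 HC (S i) y). lia. Qed.
Lemma fd_cont i : (i <= p)%nat -> cont (fd i).
Proof.
  intros Hi. destruct (Nat.eq_dec i p) as [->|Hne]; [exact (proj2 HC)|].
  apply (cont_derive (fd i) (fd (S i))). intros y. apply fd_derive. lia.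
Qed.

(** Induction downwards from the derivative of order [p], where the estimate is continuity at 0.
    Each lower derivative vanishes at 0 along with its model, so the mean value inequality
    integrates the bound. *)
Lemma taylor_at_0 e : 0 < e -> exists eta, 0 < eta /\ forall j y, (j <= p)%nat -> Rabs y <= eta ->
  Rabs (fd (p - j) y - a * INR (fact p) / INR (fact j) * y ^ j) <= e * Rabs y ^ j.
Proof.
  intros He. destruct (cont_eps (fd p) 0 (fd_cont p (le_n p)) e He) as [d [Hd Hd']].
  exists (d / 2). split; [lra|]. intros j. induction j as [|j IH]; intros y Hj Hy.
  - rewrite Nat.sub_0_r. specialize (Hd' y). rewrite Rminus_0_r, Hap in Hd'. simpl.
    replace (a * INR (fact p) / 1 * 1) with (a * INR (fact p)) by field.
    rewrite Rmult_1_r. left. apply Hd'. lra.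
  - assert (Hfj : INR (fact j) <> 0) by apply INR_fact_neq_0.
    set (A := a * INR (fact p)) in *.
    pose proof (lipschitz_of_derive (fun z => fd (p - S j) z - A / INR (fact (S j)) * z ^ S j)
      (fun z => fd (p - j) z - A / INR (fact j) * z ^ j) (Rabs y) (e * Rabs y ^ j)) as E.
    specialize (fun H1 H2 => E H1 H2 y 0 (Rle_refl _)). cbv beta in E.
    rewrite Hz, pow_i, Rmult_0_r, !Rminus_0_r, Rabs_R0 in E by lia.
    replace (e * Rabs y ^ S j) with (e * Rabs y ^ j * Rabs y) by (simpl; ring).
    apply E; [| |apply Rabs_pos].
    + intros z. apply (is_derive_minus (fd (p - S j)) (fun z => A / INR (fact (S j)) * z ^ S j)).
      * replace (p - j)%nat with (S (p - S j)) by lia. apply fd_derive. lia.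
      * replace (A / INR (fact j) * z ^ j) with (A / INR (fact (S j)) * (INR (S j) * 1 * z ^ Init.Nat.pred (S j))).
        -- apply is_derive_scal. apply (is_derive_pow (fun z => z) (S j) z 1). apply (is_derive_id z).
        -- rewrite fact_simpl, mult_INR. simpl Init.Nat.pred. field. split; [assumption|apply not_0_INR; lia].
    + intros z Hzy. eapply Rle_trans; [apply IH; [lia|lra]|].
      apply Rmult_le_compat_l; [lra|]. apply pow_incr. split; [apply Rabs_pos|assumption].
Qed.

(** The [i]-th derivative of the rescaled nonlinearity [f (d y) / (a d^p)]. *)
Definition gs (d : R) (i : nat) (y : R) : R := d ^ i / (a * d ^ p) * fd i (d * y).

Lemma gs_derive d i y : (i < p)%nat -> is_derive (gs d i) y (gs d (S i) y).
Proof.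
  intros Hi. unfold gs.
  replace (d ^ S i / (a * d ^ p) * fd (S i) (d * y)) with (d ^ i / (a * d ^ p) * (d * fd (S i) (d * y)))
    by (simpl; unfold Rdiv; ring).
  apply is_derive_scal. apply (is_derive_comp (fd i) (fun y => d * y)).
  - now apply fd_derive.
  - auto_derive; [trivial|ring].
Qed.
Lemma gs_0 d : gs d 0 0 = 0.
Proof. unfold gs. rewrite Rmult_0_r, Hz by lia. ring. Qed.

(** Comparison with the [i]-th derivative of [y^p]: since [p = i + (p - i)] the powers of [d] cancel
    exactly, and what remains of the Taylor error on [|y| <= B] is independent of [d]. *)
Lemma gs_approx B e : 1 <= B -> 0 < e -> exists d0, 0 < d0 /\ forall d i y, 0 < d < d0 -> (i <= p)%nat ->
  Rabs y <= B -> Rabs (gs d i y - INR (fact p) / INR (fact (p - i)) * y ^ (p - i)) <= e.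
Proof.
  intros HB He.
  assert (Haa : 0 < Rabs a) by now apply Rabs_pos_lt.
  assert (HBp : 0 < B ^ p) by (apply pow_lt; lra).
  assert (He1 : 0 < e * Rabs a / B ^ p) by (apply Rdiv_lt_0_compat; [now apply Rmult_lt_0_compat|assumption]).
  destruct (taylor_at_0 _ He1) as [eta [Heta H]].
  exists (eta / B). split; [apply Rdiv_lt_0_compat; lra|]. intros d i y Hd Hi Hy.
  assert (HdB : d * B <= eta).
  { apply Rle_trans with (eta / B * B); [apply Rmult_le_compat_r; lra|]. right. field. lra. }
  assert (Hdy : Rabs (d * y) <= eta).
  { rewrite Rabs_mult, (Rabs_right d) by lra. eapply Rle_trans; [|apply HdB]. apply Rmult_le_compat_l; lra. }
  specialize (H (p - i)%nat (d * y) ltac:(lia) Hdy). replace (p - (p - i))%nat with i in H by lia.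
  set (j := (p - i)%nat) in *. assert (Hpj : p = (i + j)%nat) by (unfold j; lia).
  assert (Hdi : 0 < d ^ i) by (apply pow_lt; lra). assert (Hdj : 0 < d ^ j) by (apply pow_lt; lra).
  assert (Hdp : d ^ p = d ^ i * d ^ j) by (rewrite Hpj, pow_add; reflexivity).
  assert (Hfj : INR (fact j) <> 0) by apply INR_fact_neq_0.
  unfold gs. replace (d ^ i / (a * d ^ p) * fd i (d * y) - INR (fact p) / INR (fact j) * y ^ j)
    with (/ (a * d ^ j) * (fd i (d * y) - a * INR (fact p) / INR (fact j) * (d * y) ^ j)).
  - rewrite Rabs_mult, Rabs_inv, Rabs_mult, (Rabs_right (d ^ j)) by lra.
    apply Rmult_le_reg_l with (Rabs a * d ^ j); [now apply Rmult_lt_0_compat|].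
    rewrite <- Rmult_assoc, Rinv_r, Rmult_1_l by (apply Rgt_not_eq; now apply Rmult_lt_0_compat).
    eapply Rle_trans; [apply H|]. rewrite Rabs_mult, Rpow_mult_distr, (Rabs_right d) by lra.
    replace (Rabs a * d ^ j * e) with (e * Rabs a / B ^ p * (d ^ j * B ^ p)) by (field; lra).
    apply Rmult_le_compat_l; [lra|]. apply Rmult_le_compat_l; [lra|].
    apply Rle_trans with (B ^ j); [apply pow_incr; split; [apply Rabs_pos|assumption]|].
    apply Rle_pow; [assumption|lia].
  - rewrite Hdp, Rpow_mult_distr. field. repeat split; try assumption; lra.
Qed.
End Nonlinearity.

(** With [w = n l], the product of [|om w - j| >= gam / w] and [om w + j >= om w] is at least
    [om gam]. For [l = 0] the symbol is [j^2 >= 1], and [gam <= 4/3] makes this sufficient. *)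
Lemma lam_lower n om gam k : (1 <= n)%nat -> 4 / 5 <= om <= 4 / 3 -> 0 < gam <= 4 / 3 -> in_W gam om ->
  (1 <= snd k)%nat -> res n k = false -> 3 / 4 * gam <= Rabs (lam n om k).
Proof.
  intros Hn Hom Hgam HW Hk Hr. destruct k as [l j]. unfold lam, res in *; simpl in Hr, Hk |- *.
  apply Nat.eqb_neq in Hr. assert (Hj : 1 <= INR j) by (apply (le_INR 1); lia).
  destruct (Nat.eq_dec l 0) as [->|Hl].
  - simpl INR. rewrite Rabs_right; nra.
  - assert (Hnl : 1 <= INR (n * l)) by (apply (le_INR 1); nia).
    specialize (HW (n * l)%nat j ltac:(nia) Hr). rewrite mult_INR in *.
    set (w := INR n * INR l) in *.
    replace (INR j * (INR j * 1) - om * INR n * INR l * (om * INR n * INR l * 1))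
      with ((om * w - INR j) * - (om * w + INR j)) by (unfold w; ring).
    rewrite Rabs_mult, Rabs_Ropp, (Rabs_right (om * w + INR j)) by nra.
    apply Rge_le in HW. apply Rle_trans with (gam / w * (om * w)).
    + replace (gam / w * (om * w)) with (om * gam) by (field; lra). apply Rmult_le_compat_r; lra.
    + apply Rmult_le_compat; try nra. left. apply Rdiv_lt_0_compat; lra.
Qed.

Lemma periodic_mult (h : R -> R) T : (forall t, h (t + T) = h t) -> forall n t, h (t + INR n * T) = h t.
Proof.
  intros H n. induction n as [|n IH]; intros t; [simpl; f_equal; ring|].
  rewrite S_INR. replace (t + (INR n + 1) * T) with (t + INR n * T + T) by ring. now rewrite H.
Qed.

(** Undoes the scaling by [u t x = d * U (n om t) x], where [a d^(p-1) = mu] matches the nonlinear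
    terms. The equation is invariant under the shift and reflection that define [v]; the Dirichlet
    conditions exchange ends. *)
Lemma solution_pair f n om mu a p d (U Ut Ux Utt Utx Uxx : R -> R -> R) :
  (1 <= n)%nat -> 0 < om -> 0 < d -> a <> 0 -> a * d ^ (p - 1) = mu -> (1 <= p)%nat ->
  C2_data U Ut Ux Utt Utx Uxx ->
  (forall t x, 0 <= x <= PI -> (om * INR n) ^ 2 * Utt t x - Uxx t x + mu * gs p f a d 0 (U t x) = 0) ->
  (forall t, U t 0 = 0 /\ U t PI = 0) ->
  (forall t x, U (- t) x = U t x) -> (forall t x, U (t + 2 * PI) x = U t x) ->
  (forall P, 0 < P < 2 * PI -> ~ (forall t x, 0 <= x <= PI -> U (t + P) x = U t x)) ->
  exists u : R -> R -> R,
    let T := 2 * PI / (INR n * om) in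
    let v := fun t x => u (t + PI / om) (PI - x) in
    is_solution f u /\ even_in_time u /\ minimal_period u T /\
    is_solution f v /\ even_in_time v /\ minimal_period v T.
Proof.
  intros Hn Hom Hd Ha Hmu Hp HU Hpde Hbd Hev Hper Hmin.
  assert (Hn' : 0 < INR n) by (apply lt_0_INR; lia). pose proof PI_RGT_0 as Hpi.
  set (s := INR n * om). assert (Hs : 0 < s) by now apply Rmult_lt_0_compat.
  pose proof (C2_data_affine U Ut Ux Utt Utx Uxx d s 0 1 0 HU) as Hu.
  set (u := fun t x => d * U (s * t + 0) (1 * x + 0)) in *.
  pose proof (C2_data_affine _ _ _ _ _ _ 1 1 (PI / om) (-1) PI Hu) as Hv.
  assert (HT : 0 < 2 * PI / s) by (apply Rdiv_lt_0_compat; lra).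
  assert (Hup : forall t x, u (t + 2 * PI / s) x = u t x).
  { intros t x. unfold u. replace (s * (t + 2 * PI / s) + 0) with (s * t + 0 + 2 * PI) by (field; lra).
    now rewrite Hper. }
  assert (Hue : forall t x, u (- t) x = u t x).
  { intros t x. unfold u. rewrite <- (Hev (s * t + 0)). now replace (- (s * t + 0)) with (s * - t + 0) by ring. }
  assert (Humin : forall T', 0 < T' < 2 * PI / s -> ~ has_period u T').
  { intros T' HT' HP. apply (Hmin (s * T')).
    - split; [apply Rmult_lt_0_compat; lra|]. apply Rmult_lt_reg_r with (/ s); [now apply Rinv_0_lt_compat|].
      replace (s * T' * / s) with T' by (field; lra). apply HT'.
    - intros t x Hx. specialize (HP (t / s) x Hx). unfold u in HP.
      replace (s * (t / s + T') + 0) with (t + s * T') in HP by (field; lra).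
      replace (s * (t / s) + 0) with t in HP by (field; lra).
      replace (1 * x + 0) with x in HP by ring. apply Rmult_eq_reg_l with d; lra. }
  assert (Hodd : forall y, f (d * y) = d * (mu * gs p f a d 0 y)).
  { intros y. unfold gs. simpl Derive_n. rewrite <- Hmu.
    replace (d ^ p) with (d * d ^ (p - 1)).
    - simpl. field. split; [|split]; [apply pow_nonzero; lra|lra|assumption].
    - destruct p as [|p']; [lia|]. simpl. now rewrite Nat.sub_0_r. }
  assert (Hupde : forall t x, 0 <= x <= PI ->
    d * s * s * Utt (s * t + 0) (1 * x + 0) - d * 1 * 1 * Uxx (s * t + 0) (1 * x + 0) + f (u t x) = 0).
  { intros t x Hx. unfold u. rewrite Hodd. specialize (Hpde (s * t + 0) (1 * x + 0) ltac:(lra)).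
    apply (f_equal (Rmult d)) in Hpde. rewrite Rmult_0_r in Hpde. etransitivity; [|exact Hpde]. unfold s. ring. }
  exists u. cbv zeta. fold s. set (v := fun t x => u (t + PI / om) (PI - x)).
  assert (Ev : (fun t x => 1 * u (1 * t + PI / om) (-1 * x + PI)) = v).
  { do 2 (apply functional_extensionality; intro). unfold v. rewrite Rmult_1_l. f_equal; ring. }
  rewrite Ev in Hv.
  destruct (C2_of_data _ _ _ _ _ _ Hu) as (Cu & Eu1 & Eu2).
  destruct (C2_of_data _ _ _ _ _ _ Hv) as (Cv & Ev1 & Ev2).
  (* The two times differ by [2 PI / om], which is [n] periods; with evenness of [u] this makes [v]
     even. *)
  assert (Hshift : forall t x, u (t + PI / om) x = u (t - PI / om) x).
  { intros t x. rewrite <- (periodic_mult (fun t => u t x) (2 * PI / s) (fun t => Hup t x) n (t - PI / om)).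
    f_equal. unfold s. field. lra. }
  split; [|split; [|split; [|split; [|split]]]].
  - split; [exact Cu|]. split.
    + intros t x Hx. rewrite Eu1, Eu2. now apply Hupde.
    + intros t. unfold u. rewrite Rmult_0_r, Rplus_0_l, Rmult_1_l.
      replace (PI + 0) with PI by ring. destruct (Hbd (s * t + 0)) as [-> ->]. lra.
  - intros t x _. apply Hue.
  - split; [exact HT|]. split; [|exact Humin]. intros t x _. apply Hup.
  - split; [exact Cv|]. split.
    + intros t x Hx. rewrite Ev1, Ev2.
      etransitivity; [|exact (Hupde (t + PI / om) (PI - x) ltac:(lra))]. unfold v.
      replace (1 * t + PI / om) with (t + PI / om) by ring. replace (-1 * x + PI) with (PI - x) by ring. ring.
    + intros t. unfold v, u. destruct (Hbd (s * (t + PI / om) + 0)) as [E1 E2].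
      replace (1 * (PI - 0) + 0) with PI by ring. replace (1 * (PI - PI) + 0) with 0 by ring.
      rewrite E1, E2. lra.
  - intros t x _. unfold v. rewrite <- Hue. replace (- (- t + PI / om)) with (t - PI / om) by ring.
    symmetry. apply Hshift.
  - split; [exact HT|]. split.
    + intros t x _. unfold v. rewrite <- (Hup (t + PI / om)). f_equal. ring.
    + intros T' HT' HP. apply (Humin T' HT'). intros t x Hx.
      specialize (HP (t - PI / om) (PI - x) ltac:(lra)). unfold v in HP.
      replace (t - PI / om + T' + PI / om) with (t + T') in HP by ring.
      replace (t - PI / om + PI / om) with t in HP by ring.
      now replace (PI - (PI - x)) with x in HP by ring.
Qed.

(** * Fixing the constants *)

Theorem theorem4p7 :
  forall p : nat, Nat.Odd p -> (3 <= p)%nat ->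
  exists r : nat,
  forall (f : R -> R) (a : R),
    Ck r f ->
    (forall k, (k < p)%nat -> Derive_n f k 0 = 0) ->
    a <> 0 ->
    Derive_n f p 0 = a * INR (Stdlib.Arith.Factorial.fact p) ->
    exists C10 : R, 0 < C10 /\
    forall (omega gamma : R) (n : nat),
      in_Wcal omega ->
      is_gamma_omega omega gamma ->
      (1 <= n)%nat ->
      Rabs (omega - 1) * (INR n) ^ 2 / gamma <= C10 ->
      (0 < a -> 1 < omega) ->
      (a < 0 -> omega < 1) ->
      exists u : R -> R -> R,
        let T := 2 * PI / (INR n * omega) in
        let v := fun t x => u (t + PI / omega) (PI - x) in
        is_solution f u /\ even_in_time u /\ minimal_period u T /\
        is_solution f v /\ even_in_time v /\ minimal_period v T.
Proof.
  (* Regularity [r = p] is enough: the expansion at 0 uses continuity of the derivative of order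
     [p], and the estimates need three continuous derivatives. *)
  intros p [m Hm] Hp3. exists p. intros f a HC Hz Ha Hap.
  set (q := S m). assert (Hq : (2 <= q)%nat) by (unfold q; lia).
  assert (Hpq : (p + 1 = 2 * q)%nat) by (unfold q; lia).
  set (Rr := 8 * (1 + INR (p + 1) * 4 ^ (q - 1)) + 1). set (Rm := Rr + 1).
  assert (HRr : 9 <= Rr).
  { unfold Rr. assert (0 <= INR (p + 1) * 4 ^ (q - 1)); [|lra].
    apply Rmult_le_pos; [apply pos_INR|apply pow_le; lra]. }
  assert (HRrQ : 8 * (1 + INR (p + 1) * 4 ^ (q - 1)) < Rr ^ 2).
  { apply Rlt_le_trans with Rr; [unfold Rr; lra|nra]. }
  set (B := supb Rm). assert (HB : 1 <= B) by (unfold B, supb, Rm; lra).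
  set (G := INR (fact p) * B ^ p + 1). set (W := 2 * (1 + Cp Rm p) ^ 2 + 1156 * Cp Rm p ^ 2).
  assert (HBp : 1 <= B ^ p) by (apply pow_R1_Rle; assumption).
  assert (Hfp : 1 <= INR (fact p)) by (apply (le_INR 1), lt_O_fact).
  assert (HG : 1 <= G) by (unfold G; nra).
  assert (HW0 : 0 <= W) by (unfold W; pose proof (pow2_ge_0 (1 + Cp Rm p)); pose proof (pow2_ge_0 (Cp Rm p)); lra).
  (* One quantity exceeding all coefficients that multiply [kap^2] in the smallness hypotheses; with
     [kap = 1 / Z] each product is at most [1/1000]. *)
  set (Z := 1000 * ((1 + W) * (G ^ 2 * (1152 * (Rm ^ 2 + 1) + 5)))).
  assert (HG2 : 1 <= G ^ 2) by nra. assert (HRm2 : 0 <= Rm ^ 2) by apply pow2_ge_0.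
  assert (HZW : 1000 * (W * G ^ 2) <= Z).
  { unfold Z. apply Rmult_le_compat_l; [lra|]. apply Rmult_le_compat; nra. }
  assert (HZR : 1000 * (G ^ 2 * (1152 * (Rm ^ 2 + 1) + 5)) <= Z).
  { unfold Z. apply Rmult_le_compat_l; [lra|].
    assert (0 <= G ^ 2 * (1152 * (Rm ^ 2 + 1) + 5)) by nra. nra. }
  assert (HZ1 : 1 <= Z) by nra.
  set (k0 := / Z). assert (Hk0 : 0 < k0 <= 1).
  { split; [apply Rinv_0_lt_compat; lra|]. rewrite <- Rinv_1. apply Rinv_le_contravar; lra. }
  assert (HkZ : k0 * Z = 1) by (apply Rinv_l; lra).
  assert (Hk02 : k0 ^ 2 * Z <= 1) by nra.
  destruct (gs_approx p f a HC Hz Hap Hp3 Ha B (/ 100) HB ltac:(lra)) as [d0 [Hd0 Happ]].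
  assert (Haa : 0 < Rabs a) by now apply Rabs_pos_lt.
  assert (Hdp : 0 < d0 ^ (p - 1)) by now apply pow_lt.
  (* The first bound puts [omega] into [[4/5, 4/3]], the second gives [|mu| <= k0] and
     [|mu| <= k0 |lam|] off resonance, and the third makes the amplitude [d] smaller than [d0]. *)
  set (C10 := Rmin (/ 4) (Rmin (k0 / 4) (Rabs a * d0 ^ (p - 1) / 8))).
  assert (HC10 : 0 < C10).
  { apply Rmin_pos; [lra|]. apply Rmin_pos; [lra|]. apply Rdiv_lt_0_compat; [now apply Rmult_lt_0_compat|lra]. }
  exists C10. split; [assumption|]. intros om gam n [gam' [Hgam'0 Hgam']] [HW Hmax] Hn HC10le Hpos Hneg.
  assert (Hc1 : C10 <= / 4) by apply Rmin_l.
  assert (Hc2 : C10 <= k0 / 4) by (eapply Rle_trans; [apply Rmin_r|apply Rmin_l]).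
  assert (Hc3 : C10 <= Rabs a * d0 ^ (p - 1) / 8) by (eapply Rle_trans; [apply Rmin_r|apply Rmin_r]).
  assert (Hgam : 0 < gam) by (specialize (Hmax gam' Hgam'); lra).
  assert (Hn' : 1 <= INR n) by (apply (le_INR 1); lia).
  assert (Hn2 : 1 <= INR n ^ 2) by (apply pow_R1_Rle; lra).
  assert (Hw1 : Rabs (om - 1) * INR n ^ 2 <= C10 * gam).
  { apply (Rmult_le_compat_r gam) in HC10le; [|lra].
    unfold Rdiv in HC10le. rewrite Rmult_assoc, Rinv_l, Rmult_1_r in HC10le by lra. exact HC10le. }
  (* The pair [l = 1], [j = 0] in the definition of [W_gamma]. *)
  assert (Hgo : gam <= Rabs om).
  { specialize (HW 1%nat 0%nat ltac:(lia) ltac:(lia)). simpl INR in HW.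
    rewrite Rmult_1_r, Rminus_0_r in HW. unfold Rdiv in HW. rewrite Rinv_1, Rmult_1_r in HW. lra. }
  assert (Hw2 : Rabs (om - 1) <= Rabs om / 4).
  { pose proof (Rabs_pos (om - 1)). assert (Rabs (om - 1) <= Rabs (om - 1) * INR n ^ 2).
    { rewrite <- (Rmult_1_r (Rabs (om - 1))) at 1. apply Rmult_le_compat_l; lra. }
    assert (C10 * gam <= / 4 * Rabs om) by (apply Rmult_le_compat; lra). lra. }
  assert (Hom : 4 / 5 <= om <= 4 / 3).
  { unfold Rabs in Hw2. destruct (Rcase_abs (om - 1)), (Rcase_abs om); lra. }
  assert (Hgam43 : gam <= 4 / 3) by (rewrite Rabs_right in Hgo; lra).
  set (mu := (om ^ 2 - 1) * INR n ^ 2).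
  assert (Hmu_abs : Rabs mu <= 7 / 3 * (C10 * gam)).
  { unfold mu. replace ((om ^ 2 - 1) * INR n ^ 2) with ((om + 1) * ((om - 1) * INR n ^ 2)) by ring.
    rewrite !Rabs_mult, (Rabs_right (om + 1)), (Rabs_right (INR n ^ 2)) by lra.
    apply Rmult_le_compat; try lra. apply Rmult_le_pos; [apply Rabs_pos|lra]. }
  (* This is where the sign condition relating [a] and [omega] enters; it makes the amplitude below
     a genuine root. *)
  assert (Hmua : 0 < mu / a).
  { unfold mu, Rdiv.
    destruct (Rlt_dec 0 a) as [Ha0|Ha0].
    - specialize (Hpos Ha0). apply Rmult_lt_0_compat; [|now apply Rinv_0_lt_compat].
      apply Rmult_lt_0_compat; [|lra]. clear - Hpos. nra.
    - assert (Ha1 : a < 0) by lra. specialize (Hneg Ha1).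
      replace ((om ^ 2 - 1) * INR n ^ 2 * / a) with ((1 - om ^ 2) * INR n ^ 2 * / - a) by (field; lra).
      apply Rmult_lt_0_compat; [|apply Rinv_0_lt_compat; lra].
      apply Rmult_lt_0_compat; [|lra]. clear - Hneg Hom. nra. }
  assert (Hmu0 : mu <> 0) by (intros E; rewrite E in Hmua; unfold Rdiv in Hmua; lra).
  assert (Hmuk : Rabs mu <= k0) by (assert (C10 * gam <= k0 / 4 * (4 / 3)) by (apply Rmult_le_compat; lra); lra).
  set (d := Rpower (mu / a) (/ INR (p - 1))).
  assert (Hd : 0 < d) by apply exp_pos.
  assert (Hdpow : d ^ (p - 1) = mu / a).
  { rewrite <- Rpower_pow by assumption. unfold d. rewrite Rpower_mult, Rinv_l, Rpower_1; auto.
    apply not_0_INR. lia. }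
  assert (Hdd0 : d < d0).
  { apply Rnot_le_lt. intros Hle. assert (E : d0 ^ (p - 1) <= d ^ (p - 1)) by (apply pow_incr; lra).
    rewrite Hdpow in E. rewrite <- (Rabs_right (mu / a)) in E by lra.
    unfold Rdiv in E. rewrite Rabs_mult, Rabs_inv in E.
    apply (Rmult_le_compat_r (Rabs a)) in E; [|lra]. rewrite Rmult_assoc, Rinv_l, Rmult_1_r in E by lra.
    assert (C10 * gam <= Rabs a * d0 ^ (p - 1) / 8 * (4 / 3)) by (apply Rmult_le_compat; lra).
    assert (0 < Rabs a * d0 ^ (p - 1)) by now apply Rmult_lt_0_compat. nra. }
  assert (Hgs : forall i y, (i <= p)%nat -> Rabs y <= B ->
     Rabs (gs p f a d i y - INR (fact p) / INR (fact (p - i)) * y ^ (p - i)) <= / 100)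
    by (intros; apply Happ; auto).
  assert (HgB : forall i y, (i <= p)%nat -> Rabs y <= B -> Rabs (gs p f a d i y) <= G).
  { intros i y Hi Hy. specialize (Hgs i y Hi Hy).
    replace (gs p f a d i y) with ((gs p f a d i y - INR (fact p) / INR (fact (p - i)) * y ^ (p - i))
      + INR (fact p) / INR (fact (p - i)) * y ^ (p - i)) by ring.
    eapply Rle_trans; [apply Rabs_triang|]. unfold G. rewrite Rplus_comm.
    apply Rplus_le_compat; [|lra]. rewrite Rabs_mult, <- RPow_abs.
    assert (Hfi : 1 <= INR (fact (p - i))) by (apply (le_INR 1), lt_O_fact).
    assert (Hq1 : 0 <= INR (fact p) / INR (fact (p - i)) <= INR (fact p)).
    { split; [apply Rmult_le_pos; [lra|left; apply Rinv_0_lt_compat; lra]|].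
      unfold Rdiv. rewrite <- (Rmult_1_r (INR (fact p))) at 2. apply Rmult_le_compat_l; [lra|].
      rewrite <- Rinv_1. apply Rinv_le_contravar; lra. }
    rewrite (Rabs_right (INR (fact p) / _)) by lra.
    apply Rmult_le_compat; [lra|apply pow_le, Rabs_pos|lra|].
    apply Rle_trans with (B ^ (p - i)); [apply pow_incr; split; [apply Rabs_pos|assumption]|].
    apply Rle_pow; [assumption|lia]. }
  assert (Hgd : forall i y, (i < p)%nat -> is_derive (gs p f a d i) y (gs p f a d (S i) y))
    by (intros; now apply gs_derive).
  assert (Hg3 : cont (gs p f a d 3)).
  { unfold gs. apply cont_mult; [auto with jc|]. apply cont_lin. now apply (fd_cont p f HC). }
  assert (Hg1p : forall y, Rabs y <= supb Rm -> Rabs (gs p f a d 1 y - INR p * y ^ (p - 1)) <= / 100).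
  { intros y Hy. specialize (Hgs 1%nat y ltac:(lia) Hy).
    replace (INR (fact p) / INR (fact (p - 1))) with (INR p) in Hgs; [exact Hgs|].
    destruct p as [|p']; [lia|]. rewrite fact_simpl, mult_INR. simpl Nat.sub. rewrite Nat.sub_0_r.
    field. apply INR_fact_neq_0. }
  assert (Hnr : forall k : mode, (1 <= snd k)%nat -> res n k = false ->
    lam n om k <> 0 /\ Rabs mu <= k0 * Rabs (lam n om k)).
  { intros k Hk Hr. pose proof (lam_lower n om gam k Hn Hom (conj Hgam Hgam43) HW Hk Hr) as Hl. split.
    - intros E. rewrite E, Rabs_R0 in Hl. lra.
    - assert (C10 * gam <= k0 / 4 * (4 / 3 * Rabs (lam n om k))) by (apply Rmult_le_compat; lra). nra. }
  assert (Hk0W : k0 ^ 2 * (W * G ^ 2) <= / 1000) by (pose proof (pow2_ge_0 k0); nra).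
  assert (Hk0R : k0 ^ 2 * (G ^ 2 * (1152 * (Rm ^ 2 + 1) + 5)) <= / 1000) by (pose proof (pow2_ge_0 k0); nra).
  assert (Hmu2 : mu ^ 2 <= k0 ^ 2) by (rewrite <- (pow2_abs mu); apply pow_incr; split; [apply Rabs_pos|assumption]).
  (* With [eps = 1/100] and [kp = 1/10], [Hkp2] amounts to [3 (1/10000 + 1/1000) <= 1/100]. *)
  destruct (scaled_solution n om mu k0 Rm G (gs p f a d 0) (gs p f a d 1) (gs p f a d 2) (gs p f a d 3)
    p q (/ 100) (1 / 10) Rr) as (U & Ut & Ux & Utt & Utx & Uxx & HU & Hpde & Hbd & Hev & Hper & Hmin);
    try assumption; try reflexivity; try lra; try (intros; apply Hgd; lia).
  - now apply (gs_0 p f a Hz).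
  - intros y Hy. repeat split; apply HgB; auto; lia.
  - assert (HX : 0 <= G ^ 2 * (Rm ^ 2 + 5)) by (apply Rmult_le_pos; lra).
    assert (HY : G ^ 2 * (Rm ^ 2 + 5) <= G ^ 2 * (1152 * (Rm ^ 2 + 1) + 5)) by (apply Rmult_le_compat_l; lra).
    pose proof (pow2_ge_0 k0).
    apply Rle_trans with ((2 * k0 ^ 2) * (G ^ 2 * (1152 * (Rm ^ 2 + 1) + 5))); [|lra].
    apply Rmult_le_compat; try lra. pose proof (pow2_ge_0 mu). lra.
  - assert (HY : 2 * G ^ 2 * (1152 * (Rm ^ 2 + 1) + 1) <= 2 * (G ^ 2 * (1152 * (Rm ^ 2 + 1) + 5))) by nra.
    pose proof (pow2_ge_0 k0). nra.
  - assert (HCp : 0 <= Cp Rm p).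
    { unfold Cp. apply Rmult_le_pos; [apply Rmult_le_pos; apply pos_INR|]. apply pow_le. fold B. lra. }
    assert (HY : 2 * (/ 100 + Cp Rm p) ^ 2 + 1156 * Cp Rm p ^ 2 <= W).
    { unfold W. apply Rplus_le_compat_r. apply Rmult_le_compat_l; [lra|]. apply pow_incr. lra. }
    assert (HX : (2 * (/ 100 + Cp Rm p) ^ 2 + 1156 * Cp Rm p ^ 2) * (k0 ^ 2 * G ^ 2) <= W * (k0 ^ 2 * G ^ 2)).
    { apply Rmult_le_compat_r; [|assumption]. apply Rmult_le_pos; [apply pow2_ge_0|lra]. }
    lra.
  - apply (solution_pair f n om mu a p d U Ut Ux Utt Utx Uxx); auto; try lra; try lia.
    rewrite Hdpow. field. assumption.
Qed.
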